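(* Let $\mathcal L$ be a language enriching the language of rings $\mathcal L_{\mathrm{rg}}$, let $T$ be an $\mathcal L$-theory of large fields and let $K$ be an $\mathcal L$-structure that is a field. The following are equivalent: (i) for every geometrically integral totally $T$ variety $V$ over $K$, we have $V(K)\neq\emptyset$; (ii) for every geometrically integral totally $T$ variety $V$ over $K$, $V(K)$ is Zariski dense in $V$; (iii) any regular totally $T$ field extension $K\leq F$ is $\mathcal L_{\mathrm{rg}}$-existentially closed (that is, $K$ is existentially closed in $F$ as a ring). Moreover, in (i) and in (ii), one may equivalently restrict to affine varieties $V$.
   Context: $\mathcal L_{\mathrm{rg}}=\{+,-,\cdot,0,1\}$. A variety over a field $K$ is a separated integral scheme of finite type over $K$; $V_{\mathrm{sm}}(M)$ denotes the set of smooth $M$-rational points. A field $K$ is large if every irreducible variety $V$ over $K$ with $V_{\mathrm{sm}}(K)\neq\emptyset$ has $V(K)$ Zariski dense in $V$. A variety $V$ over $K$ is geometrically integral if and only if the extension $K\leq K(V)$ is regular; a field extension $K\le F$ is regular if $F$ is linearly disjoint over $K$ from the algebraic closure of $K$. $T_K$ denotes the theory of models of $T$ containing $K$ (as an $\mathcal L$-substructure). A field extension $K\leq F$ is totally $T$ if for every $M\models T_K$, $F$ embeds over $K$ as a ring ($\mathcal L_{\mathrm{rg}}(K)$-embeds) in some elementary extension $M^\star\succcurlyeq M$. A variety $V$ over $K$ is totally $T$ if $V_{\mathrm{sm}}(M)\neq\emptyset$ for every $M\models T_K$. *)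

(* Defs.v *)
From HB Require Import structures.
From mathcomp Require Export all_boot all_algebra all_classical.
From mathcomp Require Export topology_structure discrete_topology.
From mathcomp Require Export mpoly.

Set Implicit Arguments.
Unset Strict Implicit.
Unset Printing Implicit Defensive.
Import GRing.Theory.
Local Open Scope classical_set_scope.
Local Open Scope ring_scope.

Record language : Type := Language {
  fsym : Type; farity : fsym -> nat;
  rsym : Type; rarity : rsym -> nat
}.

Record structure (L : language) : Type := Structure {
  carrier :> Type;
  finterp : forall f : fsym L, ('I_(farity f) -> carrier) -> carrier;
  rinterp : forall r : rsym L, ('I_(rarity r) -> carrier) -> Prop
}.

Inductive term (L : language) : Type :=
| Var of nat
| App (f : fsym L) of ('I_(farity f) -> term L).

Inductive formula (L : language) : Type :=
| Equal of term L & term L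
| Rel (r : rsym L) of ('I_(rarity r) -> term L)
| Neg of formula L
| Conj of formula L & formula L
| Ex of nat & formula L.

Section Semantics.
Variables (L : language) (M : structure L).

Fixpoint tval (v : nat -> M) (t : term L) : M :=
  match t with
  | Var n => v n
  | App _ a => finterp (fun i => tval v (a i))
  end.

Definition update (v : nat -> M) (n : nat) (x : M) : nat -> M :=
  fun m => if m == n then x else v m.

Fixpoint sat (v : nat -> M) (phi : formula L) : Prop :=
  match phi with
  | Equal t u => tval v t = tval v u
  | Rel _ a => rinterp (fun i => tval v (a i))
  | Neg psi => ~ sat v psi
  | Conj psi chi => sat v psi /\ sat v chi
  | Ex n psi => exists x : M, sat (update v n x) psi
  end.

Definition models (T : set (formula L)) : Prop :=
  forall phi, T phi -> forall v, sat v phi.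

End Semantics.

Section Syntax.
Variable L : language.

Fixpoint tvars (t : term L) : set nat :=
  match t with
  | Var n => [set n]
  | App _ a => [set m | exists i, tvars (a i) m]
  end.

Fixpoint free_vars (phi : formula L) : set nat :=
  match phi with
  | Equal t u => tvars t `|` tvars u
  | Rel _ a => [set m | exists i, tvars (a i) m]
  | Neg psi => free_vars psi
  | Conj psi chi => free_vars psi `|` free_vars chi
  | Ex n psi => free_vars psi `\ n
  end.

Definition sentence : set (formula L) := [set phi | free_vars phi = set0].

Fixpoint qfree (phi : formula L) : bool :=
  match phi with
  | Equal _ _ | Rel _ _ => true
  | Neg psi => qfree psi
  | Conj psi chi => qfree psi && qfree chi
  | Ex _ _ => false
  end.

Fixpoint existential (phi : formula L) : bool :=
  if phi is Ex _ psi then existential psi else qfree phi.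

End Syntax.

Record embedding (L : language) (M N : structure L) (e : M -> N) : Prop := {
  emb_inj : injective e;
  emb_fun : forall (f : fsym L) (a : 'I_(farity f) -> M),
    e (finterp a) = finterp (fun i => e (a i));
  emb_rel : forall (r : rsym L) (a : 'I_(rarity r) -> M),
    rinterp a <-> rinterp (fun i => e (a i))
}.

Definition isomorphic (L : language) (M N : structure L) : Prop :=
  exists2 e : M -> N, embedding e & bijective e.

Definition elementary (L : language) (M N : structure L) (e : M -> N) : Prop :=
  forall (phi : formula L) (v : nat -> M), sat v phi <-> sat (e \o v) phi.

Variant ring_fun := Radd | Ropp | Rmul | Rzero | Rone.

Definition ring_arity (f : ring_fun) : nat :=
  match f with Radd | Rmul => 2 | Ropp => 1 | Rzero | Rone => 0 end.

Definition ring_lang : language :=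
  @Language ring_fun ring_arity void (fun=> 0%N).

Definition ring_interp (R : pzRingType) (f : ring_fun) :
    ('I_(ring_arity f) -> R) -> R :=
  match f with
  | Radd => fun a => a ord0 + a ord_max
  | Ropp => fun a => - a ord0
  | Rmul => fun a => a ord0 * a ord_max
  | Rzero => fun=> 0
  | Rone => fun=> 1
  end.

Definition ring_structure (R : pzRingType) : structure ring_lang :=
  @Structure ring_lang R (@ring_interp R) (fun r => match r with end).

(* The languages enriching [ring_lang], presented by their additional
   symbols [E]. *)
Definition enrich (E : language) : language :=
  @Language (ring_fun + fsym E)%type
    (fun f => match f with inl g => ring_arity g | inr g => farity g end)
    (rsym E) (@rarity E).

(* An [enrich E]-structure whose reduct to [ring_lang] is a field. *)
Record Lfield (E : language) : Type := MkLfield {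
  Lfield_field :> fieldType;
  Lfield_fun : forall f : fsym E, ('I_(farity f) -> Lfield_field) -> Lfield_field;
  Lfield_rel : forall r : rsym E, ('I_(rarity r) -> Lfield_field) -> Prop
}.

Definition Lstruct (E : language) (K : Lfield E) : structure (enrich E) :=
  @Structure (enrich E) K
    (fun f : fsym (enrich E) =>
       match f return ('I_(@farity (enrich E) f) -> K) -> K with
       | inl g => @ring_interp K g
       | inr g => @Lfield_fun E K g
       end)
    (@Lfield_rel E K).

(* The structure sheaf is given as an etale space: its stalks, and for each
   open [U] the families of germs that are (induced by) sections over [U].
   Only the values on [U] of a member of [sect U] are meaningful, and
   [sect U] is only meaningful for [U] open. *)
Record lrSpace : Type := LrSpace {
  space :> topologicalType;
  stalk : space -> comUnitRingType;
  sect : set space -> set (forall x, stalk x);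
  sect_glue : forall (U : set space) s, open U ->
    (forall x, U x -> exists W t, [/\ open W, W x, sect W t &
       forall y, U y -> W y -> t y = s y]) -> sect U s;
  sect_res : forall (U W : set space) s, open U -> open W -> W `<=` U ->
    sect U s -> sect W s;
  sect1 : forall U, open U -> sect U (fun=> 1);
  sectB : forall U s t, open U -> sect U s -> sect U t ->
    sect U (fun x => s x - t x);
  sectM : forall U s t, open U -> sect U s -> sect U t ->
    sect U (fun x => s x * t x);
  germ_ex : forall x (a : stalk x), exists U s,
    [/\ open U, U x, sect U s & s x = a];
  germ_eq : forall (U : set space) s t x, open U -> sect U s -> sect U t ->
    U x -> s x = t x ->
    exists W, [/\ open W, W x, W `<=` U & forall y, W y -> s y = t y];
  stalk_local : forall x (a b : stalk x),
    a + b \is a GRing.unit -> a \is a GRing.unit \/ b \is a GRing.unit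
}.

Record lrHom (X Y : lrSpace) : Type := LrHom {
  hmap :> X -> Y;
  hcont : forall W, open W -> open (hmap @^-1` W);
  hstalk : forall x, {rmorphism stalk (hmap x) -> stalk x};
  hlocal : forall x a,
    hstalk x a \is a GRing.unit -> a \is a GRing.unit;
  hsect : forall W s, open W -> sect W s ->
    sect (hmap @^-1` W) (fun x => hstalk x (s (hmap x)))
}.

Definition lrId (X : lrSpace) : lrHom X X :=
  @LrHom X X idfun (fun _ oW => oW)
    (fun x => idfun : {rmorphism stalk x -> stalk x})
    (fun _ _ ua => ua) (fun _ _ _ sW => sW).

Section Composition.
Variables (X Y Z : lrSpace) (g : lrHom Y Z) (f : lrHom X Y).

Definition lrComp_stalk (x : X) : {rmorphism stalk (g (f x)) -> stalk x} :=
  hstalk f x \o hstalk g (f x).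

Lemma lrComp_cont W : open W -> open ((g \o f) @^-1` W).
Proof. by move=> oW; apply: (hcont f (hcont g oW)). Qed.

Lemma lrComp_local x a :
  lrComp_stalk x a \is a GRing.unit -> a \is a GRing.unit.
Proof. by move=> /hlocal /hlocal. Qed.

Lemma lrComp_sect W s : open W -> sect W s ->
  sect ((g \o f) @^-1` W) (fun x => lrComp_stalk x (s (g (f x)))).
Proof. by move=> oW sW; apply: (hsect f (hcont g oW) (hsect g oW sW)). Qed.

Definition lrComp : lrHom X Z := LrHom lrComp_cont lrComp_local lrComp_sect.

End Composition.

Definition closed_immersion (X Y : lrSpace) (f : lrHom X Y) : Prop :=
  [/\ closed (range f), injective f,
      forall U, open U -> exists2 W, open W & U = f @^-1` W &
      forall x (a : stalk x), exists b, hstalk f x b = a].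

(* [phi] identifies the open subspace [U] of [X] with Spec A: it sends the
   elements of [A] to sections over [U], [x] corresponds to the prime ideal of
   the [a] whose germ at [x] is not a unit, the topology of [U] is the Zariski
   topology, and the stalk at [x] is the localization of [A] at that prime.
   Since the ring [A] is nonzero, this describes nonempty affine opens. *)
Record affine_open (X : lrSpace) (U : set X) (A : comNzRingType)
    (phi : A -> forall x : X, stalk x) : Prop := {
  ao_open : open U;
  ao_sect : forall a, sect U (phi a);
  ao_1 : forall x, U x -> phi 1 x = 1;
  ao_B : forall x a b, U x -> phi (a - b) x = phi a x - phi b x;
  ao_M : forall x a b, U x -> phi (a * b) x = phi a x * phi b x;
  ao_prime : forall P : pred A, idealr_closed P -> prime_idealr_closed P ->
    exists! x, U x /\ forall a, (a \in P) = (phi a x \isn't a GRing.unit);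
  ao_top : forall W, W `<=` U ->
    (open W <-> exists I : set A,
       W = U `&` [set x | exists2 a, I a & phi a x \is a GRing.unit]);
  ao_frac : forall x (s : stalk x), U x -> exists a b,
    phi b x \is a GRing.unit /\ s = phi a x / phi b x;
  ao_ker : forall x a, U x -> phi a x = 0 ->
    exists2 b, phi b x \is a GRing.unit & b * a = 0
}.

Definition is_scheme (X : lrSpace) : Prop :=
  forall x : X, exists (U : set X) (A : comNzRingType)
    (phi : A -> forall x : X, stalk x), U x /\ affine_open U phi.

Definition integral_scheme (X : lrSpace) : Prop :=
  [set: X] !=set0 /\
  forall (U : set X) s t, open U -> U !=set0 -> sect U s -> sect U t ->
    (forall x, U x -> s x * t x = 0) ->
    (forall x, U x -> s x = 0) \/ (forall x, U x -> t x = 0).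

Lemma spec_field_germ_ex (K : fieldType) (x : discrete_topology unit) (a : K) :
  exists (U : set (discrete_topology unit)) (s : discrete_topology unit -> K),
  [/\ open U, U x, setT s & s x = a].
Proof. by exists setT, (fun=> a); split=> //; exact: openT. Qed.

Lemma spec_field_germ_eq (K : fieldType) (U : set (discrete_topology unit))
    (s t : discrete_topology unit -> K) x :
  open U -> setT s -> setT t -> U x -> s x = t x ->
  exists W, [/\ open W, W x, W `<=` U & forall y, W y -> s y = t y].
Proof. by case: x => oU _ _ Ux st; exists U; split=> // -[]. Qed.

Lemma spec_field_local (K : fieldType) (a b : K) :
  a + b \is a GRing.unit -> a \is a GRing.unit \/ b \is a GRing.unit.
Proof.
rewrite !unitfE => ab; have [a0|] := eqVneq a 0; last by left.
by right; move: ab; rewrite a0 add0r.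
Qed.

Definition spec_field (K : fieldType) : lrSpace :=
  @LrSpace (discrete_topology unit) (fun=> K) (fun=> setT)
    (fun _ _ _ _ => I) (fun _ _ _ _ _ _ _ => I) (fun _ _ => I)
    (fun _ _ _ _ _ _ => I) (fun _ _ _ _ _ _ => I)
    (@spec_field_germ_ex K) (@spec_field_germ_eq K)
    (fun=> @spec_field_local K).

Record kScheme (K : fieldType) : Type := KScheme {
  scheme_space :> lrSpace;
  schemeP : is_scheme scheme_space;
  structure_map : lrHom scheme_space (spec_field K)
}.

Definition kscalar (K : fieldType) (X : kScheme K) (x : X) :
    {rmorphism K -> stalk x} := hstalk (structure_map X) x.

(* Compatibility with the structure maps X -> Spec K and Y -> Spec K amounts to
   compatibility of the stalk maps with the scalars. *)
Record kHom (K : fieldType) (X Y : kScheme K) : Type := KHom {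
  kmap :> lrHom X Y;
  kmapP : forall x c, hstalk kmap x (kscalar (kmap x) c) = kscalar x c
}.

Definition is_product (K : fieldType) (X Y P : kScheme K)
    (p : kHom P X) (q : kHom P Y) : Prop :=
  forall (Z : kScheme K) (f : kHom Z X) (g : kHom Z Y),
  exists! h : kHom Z P,
    lrComp p h = f :> lrHom Z X /\ lrComp q h = g :> lrHom Z Y.

(* The diagonal is a closed immersion into the fibre product over Spec K, which
   is only determined by its universal property, up to unique isomorphism. *)
Definition separated (K : fieldType) (X : kScheme K) : Prop :=
  forall (P : kScheme K) (p q : kHom P X) (d : kHom X P),
  is_product p q -> lrComp p d = lrId X -> lrComp q d = lrId X ->
  closed_immersion d.

Definition affine_chart (K : fieldType) (X : kScheme K) (U : set X)
    (A : comNzRingType) (k : {rmorphism K -> A})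
    (phi : A -> forall x : X, stalk x) : Prop :=
  affine_open U phi /\ forall c x, U x -> phi (k c) x = kscalar x c.

Definition finite_type (K : fieldType) (X : kScheme K) : Prop :=
  exists (m : nat) (U : 'I_m -> set X),
  (forall x, exists i, U i x) /\
  forall i, exists (A : comNzRingType) (k : {rmorphism K -> A})
    (phi : A -> forall x : X, stalk x) (n : nat) (t : 'I_n -> A),
    affine_chart (U i) k phi /\
    forall a, exists p : {mpoly K[n]}, mmap k t p = a.

Record variety (K : fieldType) : Type := Variety {
  variety_scheme :> kScheme K;
  varietyP : [/\ separated variety_scheme, integral_scheme variety_scheme
    & finite_type variety_scheme]
}.

Definition affine (K : fieldType) (V : kScheme K) : Prop :=
  exists (A : comNzRingType) (k : {rmorphism K -> A})
    (phi : A -> forall x : V, stalk x), affine_chart [set: V] k phi.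

(* [x] has an affine neighbourhood Spec K[X_1, .., X_n]/(f_1, .., f_c) with a
   c-minor of the Jacobian matrix invertible at [x]. *)
Definition smooth_at (K : fieldType) (V : kScheme K) (x : V) : Prop :=
  exists (U : set V) (A : comNzRingType) (k : {rmorphism K -> A})
    (phi : A -> forall x : V, stalk x) (n c : nat) (t : 'I_n -> A)
    (f : 'I_c -> {mpoly K[n]}),
  [/\ affine_chart U k phi, U x,
      forall a, exists p : {mpoly K[n]}, mmap k t p = a,
      forall p, mmap k t p = 0 <->
        exists g : 'I_c -> {mpoly K[n]}, p = \sum_(i < c) g i * f i
    & exists s : 'I_c -> 'I_n,
        \det (\matrix_(i, j) phi (mmap k t (mderiv (s j) (f i))) x)
          \is a GRing.unit].

(* The points of [V] with values in an extension [iota : K -> M], i.e. the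
   morphisms Spec M -> V over Spec iota. *)
Record points (K : fieldType) (V : kScheme K) (M : fieldType) (iota : K -> M) :
  Type := Point {
  point_map :> lrHom (spec_field M) V;
  pointP : forall c, hstalk point_map tt (kscalar (point_map tt) c) = iota c
}.

Definition point_center (K : fieldType) (V : kScheme K) (M : fieldType)
  (iota : K -> M) (h : points V iota) : V := h tt.

Definition smooth_points (K : fieldType) (V : kScheme K) (M : fieldType)
  (iota : K -> M) : set (points V iota) := [set h | smooth_at (point_center h)].

Arguments smooth_points {K} V {M} iota.

(* V(K), as a subset of the underlying space of [V]. *)
Definition rational_points (K : fieldType) (V : kScheme K) : set V :=
  [set x | exists h : points V (@idfun K), point_center h = x].
Arguments rational_points {K} V.

Definition large (K : fieldType) : Prop :=
  forall V : variety K, smooth_points V (@idfun K) !=set0 ->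
    dense (rational_points V).

(* F is linearly disjoint over K from the algebraic closure of K, inside an
   algebraically closed field Om containing F. *)
Definition regular_extension (K F : fieldType) (j : {rmorphism K -> F}) : Prop :=
  exists (Om : closedFieldType) (i : {rmorphism F -> Om}),
  forall (n : nat) (a : 'I_n -> F),
  (forall c : 'I_n -> K, \sum_(l < n) j (c l) * a l = 0 -> forall l, c l = 0) ->
  forall b : 'I_n -> Om, (forall l, algebraicOver (i \o j) (b l)) ->
    \sum_(l < n) b l * i (a l) = 0 -> forall l, b l = 0.

Definition generic_point (X : lrSpace) (x : X) : Prop := dense [set x].

(* [V] is geometrically integral iff K(V) is a regular extension of K. Here [F],
   via the isomorphism [g], is the function field K(V), i.e. the stalk of [V] at
   its generic point [x]. *)
Definition geometrically_integral (K : fieldType) (V : variety K) : Prop :=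
  exists (x : V) (F : fieldType) (g : {rmorphism stalk x -> F}),
  [/\ generic_point x, bijective g & regular_extension (g \o @kscalar K V x)].

Section Totally.
Variables (E : language) (T : set (formula (enrich E))).

(* Up to isomorphism every model is an [Lfield], and every model that is given
   as an [Lfield] is a large field. *)
Definition theory_of_large_fields : Prop :=
  (forall M : structure (enrich E), models M T ->
     exists F : Lfield E, isomorphic (Lstruct F) M) /\
  (forall M : Lfield E, models (Lstruct M) T -> large M).

Definition totally_extension (K : Lfield E) (F : fieldType)
    (j : {rmorphism K -> F}) : Prop :=
  forall (M : Lfield E) (iota : Lstruct K -> Lstruct M),
  models (Lstruct M) T -> embedding iota ->
  exists (N : Lfield E) (e : Lstruct M -> Lstruct N) (g : {rmorphism F -> N}),
    elementary e /\ forall c : K, g (j c) = e (iota c).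

Definition totally_variety (K : Lfield E) (V : variety K) : Prop :=
  forall (M : Lfield E) (iota : Lstruct K -> Lstruct M),
  models (Lstruct M) T -> embedding iota ->
  smooth_points V iota !=set0.

End Totally.

Definition existentially_closed (K F : fieldType) (j : {rmorphism K -> F}) :
    Prop :=
  forall (phi : formula ring_lang) (v : nat -> ring_structure K),
  existential phi -> @sat _ (ring_structure F) (j \o v) phi -> sat v phi.

(* Main.v *)
(* (iii) => (ii): by Hilbert's Nullstellensatz and an ultraproduct of places, the
   regular extension K(V) and any M containing K have a compositum in which they
   are linearly disjoint over K.  The M-algebra generated there by a smooth chart
   of V is presented by the same equations, so it is the coordinate ring of an
   M-variety with a smooth M-point.  As M is large, M-points avoid every proper
   closed subset of V, and K(V) embeds in an ultrapower of M.  Hence K is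
   existentially closed in K(V), which gives a K-point in every nonempty open set.

   (i), affine case => (iii): a solution in F of a quantifier-free formula over K
   generates a K-algebra K[x] in F.  By MacLane's theorem a localization of K[x]
   is smooth over K, and its spectrum is a geometrically integral affine variety.
   It is totally T because its finitely many equations have a solution in an
   elementary extension of every model M, hence in M.  A K-point of it is a
   solution in K.

   The only schemes to be constructed are the spectra of subrings S of a field L.
   Their points are the prime ideals of S, seen as subsets of L, and their stalks
   are the localizations of S inside L. *)
From HB Require Import structures.
Require Import Defs.
From mathcomp Require Import filter.
Import GRing.Theory.
Set Implicit Arguments.
Unset Strict Implicit.
Unset Printing Implicit Defensive.
Local Open Scope classical_set_scope.
Local Open Scope ring_scope.

(** * Rings *)

(** Among the five statements, (i) for affine varieties is the weakest and (ii) the strongest, so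
    the two implications (i, affine) => (iii) => (ii) close every circle; an integral scheme is
    nonempty, so density always gives a point.

    Largeness of M speaks only of integral M-schemes, whereas the base change of V to M is not
    visibly integral. An M-algebra generated inside a field is a domain for free; the price is to
    show that it satisfies no relations beyond those of the chart, and this is where linear
    disjointness enters. Regularity is used a second time for separability: a relation that is a
    polynomial in l-th powers would yield, through l-th roots of its coefficients, a relation of
    smaller degree.

    Separatedness mentions products only through their universal property. Testing that property on
    spectra of residue fields suffices for affine schemes, so no product is ever built.

    Several constructions concern infinitely many elements but impose finitely many conditions at a
    time; they are all carried out over an ultrafilter on finite lists. *)

Lemma rmorph_ex (A B : pzRingType) (f : A -> B) :
  (forall a b, f (a - b) = f a - f b) -> f 1 = 1 ->
  (forall a b, f (a * b) = f a * f b) ->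
  exists g : {rmorphism A -> B}, forall a, g a = f a.
Proof.
move=> fB f1 fM.
pose m1 := GRing.isZmodMorphism.Build A B f fB.
pose m2 := GRing.isMonoidMorphism.Build A B f (conj f1 fM).
pose g : {rmorphism A -> B} := HB.pack f m1 m2.
by exists g.
Qed.

(** The universal property of a quotient, with a surjection in place of a quotient ring: coordinate
    rings are handled through their polynomial presentations. *)
Lemma factor_rmorph (R A B : pzRingType) (p : {rmorphism R -> A})
    (q : {rmorphism R -> B}) :
  (forall a, exists r, p r = a) -> (forall r, p r = 0 -> q r = 0) ->
  exists h : {rmorphism A -> B}, forall r, h (p r) = q r.
Proof.
move=> psurj pq; have [s ps] := choice psurj.
have wd r : q (s (p r)) = q r.
  by apply/eqP; rewrite -subr_eq0 -rmorphB pq // rmorphB ps subrr.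
have [h hE] : exists h : {rmorphism A -> B}, forall a, h a = q (s a).
  apply: rmorph_ex => [a b||a b].
  - by rewrite -rmorphB -[RHS]wd rmorphB !ps.
  - by rewrite -(rmorph1 p) wd rmorph1.
  - by rewrite -rmorphM -[RHS]wd rmorphM !ps.
by exists h => r; rewrite hE wd.
Qed.

Lemma rmorph_eq (A B : pzRingType) (f g : {rmorphism A -> B}) : f =1 g -> f = g.
Proof.
case: f g => [f [[f1] [f2]]] [g [[g1] [g2]]] /= /funext fg.
rewrite /= in fg; subst g.
have -> : f1 = g1.
  exact: Prop_irrelevance.
have -> // : f2 = g2.
exact: Prop_irrelevance.
Qed.

Section ClassicalUnits.
Variable R : comNzRingType.

(** Stalks must carry a unit structure; invertibility decided classically and chosen inverses give
    one to any commutative nonzero ring. *)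
Definition with_units : Type := R.
HB.instance Definition _ := GRing.ComNzRing.on with_units.

Definition cunit : pred with_units := fun x => `[< exists y : R, y * x = 1 >].
Definition cinv (x : with_units) : with_units :=
  if pselect (exists y : R, y * x = 1) is left h then projT1 (cid h) else x.

Fact cinv_mulVx : {in cunit, left_inverse 1 cinv *%R}.
Proof.
move=> x; rewrite inE /cinv => h; case: pselect => // h'.
by case: cid.
Qed.

Fact cunitPl (x y : with_units) : y * x = 1 -> cunit x.
Proof. by move=> yx; apply/asboolP; exists y. Qed.

Fact cinv_out : {in [predC cunit], cinv =1 id}.
Proof.
move=> x; rewrite inE /= => /asboolPn h; rewrite /cinv.
by case: pselect.
Qed.

HB.instance Definition _ :=
  GRing.ComNzRing_hasMulInverse.Build with_units cinv_mulVx cunitPl cinv_out.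

Lemma with_unitsP (x : with_units) :
  reflect (exists y, y * x = 1) (x \is a GRing.unit).
Proof. exact: asboolP. Qed.

End ClassicalUnits.

Definition prime_set (R : comNzRingType) (P : set R) : Prop :=
  [/\ P 0, ~ P 1, forall a b, P a -> P b -> P (a - b),
      forall a b, P b -> P (a * b) & forall a b, P (a * b) -> P a \/ P b].

Local Notation "x %:F" := (@FracField.tofrac _ x).

Lemma fraction_frac (D : idomainType) (z : {fraction D}) :
  exists a b : D, b != 0 /\ z = a%:F / b%:F.
Proof.
exists (frac (repr z)).1, (frac (repr z)).2; split; first exact: denom_ratioP.
have d0 : ((frac (repr z)).2)%:F != 0 :> {fraction D}.
  by rewrite tofrac_eq0 denom_ratioP.
apply: (mulIf d0); rewrite divfK // -{1}[z]reprK; unlock FracField.tofrac.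
rewrite -[LHS]FracField.pi_mul; apply/eqmodP; rewrite /= FracField.equivfE.
by rewrite /FracField.mulf /= !numden_Ratio ?mulf_neq0 ?denom_ratioP ?oner_neq0 //
  !mulr1 mulrC.
Qed.

(** The fraction field of R/P. Residue fields, ultrapowers and function fields are all obtained from
    it. *)
Lemma prime_set_field (R : comNzRingType) (P : set R) : prime_set P ->
  exists (L : fieldType) (f : {rmorphism R -> L}),
    (forall a, f a = 0 <-> P a) /\
    forall z, exists a b, f b != 0 /\ z = f a / f b.
Proof.
move=> [P0 P1 PB PM PP].
pose I0 : R -> bool := fun x => `[< P x >].
have I1 : idealr_closed I0.
  split; [exact/asboolP|exact/asboolP|].
  move=> a u v /asboolP Pu /asboolP Pv; apply/asboolP.
  by rewrite -[v]opprK; apply: (PB); [exact: PM|rewrite -sub0r; exact: PB].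
have I2 : prime_idealr_closed I0.
  by move=> u v /asboolP /PP [?|?]; apply/orP; [left|right]; apply/asboolP.
pose I : prime_idealr R := HB.pack I0 (isIdealr.Build R I0 I1)
  (isPrimeIdealrClosed.Build R I0 I2).
(* Fractions are taken over an [idomainType], so the quotient first needs a unit structure. *)
pose Q := with_units {ideal_quot I}.
have Qdom : GRing.integral_domain_axiom Q.
  exact: Quotient.rquot_IdomainAxiom.
pose D : idomainType := HB.pack Q (GRing.ComUnitRing_isIntegral.Build Q Qdom).
pose p : {rmorphism R -> {ideal_quot I}} := \pi_{ideal_quot I}%qT.
pose f0 : R -> {fraction D} := fun x => (p x : D)%:F.
have [f fE] : exists f : {rmorphism R -> {fraction D}}, forall a, f a = f0 a.
  apply: rmorph_ex => [a b||a b]; rewrite /f0.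
  - by rewrite -rmorphB -[in RHS]rmorphB.
  - by rewrite [X in X%:F]rmorph1 rmorph1.
  - by rewrite -rmorphM -[in RHS]rmorphM.
exists {fraction D}, f.
have f_eq0 a : f a = 0 <-> P a.
  rewrite fE /f0; split=> [/eqP|Pa].
    rewrite tofrac_eq0 => /eqP pa0.
    have : a - 0 \in (I : {pred R}).
      by rewrite Quotient.idealrBE; apply/eqP; rewrite -/(p a) pa0 rmorph0.
    by rewrite subr0 => /asboolP.
  apply/eqP; rewrite tofrac_eq0 -(rmorph0 p) -Quotient.idealrBE subr0.
  exact/asboolP.
split=> // z; have [a [b [b0 ->]]] := fraction_frac z.
have [a' a'E] : exists r, p r = a.
  by exists (repr (a : {ideal_quot I})); exact: reprK.
have [b' b'E] : exists r, p r = b.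
  by exists (repr (b : {ideal_quot I})); exact: reprK.
exists a', b'; rewrite !fE /f0 a'E b'E; split=> //.
by rewrite tofrac_eq0.
Qed.

(** * Subrings of a field and their localizations *)

Record subring (L : fieldType) : Type := Subring {
  sr_set :> L -> Prop;
  sr1 : sr_set 1;
  srB : forall a b, sr_set a -> sr_set b -> sr_set (a - b);
  srM : forall a b, sr_set a -> sr_set b -> sr_set (a * b)
}.

Section SubringType.
Variables (L : fieldType) (S : subring L).

Lemma sr0 : S 0. Proof. by rewrite -(subrr 1); apply: srB; exact: sr1. Qed.
Lemma srN a : S a -> S (- a).
Proof. by move=> Sa; rewrite -sub0r; apply: srB => //; exact: sr0. Qed.
Lemma srD a b : S a -> S b -> S (a + b).
Proof. by move=> Sa Sb; rewrite -[b]opprK; apply: srB => //; exact: srN. Qed.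
Definition sr_pred : L -> bool := fun z => `[< S z >].

Fact sr_closed : subring_closed sr_pred.
Proof.
split; first exact/asboolP/sr1.
- by move=> x y /asboolP Sx /asboolP Sy; exact/asboolP/srB.
- by move=> x y /asboolP Sx /asboolP Sy; exact/asboolP/srM.
Qed.
HB.instance Definition _ := GRing.isSubringClosed.Build L sr_pred sr_closed.

Record sr_elt : Type := SrElt { sr_elt_val : L; _ : sr_elt_val \in sr_pred }.
HB.instance Definition _ := [isSub for sr_elt_val].
HB.instance Definition _ := [Choice of sr_elt by <:].
HB.instance Definition _ := [SubChoice_isSubComNzRing of sr_elt by <:].

Definition sr_ring : comUnitRingType := with_units sr_elt.

Definition srval (x : sr_ring) : L := sr_elt_val x.

(** Total, with value 0 outside [S], so that sections can be written down at all points without a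
    membership proof. *)
Definition srmk (z : L) : sr_ring :=
  if pselect (S z) is left h then (SrElt (asboolT h : z \in sr_pred)) else 0.

Lemma srmkK z : S z -> srval (srmk z) = z.
Proof. by move=> Sz; rewrite /srmk; case: pselect. Qed.

Lemma srvalP (x : sr_ring) : S (srval x).
Proof. by case: x => z /= /asboolP. Qed.

Lemma srval_inj : injective srval.
Proof. exact: val_inj. Qed.

Lemma srvalK (x : sr_ring) : srmk (srval x) = x.
Proof. by apply: srval_inj; rewrite srmkK //; exact: srvalP. Qed.

Lemma srvalB x y : srval (x - y) = srval x - srval y. Proof. by []. Qed.
Lemma srval1 : srval 1 = 1. Proof. by []. Qed.
Lemma srvalM x y : srval (x * y) = srval x * srval y. Proof. by []. Qed.
Lemma srvalD x y : srval (x + y) = srval x + srval y. Proof. by []. Qed.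

Lemma srval_unit (x : sr_ring) :
  (x \is a GRing.unit) <-> srval x != 0 /\ S (srval x)^-1.
Proof.
split=> [/with_unitsP[y yx]|[x0 Sx]].
  have yx1 : srval y * srval x = 1 by rewrite -[LHS]/(srval (y * x)) yx.
  have x0 : srval x != 0.
    by apply/eqP => x0; move/eqP: yx1; rewrite x0 mulr0 eq_sym oner_eq0.
  split=> //; rewrite (_ : _^-1 = srval y); first exact: srvalP.
  by apply: (mulIf x0); rewrite mulVf // yx1.
apply/with_unitsP; exists (srmk (srval x)^-1); apply: srval_inj.
by rewrite -[LHS]/(srval _ * srval x) srmkK // mulVf.
Qed.

Lemma srval_div (x y : sr_ring) : y \is a GRing.unit ->
  srval (x / y) = srval x / srval y.
Proof.
move=> yu; have [y0 _] := (srval_unit y).1 yu.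
by apply: (mulIf y0); rewrite -[LHS]/(srval (x / y * y)) divrK // divfK.
Qed.

End SubringType.
Arguments srmk {L} S z.

HB.instance Definition _ (L : fieldType) (S : subring L) :=
  GRing.isZmodMorphism.Build (sr_ring S) L (@srval L S) (@srvalB L S).
HB.instance Definition _ (L : fieldType) (S : subring L) :=
  GRing.isMonoidMorphism.Build (sr_ring S) L (@srval L S)
    (conj (@srval1 L S) (@srvalM L S)).

Record prime_of (L : fieldType) (S : subring L) (P : set L) : Prop := PrimeOf {
  po_sub : forall a, P a -> S a;
  po_0 : P 0;
  po_1 : ~ P 1;
  po_B : forall a b, P a -> P b -> P (a - b);
  po_Ml : forall a b, S a -> P b -> P (a * b);
  po_prime : forall a b, S a -> S b -> P (a * b) -> P a \/ P b
}.

Section Localization.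
Variables (L : fieldType) (S : subring L) (P : set L) (primeP : prime_of S P).

Definition loc_set : set L :=
  [set z | exists a b, [/\ S a, S b, ~ P b & z = a / b]].

Lemma notP_neq0 b : ~ P b -> b != 0.
Proof. by move=> Pb; apply/eqP => b0; apply: Pb; rewrite b0; exact: po_0 primeP. Qed.

Lemma notP_mul a b : S a -> S b -> ~ P a -> ~ P b -> ~ P (a * b).
Proof. by move=> Sa Sb Pa Pb /(po_prime primeP Sa Sb)[]. Qed.

Fact loc_1 : loc_set 1.
Proof.
by exists 1, 1; rewrite divr1; split=> //; [exact: sr1..|exact: po_1 primeP].
Qed.
Fact loc_B a b : loc_set a -> loc_set b -> loc_set (a - b).
Proof.
move=> [a1 [a2 [Sa1 Sa2 Pa2 ->]]] [b1 [b2 [Sb1 Sb2 Pb2 ->]]].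
exists (a1 * b2 - b1 * a2), (a2 * b2).
split; [by apply: srB; exact: srM|exact: srM|exact: notP_mul|].
by rewrite -mulNr addf_div ?notP_neq0 // mulNr.
Qed.
Fact loc_M a b : loc_set a -> loc_set b -> loc_set (a * b).
Proof.
move=> [a1 [a2 [Sa1 Sa2 Pa2 ->]]] [b1 [b2 [Sb1 Sb2 Pb2 ->]]].
exists (a1 * b1), (a2 * b2).
by split; [exact: srM|exact: srM|exact: notP_mul|rewrite mulf_div].
Qed.

Definition loc : subring L := Subring loc_1 loc_B loc_M.

Lemma loc_sub a : S a -> loc a.
Proof.
by move=> Sa; exists a, 1; rewrite divr1; split=> //; [exact: sr1|exact: po_1 primeP].
Qed.

End Localization.

(** * The spectrum of a subring of a field *)

Lemma sr_lift_ex (R : pzRingType) (L : fieldType) (f : {rmorphism R -> L})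
    (S : subring L) : (forall r, S (f r)) ->
  exists g : {rmorphism R -> sr_ring S}, forall r, srval (g r) = f r.
Proof.
move=> Sf; have [g gE] : exists g : {rmorphism R -> sr_ring S},
    forall r, g r = srmk S (f r).
  apply: rmorph_ex => [a b||a b]; apply: srval_inj.
  - by rewrite srvalB !srmkK // rmorphB.
  - by rewrite srmkK // rmorph1.
  - by rewrite srvalM !srmkK // rmorphM.
by exists g => r; rewrite gE srmkK.
Qed.

Record spec (L : fieldType) (S : subring L) : Type := SpecPoint {
  pt_set :> L -> Prop;
  pt_prime : prime_of S pt_set
}.

Section SpecTopology.
Variables (L : fieldType) (S : subring L).

HB.instance Definition _ := gen_eqMixin (spec S).
HB.instance Definition _ := gen_choiceMixin (spec S).

Lemma spec_eq (x y : spec S) : (forall a, S a -> (x a <-> y a)) -> x = y.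
Proof.
case: x y => [P pP] [Q pQ] /= PQ.
have e : P = Q.
  apply/funext => a; apply/propext.
  split=> h; have Sa : S a by [exact: po_sub pP _ h|exact: po_sub pQ _ h].
    exact/(PQ a Sa).
  exact/(PQ a Sa).
by subst Q; congr SpecPoint; exact: Prop_irrelevance.
Qed.

Definition spec_open (W : set (spec S)) : Prop :=
  forall x, W x -> exists a, [/\ S a, ~ x a & forall y : spec S, ~ y a -> W y].

Fact spec_openT : spec_open setT.
Proof. by move=> x _; exists 1; split=> //; [exact: sr1|exact: po_1 (pt_prime x)]. Qed.

Fact spec_openI : setI_closed spec_open.
Proof.
move=> A B oA oB x [/oA [a [Sa xa aA]] /oB [b [Sb xb bB]]].
exists (a * b); split; [exact: srM|exact: (notP_mul (pt_prime x))|].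
move=> y yab; split; [apply: aA|apply: bB] => ya; apply: yab.
  by rewrite mulrC; apply: (po_Ml (pt_prime y)).
exact: (po_Ml (pt_prime y)).
Qed.

Fact spec_open_bigU (I : Type) (f : I -> set (spec S)) :
  (forall i, spec_open (f i)) -> spec_open (\bigcup_i f i).
Proof.
move=> of_ x [i _ /of_ [a [Sa xa af]]]; exists a; split=> // y /af fy.
by exists i.
Qed.

HB.instance Definition _ :=
  isOpenTopological.Build (spec S) spec_openT spec_openI spec_open_bigU.

Lemma spec_openE (W : set (spec S)) : open W <-> spec_open W.
Proof. by []. Qed.

Lemma spec_basic_open a : S a -> open [set x : spec S | ~ x a].
Proof. by move=> Sa; apply/spec_openE => x /= xa; exists a. Qed.

Fact generic_prime : prime_of S (fun z => z = 0).
Proof.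
split=> //.
- by move=> a ->; exact: sr0.
- by move/eqP; rewrite oner_eq0.
- by move=> a b -> ->; rewrite subrr.
- by move=> a b _ ->; rewrite mulr0.
- by move=> a b _ _ /eqP; rewrite mulf_eq0 => /orP[] /eqP; [left|right].
Qed.

Definition spec_generic : spec S := SpecPoint generic_prime.

(** The zero ideal lies in every nonempty open set because [S] is a domain. All germs can therefore
    be compared at this single point. *)
Lemma open_generic (W : set (spec S)) x : open W -> W x -> W spec_generic.
Proof.
move=> /spec_openE oW /oW [a [Sa xa aW]]; apply: aW => a0; apply: xa.
by rewrite a0; exact: po_0 (pt_prime x).
Qed.

End SpecTopology.
Arguments spec_generic {L} S.

Section SpecSheaf.
Variables (L : fieldType) (S : subring L).

Definition spec_stalk (x : spec S) : comUnitRingType := sr_ring (loc (pt_prime x)).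

(* As the base is irreducible, a section is a constant of [L] lying in all the
   relevant localizations. *)
Definition spec_sect (U : set (spec S)) : set (forall x, spec_stalk x) :=
  [set s | forall x y, U x -> U y -> srval (s x) = srval (s y)].

Fact spec_glue (U : set (spec S)) s : open U ->
  (forall x, U x -> exists W t, [/\ open W, W x, spec_sect W t &
     forall y, U y -> W y -> t y = s y]) -> spec_sect U s.
Proof.
move=> oU loc_s x y Ux Uy.
(* The local section around [z] is constant on a neighbourhood that contains the generic point. *)
have sgen z : U z -> srval (s z) = srval (s (spec_generic S)).
  move=> Uz; have [W [t [oW Wz Wt ts]]] := loc_s z Uz.
  have Ug := open_generic oU Uz; have Wg := open_generic oW Wz.
  by rewrite -!ts //; exact: Wt.
by rewrite sgen // [RHS]sgen.
Qed.

Fact spec_res (U W : set (spec S)) s : open U -> open W -> W `<=` U ->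
  spec_sect U s -> spec_sect W s.
Proof. by move=> _ _ WU Us x y /WU Ux /WU Uy; exact: Us. Qed.

Fact spec_1 U : open U -> spec_sect U (fun=> 1).
Proof. by []. Qed.

Fact spec_B U s t : open U -> spec_sect U s -> spec_sect U t ->
  spec_sect U (fun x => s x - t x).
Proof. by move=> _ Us Ut x y Ux Uy; rewrite !srvalB (Us x y) // (Ut x y). Qed.

Fact spec_M U s t : open U -> spec_sect U s -> spec_sect U t ->
  spec_sect U (fun x => s x * t x).
Proof. by move=> _ Us Ut x y Ux Uy; rewrite !srvalM (Us x y) // (Ut x y). Qed.

Fact spec_germ_ex x (a : spec_stalk x) : exists U s,
  [/\ open U, U x, spec_sect U s & s x = a].
Proof.
have [c [b [Sc Sb xb cb]]] := srvalP a.
exists [set y : spec S | ~ y b], (fun y => srmk (loc (pt_prime y)) (srval a)).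
split=> //; [exact: spec_basic_open| |exact: srvalK].
by move=> y z yb zb; rewrite !srmkK //; exists c, b.
Qed.

Fact spec_germ_eq (U : set (spec S)) s t x :
  open U -> spec_sect U s -> spec_sect U t -> U x -> s x = t x ->
  exists W, [/\ open W, W x, W `<=` U & forall y, W y -> s y = t y].
Proof.
move=> oU Us Ut Ux st; exists U; split=> // y Uy.
by apply: srval_inj; rewrite (Us y x) // st (Ut x y).
Qed.

(** Any representation as a fraction may be used to test invertibility, since primality makes the
    answer independent of the choice. *)
Lemma spec_stalk_unit (x : spec S) (a : spec_stalk x) c b :
  S c -> S b -> ~ x b -> srval a = c / b -> (a \is a GRing.unit) <-> ~ x c.
Proof.
move=> Sc Sb xb ab; rewrite srval_unit; have b0 := notP_neq0 (pt_prime x) xb.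
rewrite ab; split=> [[cb0 [d [e [Sd Se xe de]]]] xc|xc].
  apply: (notP_mul (pt_prime x) Sb Se xb xe).
  have e0 := notP_neq0 (pt_prime x) xe.
  have c0 : c != 0 by apply: contraNneq cb0 => ->; rewrite mul0r.
  have -> : b * e = d * c.
    move: de; rewrite invf_div => /eqP; by rewrite eqr_div // => /eqP.
  exact: (po_Ml (pt_prime x)).
have c0 := notP_neq0 (pt_prime x) xc.
split; first by rewrite mulf_neq0 // invr_neq0.
by exists b, c; rewrite invf_div.
Qed.

Fact spec_stalk_local x (a b : spec_stalk x) :
  a + b \is a GRing.unit -> a \is a GRing.unit \/ b \is a GRing.unit.
Proof.
have [c [d [Sc Sd xd cd]]] := srvalP a.
have [e [f [Se Sf xf ef]]] := srvalP b.
have [d0 f0] := (notP_neq0 (pt_prime x) xd, notP_neq0 (pt_prime x) xf).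
have xdf := notP_mul (pt_prime x) Sd Sf xd xf.
have ab : srval (a + b) = (c * f + e * d) / (d * f).
  by rewrite srvalD cd ef addf_div.
have Scf := srM Sc Sf; have Sed := srM Se Sd.
move/(spec_stalk_unit (srD Scf Sed) (srM Sd Sf) xdf ab) => h.
have [xc|xc] := pselect (x c); last by left; apply/(spec_stalk_unit Sc Sd xd cd).
right; apply/(spec_stalk_unit Se Sf xf ef) => xe; apply: h.
have px := pt_prime x; rewrite -[e * d]opprK; apply: (po_B px).
  by rewrite mulrC; apply: (po_Ml px).
by rewrite -sub0r; apply: (po_B px); [exact: (po_0 px)|rewrite mulrC; apply: (po_Ml px)].
Qed.

Definition Spec : lrSpace :=
  LrSpace spec_glue spec_res spec_1 spec_B spec_M spec_germ_ex spec_germ_eq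
    spec_stalk_local.

Definition spec_chart (a : sr_ring S) (x : Spec) : stalk x :=
  srmk (loc (pt_prime x)) (srval a).

Lemma spec_chartE a x : srval (spec_chart a x) = srval a.
Proof. by rewrite srmkK //; apply: loc_sub; exact: srvalP. Qed.

Lemma spec_chart_unit a (x : Spec) :
  spec_chart a x \is a GRing.unit <-> ~ (x : spec S) (srval a).
Proof.
apply: (@spec_stalk_unit x _ _ 1); [exact: srvalP|exact: sr1| |].
  exact: po_1 (pt_prime x).
by rewrite divr1 spec_chartE.
Qed.

Lemma spec_affine_open : affine_open [set: Spec] spec_chart.
Proof.
split; first exact: openT.
- by move=> a x y _ _; rewrite !spec_chartE.
- by move=> x _; apply: srval_inj; rewrite spec_chartE.
- by move=> x a b _; apply: srval_inj; rewrite srvalB !spec_chartE.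
- by move=> x a b _; apply: srval_inj; rewrite srvalM !spec_chartE.
- move=> P [P0 P1 PB] PP.
  (* Points are subsets of [L], so a prime of the ring [sr_ring S] is replaced by its image in
     [L]. *)
  have pP : prime_of S (fun z => exists2 a, a \in P & z = srval a).
    split.
    + by move=> _ [a _ ->]; exact: srvalP.
    + by exists 0.
    + by move=> [a aP /esym a1]; move/negP: P1; apply; rewrite -(srval_inj (a1 : srval a = srval 1)).
    + move=> _ _ [a aP ->] [b bP ->]; exists (a - b) => //.
      by rewrite addrC -mulN1r; exact: PB.
    + move=> z _ Sz [b bP ->]; exists (srmk S z * b); last by rewrite srvalM srmkK.
      by rewrite -[_ * b]addr0; apply: PB.
    + move=> y z Sy Sz [c cP yz].
      have : srmk S y * srmk S z \in P.
        rewrite (_ : _ * _ = c) //; apply: srval_inj.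
        by rewrite srvalM !srmkK.
      move=> /PP/orP[] h; [left|right]; by [exists (srmk S y); rewrite ?srmkK|
        exists (srmk S z); rewrite ?srmkK].
  exists (SpecPoint pP : Spec); split.
    split=> // a; apply/idP/negP => [aP /spec_chart_unit|h].
      by apply; exists a.
    apply: contrapT => aP; apply: h; apply/spec_chart_unit => -[b bP].
    by move=> /srval_inj ab; apply: aP; rewrite ab.
  move=> y [_ yP]; apply: spec_eq => z Sz; rewrite -(srmkK Sz) /=.
  have := yP (srmk S z) => /(congr1 is_true) yz.
  split=> [[b bP /srval_inj zb]|yz'].
    apply: contrapT => /spec_chart_unit; apply/negP; rewrite -yz zb; exact: bP.
  exists (srmk S z) => //; rewrite yz; apply/negP => /spec_chart_unit.
  exact.
- move=> W _; split=> [/spec_openE oW|[I ->]].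
    (* All functions whose basic open set is contained in [W]. *)
    exists [set a | forall y : spec S, ~ y (srval a) -> W y]; rewrite setTI.
    apply/seteqP; split=> [x /oW [a [Sa xa aW]]|x [a aW /spec_chart_unit]].
      exists (srmk S a); last by apply/spec_chart_unit; rewrite srmkK.
      by move=> y; rewrite srmkK //; exact: aW.
    exact: aW.
  rewrite setTI; apply/spec_openE => x [a Ia /spec_chart_unit xa]; exists (srval a).
  split=> //; first exact: srvalP.
  by move=> y ya; exists a => //; exact/spec_chart_unit.
- move=> x s _; have [c [b [Sc Sb xb cb]]] := srvalP s.
  have ub : spec_chart (srmk S b) x \is a GRing.unit.
    by apply/spec_chart_unit; rewrite srmkK.
  exists (srmk S c), (srmk S b); split=> //.
  by apply: srval_inj; rewrite srval_div // !spec_chartE !srmkK.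
- move=> x a _ ax0; exists 1; last first.
    by apply: srval_inj; rewrite mul1r -(spec_chartE a x) ax0.
  by apply/spec_chart_unit; exact: po_1 (pt_prime x).
Qed.

Lemma spec_integral : integral_scheme Spec.
Proof.
split; first by exists (spec_generic S).
move=> U s t oU [x Ux] Us Ut st0.
have /eqP := congr1 (@srval _ _) (st0 x Ux).
rewrite srvalM mulf_eq0 => /orP[] /eqP h; [left|right] => y Uy; apply: srval_inj.
  by rewrite (Us y x).
by rewrite (Ut y x).
Qed.

Section StructureMap.
Variables (K : fieldType) (k : {rmorphism K -> sr_ring S}).

Fact spec_scalar_ex (x : Spec) :
  exists g : {rmorphism K -> stalk x}, forall c, g c = spec_chart (k c) x.
Proof.
apply: rmorph_ex => [a b||a b]; apply: srval_inj.
- by rewrite srvalB !spec_chartE rmorphB.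
- by rewrite spec_chartE rmorph1.
- by rewrite srvalM !spec_chartE rmorphM.
Qed.

Definition spec_scalar (x : Spec) : {rmorphism K -> stalk x} :=
  projT1 (cid (spec_scalar_ex x)).

Lemma spec_scalarE x c : spec_scalar x c = spec_chart (k c) x.
Proof. by rewrite /spec_scalar; case: cid. Qed.

Fact spec_smap_cont (W : set (spec_field K)) :
  open W -> open ((fun _ : Spec => tt : spec_field K) @^-1` W).
Proof.
move=> oW; have [Wt|Wt] := pselect (W tt).
  by rewrite (_ : _ @^-1` _ = setT); [exact: openT|apply/seteqP; split].
by rewrite (_ : _ @^-1` _ = set0); [exact: open0|apply/seteqP; split].
Qed.

Fact spec_smap_local (x : Spec) (a : K) :
  spec_scalar x a \is a GRing.unit -> a \is a GRing.unit.
Proof.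
rewrite unitfE => xa; apply: contraTneq xa => ->.
by rewrite rmorph0 unitr0.
Qed.

Fact spec_smap_sect (W : set (spec_field K)) (s : spec_field K -> K) :
  open W -> setT s ->
  spec_sect ((fun _ : Spec => tt : spec_field K) @^-1` W)
    (fun x => spec_scalar x (s tt)).
Proof. by move=> _ _ x y _ _; rewrite !spec_scalarE !spec_chartE. Qed.

Definition spec_smap : lrHom Spec (spec_field K) :=
  @LrHom Spec (spec_field K) (fun=> tt) spec_smap_cont spec_scalar
    spec_smap_local spec_smap_sect.

Lemma spec_scheme : is_scheme Spec.
Proof. by move=> x; exists setT, (sr_ring S), spec_chart; split=> //; exact: spec_affine_open. Qed.

Definition SpecK : kScheme K := KScheme spec_scheme spec_smap.

Lemma spec_affine_chart : affine_chart (X := SpecK) setT k spec_chart.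
Proof.
split; first exact: spec_affine_open.
by move=> c x _; rewrite /kscalar /= spec_scalarE.
Qed.

End StructureMap.
End SpecSheaf.

(** * Morphisms and points *)

(** The stalk maps live over the points f x and g x, which are equal only propositionally. Comparing
    them on a section [s] evaluated at both points avoids a transport; every germ comes from a
    section. *)
Lemma lrHom_eq (X Y : lrSpace) (f g : lrHom X Y) :
  (forall x, f x = g x) ->
  (forall x U s, open U -> U (f x) -> sect U s ->
     hstalk f x (s (f x)) = hstalk g x (s (g x))) -> f = g.
Proof.
case: f g => [f fc fs fl ft] [g gc gs gl gt] /= /funext fg.
rewrite /= in fg; subst g => st.
have e : fs = gs.
  apply: functional_extensionality_dep => x; apply: rmorph_eq => a.
  by have [U [s [oU Ux Us <-]]] := germ_ex a; exact: st Us.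
by subst gs; rewrite (Prop_irrelevance gc fc) (Prop_irrelevance gl fl)
  (Prop_irrelevance gt ft).
Qed.

Section AffineOpen.
Variables (X : lrSpace) (U : set X) (A : comNzRingType).
Variables (phi : A -> forall x : X, stalk x) (aU : affine_open U phi).

Lemma ao_0 x : U x -> phi 0 x = 0.
Proof. by move=> Ux; rewrite -(subrr (0 : A)) (ao_B aU) // subrr. Qed.

Lemma ao_D x a b : U x -> phi (a + b) x = phi a x + phi b x.
Proof.
move=> Ux; rewrite -{1}[b]opprK (ao_B aU) //; congr (_ + _).
by rewrite -[- b]sub0r (ao_B aU) // ao_0 // sub0r opprK.
Qed.

Lemma ao_nonunit_ideal x : U x ->
  idealr_closed [pred a | phi a x \isn't a GRing.unit].
Proof.
move=> Ux; split; rewrite ?inE /=.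
- by rewrite ao_0 // unitr0.
- by rewrite (ao_1 aU) // unitr1.
- move=> a u v; rewrite !inE /= => uu uv; rewrite ao_D // (ao_M aU) //.
  apply/negP => /stalk_local[]; last exact/negP.
  by rewrite unitrM (negPf uu) andbF.
Qed.

Lemma ao_nonunit_prime x : U x ->
  prime_idealr_closed [pred a | phi a x \isn't a GRing.unit].
Proof.
move=> Ux u v; rewrite !inE /= (ao_M aU) // unitrM negb_and.
exact.
Qed.

Lemma ao_point_eq x y : U x -> U y ->
  (forall a, phi a x \is a GRing.unit = (phi a y \is a GRing.unit)) -> x = y.
Proof.
move=> Ux Uy xy.
have [z [_ zu]] := ao_prime aU (ao_nonunit_ideal Ux) (ao_nonunit_prime Ux).
rewrite -(zu x); last by split.
by apply: zu; split=> // a; rewrite inE /= xy.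
Qed.

End AffineOpen.

Lemma hstalk_unit (X Y : lrSpace) (f : lrHom X Y) x a :
  (hstalk f x a \is a GRing.unit) = (a \is a GRing.unit).
Proof. by apply/idP/idP => [/hlocal//|]; exact: rmorph_unit. Qed.

(** Locality of the stalk maps recovers the image point as the prime of functions that become
    non-units; the stalk there consists of fractions of global functions, so the stalk maps are
    determined too. *)
Lemma lrHom_affine_eq (X Y : lrSpace) (A : comNzRingType)
    (phi : A -> forall y : Y, stalk y) (f g : lrHom X Y) :
  affine_open [set: Y] phi ->
  (forall x a, hstalk f x (phi a (f x)) = hstalk g x (phi a (g x))) -> f = g.
Proof.
move=> aY fg.
have fgx x : f x = g x.
  by apply: (ao_point_eq aY) => // a; rewrite -(@hstalk_unit _ _ f) fg hstalk_unit.
apply: lrHom_eq => // x U s oU Ux Us.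
have [a [b [ub sab]]] := ao_frac aY (s (f x)) I.
(* Stated for a variable point equal to f x, so that the fraction can be moved to g x. *)
have sg y : y = f x -> phi b y \is a GRing.unit /\ s y = phi a y / phi b y.
  by move=> ->.
have [ub' ->] := sg (g x) (esym (fgx x)).
rewrite sab !rmorphM fg; congr (_ * _).
by rewrite !rmorphV // fg.
Qed.

Section PointHom.
Variables (X : lrSpace) (x : X) (M : fieldType) (f : {rmorphism stalk x -> M}).
Hypothesis f_local : forall a, f a != 0 -> a \is a GRing.unit.

Let hm : spec_field M -> X := fun=> x.

Fact pt_hom_cont (W : set X) : open W -> open (hm @^-1` W).
Proof.
move=> oW; have [Wt|Wt] := pselect (W x).
  by rewrite (_ : _ @^-1` _ = setT); [exact: openT|apply/seteqP; split].
by rewrite (_ : _ @^-1` _ = set0); [exact: open0|apply/seteqP; split].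
Qed.

Fact pt_hom_local (u : spec_field M) (a : stalk (hm u)) :
  (f a : stalk u) \is a GRing.unit -> a \is a GRing.unit.
Proof. by move=> /= fa; apply: f_local; rewrite -unitfE. Qed.

Definition pt_hom : lrHom (spec_field M) X :=
  @LrHom (spec_field M) X hm pt_hom_cont (fun=> f) pt_hom_local
    (fun _ _ _ _ => I).

End PointHom.

Lemma field_rmorph_local (K M : fieldType) (f : {rmorphism K -> M}) a :
  f a != 0 -> a \is a GRing.unit.
Proof. by rewrite fmorph_eq0 unitfE. Qed.

Lemma spec_field_affine (M : fieldType) :
  affine_open [set: spec_field M] (fun (a : M) (x : spec_field M) => a : stalk x).
Proof.
split=> //.
- move=> P [P0 P1 PB] PP; exists tt; split; last by case.
  split=> // a; rewrite /= unitfE negbK; apply/idP/eqP => [aP|-> //].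
  apply/eqP; apply: contraNT P1 => a0.
  by rewrite -(mulVf a0) -[_ * _]addr0; exact: PB.
- move=> W _; split=> [oW|[I ->]].
    exists [set a | W tt]; apply/seteqP; split=> [[] Wt|[] [_ [a //]]].
    by split=> //; exists 1 => //=; rewrite unitr1.
  rewrite setTI; set B := (X in open X).
  have [Wt|Wt] := pselect (B tt).
    by rewrite (_ : B = setT); [exact: openT|apply/seteqP; split=> // -[]].
  by rewrite (_ : B = set0); [exact: open0|apply/seteqP; split=> // -[]].
- by move=> x s _; exists s, 1; rewrite /= unitr1 divr1.
- by move=> x a _ /= ->; exists 1; rewrite ?unitr1 ?mulr0.
Qed.

Lemma spec_field_scheme (M : fieldType) : is_scheme (spec_field M).
Proof.
by move=> x; exists setT, M, (fun a x => a); split=> //; exact: spec_field_affine.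
Qed.

(** These are the test objects on which the universal property of a product is evaluated in the
    proof of separatedness. *)
Definition spec_fieldK (K M : fieldType) (f : {rmorphism K -> M}) : kScheme K :=
  @KScheme K (spec_field M) (@spec_field_scheme M)
    (@pt_hom (spec_field K) tt M f (@field_rmorph_local K M f)).

(** The inverse of a germ extends to a section on a neighbourhood, and the product with [s] is 1 on
    a smaller one. *)
Lemma unit_locus_open (X : lrSpace) (U : set X) s : open U -> sect U s ->
  open [set x | U x /\ s x \is a GRing.unit].
Proof.
move=> oU Us; rewrite openE => x [Ux su].
have [W [t [oW Wx Wt tx]]] := germ_ex (s x)^-1.
have oUW : open (U `&` W) by exact: openI.
have Ust : sect (U `&` W) (fun y => s y * t y).
  by apply: sectM => //; [exact: (sect_res oU)|exact: (sect_res oW)].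
have [] := @germ_eq X (U `&` W) _ _ x oUW Ust (sect1 oUW) (conj Ux Wx).
  by rewrite tx divrr.
move=> V [oV Vx VUW st].
rewrite /interior nbhsE; exists V; first by split.
move=> y Vy; have [Uy _] := VUW y Vy; split=> //.
by have := st y Vy; move/(congr1 (fun z => z \is a GRing.unit));
  rewrite unitr1 unitrM => /andP[].
Qed.

(** A whole family of germs is needed, because a germ at x and a germ at e x have different
    types. *)
Lemma lrId_stalk (X : lrSpace) (e : lrHom X X) (s : forall x : X, stalk x) x :
  e = lrId X -> hstalk e x (s (e x)) = s x.
Proof. by move=> ->. Qed.

Lemma lrId_point (X : lrSpace) (e : lrHom X X) x : e = lrId X -> e x = x.
Proof. by move=> ->. Qed.

Lemma residue_field (X : lrSpace) (z : X) : exists (M : fieldType)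
  (f : {rmorphism stalk z -> M}), forall a, f a != 0 -> a \is a GRing.unit.
Proof.
have pz : prime_set [set a : stalk z | a \isn't a GRing.unit].
  split=> /=.
  - by rewrite unitr0.
  - by rewrite unitr1.
  - move=> a b au bu; apply/negP => /stalk_local[]; first exact/negP.
    by rewrite unitrN (negPf bu).
  - by move=> a b bu; rewrite unitrM negb_and bu orbT.
  - by move=> a b; rewrite unitrM negb_and => /orP.
have [M [f [f0 _]]] := prime_set_field pz.
exists M, f => a fa; apply: contraNT fa => au; apply/eqP/f0; exact: au.
Qed.

Section KHom.
Variable K : fieldType.

Fact kComp_kmapP (X Y Z : kScheme K) (g : kHom Y Z) (f : kHom X Y) x c :
  hstalk (lrComp g f) x (kscalar (lrComp g f x) c) = kscalar x c.
Proof. by rewrite /= (kmapP g) (kmapP f). Qed.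

Definition kComp (X Y Z : kScheme K) (g : kHom Y Z) (f : kHom X Y) : kHom X Z :=
  KHom (@kComp_kmapP X Y Z g f).

(** The image of the diagonal is the locus where the two pullbacks of every global function have a
    non-unit difference; its complement is a union of unit loci. The other clauses follow from [p]
    being a left inverse of [d]. *)
Lemma affine_separated (X : kScheme K) : affine X -> separated X.
Proof.
move=> [A [k [phi [aX _]]]] P p q d pq pd qd.
pose u z a : stalk z := hstalk p z (phi a (p z)) - hstalk q z (phi a (q z)).
have du x a : hstalk d x (u (d x) a) = 0.
  rewrite rmorphB /=.
  have := @lrId_stalk X (lrComp p d) (phi a) x pd; rewrite /= => ->.
  by have := @lrId_stalk X (lrComp q d) (phi a) x qd; rewrite /= => ->; rewrite subrr.
have rangeE : range d = [set z | forall a, u z a \isn't a GRing.unit].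
  apply/seteqP; split=> [_ [x _ <-] a|z uz].
    by rewrite -(@hstalk_unit _ _ d) du unitr0.
  have [M [f f_loc]] := residue_field z.
  have fpq a : f (hstalk p z (phi a (p z))) = f (hstalk q z (phi a (q z))).
    apply/eqP; rewrite -subr_eq0 -rmorphB.
    by apply/negP => /negP /f_loc uu; have := uz a; rewrite /u uu.
  (* The point [z] as a morphism from the spectrum of a field; its two projections agree because the
     differences die in that field. *)
  pose i0 : lrHom (spec_fieldK (f \o kscalar z)) P := pt_hom f_loc.
  have i0P (x : spec_fieldK (f \o kscalar z)) c :
    hstalk i0 x (kscalar (i0 x) c) = kscalar x c by [].
  pose i : kHom (spec_fieldK (f \o kscalar z)) P := @KHom K (spec_fieldK (f \o kscalar z)) P i0 i0P.
  have piqi : lrComp p i = lrComp q i.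
    by apply: (lrHom_affine_eq aX) => x a; exact: fpq.
  (* Both [i] and its projection followed by the diagonal solve the same mapping problem, so
     uniqueness puts [z] on the diagonal. *)
  have [h [_ hu]] := pq _ (kComp p i) (kComp q i).
  have hi : h = i by apply: hu.
  have hd : h = kComp d (kComp p i).
    apply: hu; split; apply: (lrHom_affine_eq aX) => x a /=.
      by have := @lrId_stalk X (lrComp p d) (phi a) (p (i x)) pd; rewrite /= => ->.
    have := @lrId_stalk X (lrComp q d) (phi a) (p (i x)) qd; rewrite /= => ->.
    exact: fpq.
  exists (p z) => //.
  have point_eq (e1 e2 : kHom (spec_fieldK (f \o kscalar z)) P) :
    e1 = e2 -> (e1 : lrHom (spec_field M) P) tt = (e2 : lrHom (spec_field M) P) tt.
    by move=> ->.
  by apply: (point_eq (kComp d (kComp p i)) i); rewrite -hd.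
split.
- rewrite rangeE -[X in closed X]setCK; apply: open_closedC.
  have uo a : open [set z | setT z /\ u z a \is a GRing.unit].
    have st (e : kHom P X) : sect setT (fun z => hstalk e z (phi a (e z))).
      rewrite -(preimage_setT e); apply: hsect; first exact: openT.
      exact: ao_sect aX a.
    apply: unit_locus_open; first exact: openT.
    by apply: sectB; [exact: openT|exact: st..].
  rewrite (_ : ~` _ = \bigcup_a [set z | setT z /\ u z a \is a GRing.unit]).
    exact: bigcup_open.
  apply/seteqP; split=> [z /= /existsNP[a /negP]|z [a _ [_ uu]] /= nu].
    by rewrite negbK => uu; exists a.
  by have := nu a; rewrite uu.
- move=> x y dxy; rewrite -(lrId_point x pd) -(lrId_point y pd) /=.
  by rewrite dxy.
- move=> U oU; exists (p @^-1` U); first exact: hcont.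
  apply/seteqP; split=> x /=; have := lrId_point x pd; rewrite /= => -> //.
- move=> x a; have [U [s [oU Ux Us <-]]] := germ_ex a.
  exists (hstalk p (d x) (s (p (d x)))).
  by have := @lrId_stalk X (lrComp p d) s x pd.
Qed.

End KHom.

(** * Points in an affine chart as algebra homomorphisms *)

Section ChartPoints.
Variables (K : fieldType) (V : kScheme K) (U : set V) (A : comNzRingType).
Variables (k : {rmorphism K -> A}) (phi : A -> forall x : V, stalk x).
Hypothesis cU : affine_chart U k phi.
Let aU := cU.1.
Variables (M : fieldType) (iota : K -> M).

Lemma hom_of_point (h : points V iota) : U (point_center h) ->
  exists g : {rmorphism A -> M},
    (forall a, g a = hstalk (point_map h) tt (phi a (point_center h))) /\
    (forall c, g (k c) = iota c).
Proof.
move=> Uh; have [g gE] : exists g : {rmorphism A -> M},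
    forall a, g a = hstalk (point_map h) tt (phi a (point_center h)).
  apply: rmorph_ex => [a b||a b].
  - by rewrite (ao_B aU) // rmorphB.
  - by rewrite (ao_1 aU) // rmorph1.
  - by rewrite (ao_M aU) // rmorphM.
by exists g; split=> // c; rewrite gE cU.2 // pointP.
Qed.

(** The kernel of [g] is prime and determines the point; [g] then extends to the stalk, a
    localization of [A] at that kernel. *)
Lemma point_of_hom (g : {rmorphism A -> M}) :
  (forall c, g (k c) = iota c) ->
  exists h : points V iota, U (point_center h) /\
    (forall a, hstalk (point_map h) tt (phi a (point_center h)) = g a).
Proof.
move=> gk; pose P : pred A := [pred a | g a == 0].
have P1 : idealr_closed P.
  split; rewrite ?inE /=; [by rewrite rmorph0|by rewrite rmorph1 oner_eq0|].
  move=> a u v; rewrite !inE /= => /eqP gu /eqP gv.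
  by rewrite rmorphD rmorphM gu gv mulr0 addr0.
have P2 : prime_idealr_closed P.
  by move=> u v; rewrite !inE /= rmorphM mulf_eq0.
have [x [[Ux xP] _]] := ao_prime aU P1 P2.
have ux a : phi a x \is a GRing.unit = (g a != 0).
  by have := xP a; rewrite inE /= => ->; rewrite negbK.
(* Equal germs differ by an element killed by some [c] outside the kernel of [g], so [g] cannot
   separate them. *)
have wd a b : phi a x = phi b x -> g a = g b.
  move=> ab; apply/eqP; rewrite -subr_eq0 -rmorphB.
  have [||c uc cab] := ao_ker aU (x := x) (a := a - b) => //.
    by rewrite (ao_B aU) // ab subrr.
  have := congr1 g cab; rewrite rmorph0 rmorphM => /eqP.
  by rewrite mulf_eq0 (negPf (_ : g c != 0)) // -ux.
have wd2 a b a' b' : phi b x \is a GRing.unit -> phi b' x \is a GRing.unit ->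
    phi a x / phi b x = phi a' x / phi b' x -> g a / g b = g a' / g b'.
  move=> ub ub' e; apply/eqP; rewrite eqr_div -?ux // -!rmorphM; apply/eqP/wd.
  rewrite !(ao_M aU) // -[phi a x](divrK ub) e mulrAC divrK //.
have frac_ex s : exists ab : A * A,
    phi ab.2 x \is a GRing.unit /\ s = phi ab.1 x / phi ab.2 x.
  by have [a [b ab]] := ao_frac aU s Ux; exists (a, b).
have [F FE] := choice frac_ex.
pose f0 s := g (F s).1 / g (F s).2.
have f0E s a b : phi b x \is a GRing.unit -> s = phi a x / phi b x ->
    f0 s = g a / g b.
  by move=> ub sab; have [uF sF] := FE s; apply: wd2 => //; rewrite -sF.
have f0a a : f0 (phi a x) = g a.
  by rewrite (@f0E _ a 1) ?(ao_1 aU) ?unitr1 // ?divr1 // rmorph1 divr1.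
have [f fE] : exists f : {rmorphism stalk x -> M}, forall s, f s = f0 s.
  apply: rmorph_ex => [s t||s t].
  - have [[us sF] [ut tF]] := (FE s, FE t).
    have ust : phi ((F s).2 * (F t).2) x \is a GRing.unit.
      by rewrite (ao_M aU) // unitrM us.
    rewrite (@f0E _ ((F s).1 * (F t).2 - (F t).1 * (F s).2) ((F s).2 * (F t).2)) //.
      rewrite /f0 -[X in _ = _ + X]mulNr addf_div -?ux //.
      by rewrite rmorphB !rmorphM mulNr.
    rewrite (ao_B aU) // !(ao_M aU) // {1}sF {1}tF mulrBl; congr (_ - _).
      by rewrite -mulrA invrM // [phi (F t).2 x * _]mulrA divrr // mul1r.
    by rewrite -mulrA invrM // [_ ^-1 / _]mulrC [phi (F s).2 x * _]mulrA divrr // mul1r.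
  - by rewrite -(ao_1 aU Ux) f0a rmorph1.
  - have [[us sF] [ut tF]] := (FE s, FE t).
    have ust : phi ((F s).2 * (F t).2) x \is a GRing.unit.
      by rewrite (ao_M aU) // unitrM us.
    rewrite (@f0E _ ((F s).1 * (F t).1) ((F s).2 * (F t).2)) //.
      by rewrite /f0 !rmorphM mulf_div.
    by rewrite !(ao_M aU) // {1}sF {1}tF invrM // mulrACA [_ ^-1 / _]mulrC.
have f_loc s : f s != 0 -> s \is a GRing.unit.
  have [us sF] := FE s; rewrite fE /f0 => gF; rewrite sF unitrM unitrV us andbT ux.
  by apply: contraNneq gF => ->; rewrite mul0r.
have hP c : hstalk (pt_hom f_loc) tt (kscalar (pt_hom f_loc tt) c) = iota c.
  by rewrite /= -gk -(f0a (k c)) -fE cU.2.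
by exists (Point hP); split=> // a; rewrite /= fE f0a.
Qed.

End ChartPoints.

Lemma rmorph_mmap (n : nat) (R : comNzRingType) (A B : comNzRingType)
    (g : {rmorphism A -> B}) (k : {rmorphism R -> A}) (l : {rmorphism R -> B})
    (x : 'I_n -> A) (y : 'I_n -> B) (p : {mpoly R[n]}) :
  (forall c, g (k c) = l c) -> (forall i, g (x i) = y i) ->
  g (mmap k x p) = mmap l y p.
Proof.
move=> gk gx; rewrite /mmap rmorph_sum; apply: eq_bigr => m _.
rewrite rmorphM gk /mmap1 rmorph_prod; congr (_ * _).
by apply: eq_bigr => i _; rewrite rmorphXn gx.
Qed.

(** * The affine variety with coordinate ring K[x] inside a field *)

Section GenSubring.
Variables (K L : fieldType) (b : {rmorphism K -> L}) (n : nat) (x : 'I_n -> L).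

Definition gen_set : set L := [set z | exists p : {mpoly K[n]}, z = mmap b x p].
Fact gen_1 : gen_set 1. Proof. by exists 1; rewrite rmorph1. Qed.
Fact gen_B y z : gen_set y -> gen_set z -> gen_set (y - z).
Proof. by move=> [p ->] [q ->]; exists (p - q); rewrite rmorphB. Qed.
Fact gen_M y z : gen_set y -> gen_set z -> gen_set (y * z).
Proof. by move=> [p ->] [q ->]; exists (p * q); rewrite rmorphM. Qed.
Definition gen : subring L := Subring gen_1 gen_B gen_M.

Lemma gen_mmap p : gen (mmap b x p). Proof. by exists p. Qed.
Lemma gen_base c : gen (b c). Proof. by exists c%:MP; rewrite mmapC. Qed.
Lemma gen_gen i : gen (x i). Proof. by exists 'X_i; rewrite mmapX mmap1U. Qed.

Definition gen_scalar : {rmorphism K -> sr_ring gen} :=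
  projT1 (cid (sr_lift_ex gen_base)).
Lemma gen_scalarE c : srval (gen_scalar c) = b c.
Proof. by rewrite /gen_scalar; case: cid. Qed.

Definition gen_var i : sr_ring gen := srmk gen (x i).
Lemma gen_varE i : srval (gen_var i) = x i.
Proof. by rewrite srmkK //; exact: gen_gen. Qed.

Lemma srval_gen p : srval (mmap gen_scalar gen_var p) = mmap b x p.
Proof.
by apply: rmorph_mmap => [c|i]; [exact: gen_scalarE|exact: gen_varE].
Qed.

Lemma gen_surj (a : sr_ring gen) : exists p, mmap gen_scalar gen_var p = a.
Proof.
have [p ap] := srvalP a; exists p; apply: srval_inj.
by rewrite srval_gen -ap.
Qed.

Definition gen_scheme : kScheme K := SpecK gen_scalar.

Lemma gen_affine : affine gen_scheme.
Proof.
exists (sr_ring gen), gen_scalar, (@spec_chart L gen); exact: spec_affine_chart.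
Qed.

Fact gen_varietyP : [/\ separated gen_scheme, integral_scheme gen_scheme
  & finite_type gen_scheme].
Proof.
split; [exact: affine_separated gen_affine|exact: spec_integral|].
exists 1%N, (fun=> setT); split=> [y|_]; first by exists ord0.
exists (sr_ring gen), gen_scalar, (@spec_chart L gen), n, gen_var.
by split; [exact: spec_affine_chart|exact: gen_surj].
Qed.

Definition gen_variety : variety K := Variety gen_varietyP.

Definition in_pt (y : gen_variety) : set L := fun z => (y : spec gen) z.

Lemma gen_point (M : fieldType) (i : {rmorphism K -> M}) (m : 'I_n -> M) :
  (forall p, mmap b x p = 0 -> mmap i m p = 0) ->
  exists h : points gen_variety i, forall p,
    in_pt (point_center h) (mmap b x p) <-> mmap i m p = 0.
Proof.
move=> ker.
have [|g gE] := @factor_rmorph {mpoly K[n]} (sr_ring gen) M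
  (mmap gen_scalar gen_var) (mmap i m) gen_surj.
  by move=> p /(congr1 (@srval _ _)); rewrite srval_gen => /ker.
have gk c : g (gen_scalar c) = i c by have := gE c%:MP; rewrite /= !mmapC.
have [h [_ hE]] := point_of_hom (spec_affine_chart gen_scalar) gk.
exists h => p; rewrite -gE -hE -srval_gen.
set a := mmap _ _ p; set y := point_center h.
have -> : in_pt y (srval a) <-> ~ (spec_chart a y \is a GRing.unit).
  by rewrite spec_chart_unit; split=> [h1 h2|/contrapT].
rewrite -(@hstalk_unit _ _ (point_map h) tt) unitfE.
by split=> [/negP/negPn/eqP|->] //; rewrite eqxx.
Qed.

Lemma point_gen (M : fieldType) (i : {rmorphism K -> M})
    (h : points gen_variety i) : exists m : 'I_n -> M,
  (forall p, mmap b x p = 0 -> mmap i m p = 0) /\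
  forall p, in_pt (point_center h) (mmap b x p) <-> mmap i m p = 0.
Proof.
have [g [gE gk]] := hom_of_point (spec_affine_chart gen_scalar) (h := h) I.
have gm p : g (mmap gen_scalar gen_var p) = mmap i (g \o gen_var) p.
  exact: rmorph_mmap.
exists (g \o gen_var); split=> p.
  rewrite -srval_gen -gm => p0; rewrite (_ : mmap _ _ _ = 0) ?rmorph0 //.
  by apply: srval_inj; rewrite p0.
rewrite -gm gE -srval_gen; set a := mmap _ _ p; set y := point_center h.
have -> : in_pt y (srval a) <-> ~ (spec_chart a y \is a GRing.unit).
  by rewrite spec_chart_unit; split=> [h1 h2|/contrapT].
rewrite -(@hstalk_unit _ _ (point_map h) tt) unitfE.
by split=> [/negP/negPn/eqP|->] //; rewrite eqxx.
Qed.

Lemma gen_smooth c (f : 'I_c -> {mpoly K[n]}) (s : 'I_c -> 'I_n) (y : gen_variety) :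
  (forall p, mmap b x p = 0 <->
     exists g : 'I_c -> {mpoly K[n]}, p = \sum_(i < c) g i * f i) ->
  ~ in_pt y (mmap b x (\det (\matrix_(i, j) mderiv (s j) (f i)))) ->
  smooth_at y.
Proof.
move=> ker dy.
exists setT, (sr_ring gen), gen_scalar, (@spec_chart L gen), n, c, gen_var, f.
split=> //; [exact: spec_affine_chart|exact: gen_surj| |].
  move=> p; rewrite -ker -srval_gen; split=> [->//|p0].
  exact: srval_inj.
exists s; move: dy; set D := (X in mmap b x X) => dy.
have [e eE] : exists e : {rmorphism sr_ring gen -> stalk (y : Spec gen)},
    forall a, e a = spec_chart a y.
  have aU := @spec_affine_open L gen.
  by apply: rmorph_ex => [u v||u v]; rewrite ?(ao_B aU) ?(ao_1 aU) ?(ao_M aU).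
set J := (X in \det X).
have -> : J = map_mx e (map_mx (mmap gen_scalar gen_var)
    (\matrix_(i, j) mderiv (s j) (f i))).
  by apply/matrixP => i j; rewrite !mxE eE.
rewrite !det_map_mx eE spec_chart_unit srval_gen; exact: dy.
Qed.

Lemma gen_basic_open p : open [set y : gen_variety | ~ in_pt y (mmap b x p)].
Proof. exact/spec_basic_open/gen_mmap. Qed.

End GenSubring.

Lemma spec_generic_point (L : fieldType) (S : subring L) :
  generic_point (spec_generic S : Spec S).
Proof.
move=> O [y Oy] oO; exists (spec_generic S); split=> //.
exact: open_generic oO Oy.
Qed.

(** The function field is the fraction field of K[x], which embeds in [F]; regularity passes to
    subextensions. *)
Lemma gen_geometrically_integral (K F : fieldType) (j : {rmorphism K -> F})
    (n : nat) (x : 'I_n -> F) :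
  regular_extension j -> geometrically_integral (gen_variety j x).
Proof.
move=> [Om [i reg]]; pose S := gen j x.
pose y : gen_variety j x := spec_generic S.
have unit_y (a : stalk y) : a != 0 -> a \is a GRing.unit.
  have [c [d [Sc Sd yd acd]]] := srvalP a.
  move=> a0; apply/(spec_stalk_unit Sc Sd yd acd) => c0.
  move/eqP: a0; apply; apply: srval_inj.
  by rewrite acd [c]c0 mul0r.
have p0 : prime_set [set a : stalk y | a = 0].
  split=> //=.
  - by apply/eqP; rewrite oner_eq0.
  - by move=> a b -> ->; rewrite subrr.
  - by move=> a b ->; rewrite mulr0.
  - move=> a b ab; have [->|a0] := eqVneq a 0; first by left.
    by right; apply: (mulrI (unit_y a a0)); rewrite mulr0.
(* The generic stalk is already a field, but its type is only a [comUnitRingType]; [F'] is an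
   isomorphic [fieldType]. *)
have [F' [f [f0 ff]]] := prime_set_field p0.
have f_surj z : exists a, f a = z.
  have [a [b [fb ->]]] := ff z; exists (a / b).
  rewrite rmorphM rmorphV //; apply: unit_y; apply: contraNneq fb => ->.
  by rewrite rmorph0.
have f_inj : injective f.
  by move=> a b fab; apply/subr0_eq/f0; rewrite rmorphB fab subrr.
have [h hE] : exists h : {rmorphism F' -> F}, forall a, h (f a) = srval a.
  apply: (@factor_rmorph (stalk y) F' F f (@srval _ _)) => // a /f0 -> //.
have hk c : h (f (kscalar y c)) = j c.
  transitivity (srval (spec_chart (gen_scalar j x c) (y : Spec S))).
    by rewrite hE; congr srval; exact: (spec_scalarE (gen_scalar j x) y).
  by rewrite spec_chartE gen_scalarE.
exists y, F', f; split; first exact: spec_generic_point.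
  have [s fs] := choice f_surj.
  by exists s => [a|z]; [apply: f_inj|]; rewrite fs.
exists Om, (i \o h) => m a ind b alg_b /= b0.
apply: (reg m (h \o a)) => //=.
  move=> c c0; apply: ind; apply: (fmorph_inj h).
  rewrite rmorph0 rmorph_sum -[RHS]c0; apply: eq_bigr => l _.
  by rewrite rmorphM /= hk.
move=> l; have := alg_b l.
have -> // : (i \o h) \o (f \o kscalar y) = i \o j :> (K -> Om).
by apply/funext => c /=; rewrite hk.
Qed.

(** * Ultrapowers *)

Lemma filter_ord (I : Type) (U : set_system I) (n : nat) (A : 'I_n -> set I) :
  Filter U -> (forall k, U (A k)) -> U [set i | forall k, A k i].
Proof.
move=> FU; elim: n A => [|n IH] A UA.
  by apply: filterS filterT => i _ [].
apply: filterS (filterI (UA ord0) (IH _ (fun k => UA (lift ord0 k)))).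
by move=> i [A0 AS] k; case: (unliftP ord0 k) => [k' ->|->].
Qed.

Lemma ultra_setC (I : Type) (U : set_system I) (A : set I) :
  UltraFilter U -> U (~` A) <-> ~ U A.
Proof.
move=> uU; split=> [UcA UA|nUA].
  by have := filter_ex (filterI UA UcA); case=> i [].
by have [] := in_ultra_setVsetC A uU.
Qed.

(** The sets of lists containing a given finite list generate a proper filter. In an ultrafilter
    above it, any finitely many elements belong to almost every list. *)
Lemma ultra_seq (T : eqType) : exists U : set_system (seq T),
  UltraFilter U /\ forall x : T, U [set c | x \in c].
Proof.
pose G : set_system (seq T) :=
  [set A | exists c0 : seq T, forall c, {subset c0 <= c} -> A c].
have FG : ProperFilter G.
  split; first by move=> [c0 /(_ c0)]; exact.
  split; first by exists [::].
  - move=> A B [a aA] [b bB]; exists (a ++ b) => c sub; split.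
      by apply: aA => x xa; apply: sub; rewrite mem_cat xa.
    by apply: bB => x xb; apply: sub; rewrite mem_cat xb orbT.
  - by move=> A B AB [a aA]; exists a => c /aA; exact: AB.
have [U [uU GU]] := ultraFilterLemma FG.
exists U; split=> // x; apply: GU; exists [:: x] => c; apply.
by rewrite mem_seq1.
Qed.

Section Ultrapower.
Variables (I : pointedType) (U : set_system I) (uU : UltraFilter U).

Lemma ultrapower_field (M : fieldType) :
  exists (L : fieldType) (p : {rmorphism (I -> M) -> L}),
    (forall z, exists f, p f = z) /\
    (forall f g, p f = p g <-> U [set i | f i = g i]).
Proof.
have FU : Filter U by apply: ultra_proper.
have pU : prime_set [set f : I -> M | U [set i | f i = 0]].
  split=> /=.
  - by apply: filterS filterT.
  - move=> /(@filter_ex _ _ _)[i] /eqP; rewrite oner_eq0 //.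
  - move=> f g Uf Ug; apply: filterS (filterI Uf Ug) => i /= [fi gi].
    by rewrite -[LHS]/(f i - g i) fi gi subrr.
  - by move=> f g; apply: filterS => i /= gi; rewrite -[LHS]/(f i * g i) gi mulr0.
  - move=> f g Ufg; have [Uf|Uf] := in_ultra_setVsetC [set i | f i = 0] uU.
      by left.
    right; apply: filterS (filterI Ufg Uf) => i /= [fgi fi].
    by move/eqP: fgi; rewrite -[_ i]/(f i * g i) mulf_eq0 => /orP[] /eqP.
have [L [p [p0 pf]]] := prime_set_field pU.
have pE f g : p f = p g <-> U [set i | f i = g i].
  rewrite (_ : (p f = p g) = (p (f - g) = 0)); last first.
    by rewrite rmorphB; apply/propext; split=> [->|/subr0_eq//]; rewrite subrr.
  rewrite p0 /=; split; apply: filterS => i.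
    by move=> fg; apply/subr0_eq.
  by move=> /= fg; rewrite -[LHS]/(f i - g i) fg subrr.
exists L, p; split=> // z; have [f [g [pg0 ->]]] := pf z.
(* Every fraction is already a class of functions: division in [M] is total, and [g] vanishes only
   on a negligible set. *)
exists (fun i => f i / g i); apply: (mulIf pg0); rewrite divfK // -rmorphM.
have Ug : U (~` [set i | g i = 0]).
  by apply/(ultra_setC _ uU) => /p0 g0; move/eqP: pg0; apply.
apply/pE; apply: filterS Ug => i /= /eqP gi.
by rewrite -[LHS]/(f i / g i * g i) divfK.
Qed.

Variables (E : language) (M : Lfield E).

(** The theorem of Los; the symbols of [E] are interpreted through the representatives chosen by
    [r]. *)
Lemma ultrapower_Lfield : exists (N : Lfield E) (p : {rmorphism (I -> M) -> N}),
  (forall f g, p f = p g <-> U [set i | f i = g i]) /\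
  elementary (M := Lstruct M) (N := Lstruct N) (fun m => p (fun=> m)).
Proof.
have FU : Filter U by apply: ultra_proper.
have [L [p [p_surj pE]]] := ultrapower_field M.
have [r rK] := choice p_surj.
have rE f : U [set i | r (p f) i = f i] by apply/pE; rewrite rK.
pose N : Lfield E := @MkLfield E L
  (fun g a => p (fun i => Lfield_fun (f := g) (fun k => r (a k) i)))
  (fun R a => U [set i | Lfield_rel (r := R) (fun k => r (a k) i)]).
have tvalE (v : nat -> I -> M) (t : term (enrich E)) :
    @tval _ (Lstruct N) (fun n => p (v n)) t =
    p (fun i => @tval _ (Lstruct M) (fun n => v n i) t).
  elim: t => [//|[g|g] a IH] /=.
    case: g a IH => /= a IH; rewrite ?IH.
    - by rewrite -rmorphD.
    - by rewrite -rmorphN.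
    - by rewrite -rmorphM.
    - by rewrite -[LHS](rmorph0 p).
    - by rewrite -[LHS](rmorph1 p).
  apply/pE; apply: filterS (filter_ord FU (fun k => rE
    (fun i => @tval _ (Lstruct M) (fun n => v n i) (a k)))) => i /= h.
  by congr Lfield_fun; apply/funext => k; rewrite IH h.
have los (phi : formula (enrich E)) (v : nat -> I -> M) :
    @sat _ (Lstruct N) (fun n => p (v n)) phi <->
    U [set i | @sat _ (Lstruct M) (fun n => v n i) phi].
  elim: phi v => [t u|R a|psi IH|psi IH1 chi IH2|n psi IH] v /=.
  - by rewrite !tvalE pE.
  - have UA := filter_ord FU (fun k => rE
      (fun i => @tval _ (Lstruct M) (fun n => v n i) (a k))).
    split=> h; apply: filterS (filterI UA h) => i /= [ri];
      rewrite (_ : (fun k => r _ i) = fun k =>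
        @tval _ (Lstruct M) (fun n => v n i) (a k)) //;
      by apply/funext => k; rewrite tvalE ri.
  - rewrite IH -(ultra_setC _ uU); by [].
  - rewrite IH1 IH2; split=> [[h1 h2]|h]; first exact: filterI.
    by split; apply: filterS h => i [].
  - have upd (w : I -> M) : @update _ (Lstruct N) (fun n => p (v n)) n (p w) =
        fun m => p (fun i => @update _ (Lstruct M) (fun n => v n i) n (w i) m).
      by apply/funext => m; rewrite /update; case: ifP.
    split=> [[x]|].
      rewrite -(rK x) upd => /(IH (fun m i => _)) h.
      by apply: filterS h => i hi; exists (r x i).
    move=> h.
    (* Witnesses are chosen index by index, with 0 where there is none, to form a single element of
       the ultrapower. *)
    have ex_w i : exists x : M, @sat _ (Lstruct M) (fun n => v n i) (Ex n psi) ->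
        sat (@update _ (Lstruct M) (fun n => v n i) n x) psi.
      have [[x hx]|nh] := pselect (@sat _ (Lstruct M) (fun n => v n i) (Ex n psi)).
        by exists x.
      by exists 0.
    have [w wE] := choice ex_w.
    exists (p w); rewrite upd; apply/(IH (fun m i => _)).
    by apply: filterS h => i /wE.
exists N, p; split=> // phi v; split=> h.
  by apply/(los phi (fun n _ => v n)); apply: filterS filterT => i _.
by have /(los phi (fun n _ => v n))/(@filter_ex _ _ _)[] := h.
Qed.

End Ultrapower.

(** No single [theta i] has to be a homomorphism: each identity is only required for almost all
    indices, depending on the elements involved. *)
Lemma ultra_rmorph (F M : fieldType) (I : pointedType) (U : set_system I)
    (L : fieldType) (p : {rmorphism (I -> M) -> L}) (theta : I -> F -> M) :
  Filter U ->
  (forall f g, p f = p g <-> U [set i | f i = g i]) ->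
  (forall x y, U [set i | theta i (x - y) = theta i x - theta i y]) ->
  U [set i | theta i 1 = 1] ->
  (forall x y, U [set i | theta i (x * y) = theta i x * theta i y]) ->
  exists t : {rmorphism F -> L}, forall x, t x = p (theta^~ x).
Proof.
move=> FU pE tB t1 tM; apply: rmorph_ex => [x y||x y].
- by rewrite -rmorphB; apply/pE/tB.
- by rewrite -[RHS](rmorph1 p); apply/pE.
- by rewrite -rmorphM; apply/pE/tM.
Qed.

(** * Polynomials in one more variable *)

Lemma mmap_id (n : nat) (R : comNzRingType) (p : {mpoly R[n]}) :
  mmap (@mpolyC n R) (fun i => 'X_i) p = p.
Proof.
rewrite [RHS]mpolyE; apply: eq_bigr => m _.
rewrite -mul_mpolyC; congr (_ * _); rewrite [RHS]mpolyXE_id.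
by apply: eq_bigr.
Qed.

Lemma mpoly_rmorph_ext (n : nat) (R A : comNzRingType)
    (f g : {rmorphism {mpoly R[n]} -> A}) :
  (forall c, f c%:MP = g c%:MP) -> (forall i, f 'X_i = g 'X_i) -> f =1 g.
Proof.
move=> fgC fgX p; rewrite -(mmap_id p).
pose h : {rmorphism R -> A} := g \o @mpolyC n R.
rewrite (@rmorph_mmap n R {mpoly R[n]} A f (@mpolyC n R) h _ (g \o (fun i => 'X_i))) //.
by rewrite (@rmorph_mmap n R {mpoly R[n]} A g (@mpolyC n R) h _ (g \o (fun i => 'X_i))).
Qed.

Section LastVariable.
Variables (n : nat) (R : comNzRingType).

Definition extend (T : Type) (x : 'I_n -> T) (y : T) : 'I_n.+1 -> T :=
  fun i => if unlift ord_max i is Some k then x k else y.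

Lemma extend_widen T (x : 'I_n -> T) y k :
  extend x y (widen_ord (leqnSn n) k) = x k.
Proof.
rewrite /extend (_ : widen_ord _ _ = lift ord_max k) ?liftK //.
by apply: val_inj; rewrite /= /bump leqNgt ltn_ord.
Qed.

Lemma extend_max T (x : 'I_n -> T) y : extend x y ord_max = y.
Proof. by rewrite /extend unlift_none. Qed.

Lemma extend_split T (x : 'I_n.+1 -> T) :
  x = extend (fun k => x (widen_ord (leqnSn n) k)) (x ord_max).
Proof.
apply/funext => i; rewrite /extend; case: unliftP => [k ->|-> //].
by congr x; apply: val_inj; rewrite /= /bump leqNgt ltn_ord.
Qed.

Lemma ordS_ind (P : 'I_n.+1 -> Prop) :
  (forall k, P (widen_ord (leqnSn n) k)) -> P ord_max -> forall i, P i.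
Proof.
move=> Pw Pm i; case: (unliftP ord_max i) => [k ->|-> //].
rewrite (_ : lift _ _ = widen_ord (leqnSn n) k) //.
by apply: val_inj; rewrite /= /bump leqNgt ltn_ord.
Qed.

Lemma mwidenXi (i : 'I_n) :
  mwiden 'X_i = 'X_(widen_ord (leqnSn n) i) :> {mpoly R[n.+1]}.
Proof. by rewrite /mwiden mmapX mmap1U. Qed.

(** The isomorphism between polynomials in one variable over R[X_1, .., X_n] and polynomials in n +
    1 variables; its inverse is [muni]. *)
Definition mlast (p : {poly {mpoly R[n]}}) : {mpoly R[n.+1]} :=
  (map_poly (@mwiden n R) p).['X_ord_max].

Fact mlast_zmod : zmod_morphism mlast.
Proof. by move=> p q; rewrite /mlast rmorphB hornerD hornerN. Qed.
Fact mlast_monoid : monoid_morphism mlast.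
Proof.
by split=> [|p q]; rewrite /mlast ?rmorph1 ?hornerC // rmorphM hornerM.
Qed.
HB.instance Definition _ := GRing.isZmodMorphism.Build
  {poly {mpoly R[n]}} {mpoly R[n.+1]} mlast mlast_zmod.
HB.instance Definition _ := GRing.isMonoidMorphism.Build
  {poly {mpoly R[n]}} {mpoly R[n.+1]} mlast mlast_monoid.

Lemma mlastC c : mlast c%:P = mwiden c.
Proof. by rewrite /mlast map_polyC hornerC. Qed.

Lemma mlastX : mlast 'X = 'X_ord_max.
Proof. by rewrite /mlast map_polyX hornerX. Qed.

Lemma poly_rmorph_ext (B A : comNzRingType) (f g : {rmorphism {poly B} -> A}) :
  (forall c, f c%:P = g c%:P) -> f 'X = g 'X -> f =1 g.
Proof.
move=> fgC fgX p; elim/poly_ind: p => [|p c IH]; first by rewrite !rmorph0.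
by rewrite !rmorphD !rmorphM IH fgX fgC.
Qed.

Lemma muniX i : muni ('X_i : {mpoly R[n.+1]}) = extend (fun k => ('X_k)%:P) 'X i.
Proof.
rewrite muniE msuppX big_seq1 mcoeffX eqxx scale1r -mul_polyC.
elim/ordS_ind: i => [k|].
  rewrite extend_widen mnm1E -val_eqE /= (ltn_eqF (ltn_ord k)) mulr1.
  congr (_%:P); congr 'X_[_]; apply/mnmP => l; rewrite mnmE !mnm1E.
  by rewrite -val_eqE.
rewrite extend_max mnm1E eqxx expr1 [X in X%:P](_ : _ = 1) ?mul1r //.
rewrite -mpolyX0; congr 'X_[_]; apply/mnmP => l; rewrite mnmE mnm1E mnm0E.
by rewrite -val_eqE /= (gtn_eqF (ltn_ord l)).
Qed.

Lemma mlast_muni p : mlast (muni p) = p.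
Proof.
rewrite -[RHS]/(idfun p).
apply: (@mpoly_rmorph_ext _ _ _ (mlast \o @muni n R) idfun) => [c|i] /=.
  by rewrite muniC mlastC mwidenC.
elim/ordS_ind: i => [k|]; rewrite muniX ?extend_widen ?extend_max.
  by rewrite mlastC mwidenXi.
exact: mlastX.
Qed.

Lemma mlast_surj p : exists q, p = mlast q.
Proof. by exists (muni p); rewrite mlast_muni. Qed.

Lemma mmap_mlast (B : comNzRingType) (b : {rmorphism R -> B}) (x : 'I_n -> B) y p :
  mmap b (extend x y) (mlast p) = (map_poly (mmap b x) p).[y].
Proof.
apply: (@poly_rmorph_ext _ _ (mmap b (extend x y) \o mlast)
  (horner_eval y \o map_poly (mmap b x))) p => [c|] /=; last first.
  by rewrite mlastX map_polyX /horner_eval hornerX mmapX mmap1U extend_max.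
rewrite mlastC map_polyC /= /horner_eval hornerC.
apply: (@mpoly_rmorph_ext _ _ _ (mmap b (extend x y) \o @mwiden n R)
  (mmap b x)) => [d|i] /=.
  by rewrite mwidenC !mmapC.
by rewrite mwidenXi !mmapX !mmap1U extend_widen.
Qed.

Lemma mmap_mwiden (B : comNzRingType) (b : {rmorphism R -> B}) (x : 'I_n -> B) y p :
  mmap b (extend x y) (mwiden p) = mmap b x p.
Proof. by rewrite -mlastC mmap_mlast map_polyC hornerC. Qed.

End LastVariable.

(** * The minimal polynomial of one more generator, with denominators cleared *)

Section MinimalRelation.
Variables (K F : fieldType) (j : {rmorphism K -> F}) (n : nat) (x : 'I_n -> F).
Variable y : F.

Notation red := (map_poly (mmap j x)).
Definition ev (p : {poly {mpoly K[n]}}) : F := (red p).[y].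

Lemma evB p q : ev (p - q) = ev p - ev q.
Proof. by rewrite /ev rmorphB hornerD hornerN. Qed.
Lemma evD p q : ev (p + q) = ev p + ev q.
Proof. by rewrite /ev rmorphD hornerD. Qed.
Lemma evM p q : ev (p * q) = ev p * ev q.
Proof. by rewrite /ev rmorphM hornerM. Qed.
Lemma evC c : ev c%:P = mmap j x c.
Proof. by rewrite /ev map_polyC hornerC. Qed.
Lemma evZ c p : ev (c *: p) = mmap j x c * ev p.
Proof. by rewrite -mul_polyC evM evC. Qed.

Lemma trunc_red (p : {poly {mpoly K[n]}}) : exists q : {poly {mpoly K[n]}},
  red q = red p /\ size q = size (red p).
Proof.
exists (\poly_(i < size (red p)) p`_i).
have e : red (\poly_(i < size (red p)) p`_i) = red p.
  apply/polyP => i; rewrite !coef_map coef_poly; case: ltnP => // h.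
  by rewrite raddf0 -coef_map nth_default.
split=> //; apply/eqP; rewrite eqn_leq size_poly /= -{1}e.
exact: size_poly.
Qed.

Lemma lead_red_neq0 (p : {poly {mpoly K[n]}}) : red p != 0 -> size p = size (red p) ->
  mmap j x (lead_coef p) != 0.
Proof.
by move=> p0 sp; rewrite lead_coefE sp -coef_map -lead_coefE lead_coef_eq0.
Qed.

Lemma pseudo_div (p h : {poly {mpoly K[n]}}) : size h = size (red h) -> red h != 0 ->
  exists k q r, [/\ lead_coef h ^+ k *: p = q * h + r & (size r < size h)%N].
Proof.
move=> sh h0; exists (scalp p h), (p %/ h), (p %% h).
split; first exact: Pdiv.Idomain.divp_eq.
by rewrite Pdiv.Idomain.ltn_modp; apply: contraNneq h0 => ->; rewrite map_poly0.
Qed.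

(** A multiple of the minimal polynomial of [y] over K(x), lifted to coefficients in K[X]. The
    condition on sizes says that the leading coefficient does not vanish at [x], which makes
    pseudo-division meaningful after evaluation. *)
Definition min_rel (h : {poly {mpoly K[n]}}) : Prop :=
  [/\ ev h = 0, red h != 0, size h = size (red h) &
    forall p, ev p = 0 -> red p != 0 -> (size h <= size (red p))%N].

Lemma min_rel_ex : (forall p, ev p = 0 -> red p = 0) \/ exists h, min_rel h.
Proof.
have [H|/existsNP[p0 /not_implyP[p00 p0n]]] :=
  pselect (forall p, ev p = 0 -> red p = 0); first by left.
right; pose Pn m := `[< exists p, [/\ ev p = 0, red p != 0 & size (red p) = m] >].
have exP : exists m, Pn m.
  by exists (size (red p0)); apply/asboolP; exists p0; split=> //; exact/eqP.
have [m /asboolP[p [p1 p2 p3]] minm] := ex_minnP exP.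
have [h [hp sh]] := trunc_red p.
exists h; split.
- by rewrite /ev hp.
- by rewrite hp.
- by rewrite sh hp.
- move=> q q1 q2; rewrite sh p3; apply: minm.
  by apply/asboolP; exists q.
Qed.

Section Min.
Variables (h : {poly {mpoly K[n]}}) (mh : min_rel h).

Lemma min_rel_lead : mmap j x (lead_coef h) != 0.
Proof. by case: mh => _ h0 sh _; exact: lead_red_neq0. Qed.

Lemma min_rel_small (r : {poly {mpoly K[n]}}) : (size r < size h)%N -> ev r = 0 -> red r = 0.
Proof.
case: mh => _ _ _ hmin sr r0; apply: contrapT => /eqP rn.
have := hmin r r0 rn; rewrite leqNgt (leq_ltn_trans _ sr) //.
exact: size_poly.
Qed.

Lemma min_rel_div p : ev p = 0 -> exists k q r,
  lead_coef h ^+ k *: p = q * h + r /\ red r = 0.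
Proof.
case: mh => h0 hn sh _ p0; have [k [q [r [e sr]]]] := pseudo_div p sh hn.
exists k, q, r; split=> //; apply: min_rel_small => //.
have : ev (lead_coef h ^+ k *: p) = 0 by rewrite evZ p0 mulr0.
by rewrite e evD evM h0 mulr0 add0r.
Qed.

Lemma min_rel_size : (1 < size h)%N.
Proof.
case: mh => h0 hn sh _; rewrite ltnNge; apply/negP => /size1_polyC hC.
move: h0; rewrite hC evC => e; move: (hn).
by rewrite hC map_polyC /= e polyC0 eqxx.
Qed.

(** The Euclidean algorithm on [p] and [h]: an element p(x, y) that is not zero divides, in K[x, y],
    a nonzero element of K[x]. *)
Lemma min_rel_bezout p : ev p != 0 ->
  exists u r, mmap j x r != 0 /\ ev (u * p) = mmap j x r.
Proof.
case: (mh) => h0 hn sh hmin.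
have [m] := ubnP (size p); elim: m => // m IH in p * => pm pn0.
have [q [qp sq]] := trunc_red p.
have evq : ev q = ev p by rewrite /ev qp.
have qm : (size q <= m)%N.
  by rewrite sq (leq_trans (size_poly _ _)).
have rq0 : red q != 0.
  by apply: contraNneq pn0 => q0; rewrite -evq /ev q0 horner0.
have sq' : size q = size (red q) by rewrite qp.
have lq := lead_red_neq0 rq0 sq'.
have [sq1|sq1] := leqP (size q) 1.
  have qC := size1_polyC sq1.
  by exists 1, q`_0; rewrite mul1r -evq -evC -qC evq.
have [hq|qh] := leqP (size h) (size q).
  have [k [d [r [e sr]]]] := pseudo_div q sh hn.
  have evr : ev r = mmap j x (lead_coef h) ^+ k * ev p.
    have : ev (lead_coef h ^+ k *: q) = ev r by rewrite e evD evM h0 mulr0 add0r.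
    by rewrite evZ rmorphXn evq.
  have r0 : ev r != 0 by rewrite evr mulf_neq0 // expf_neq0 // min_rel_lead.
  have [||u [s [s0 us]]] := IH r => //.
    by rewrite (leq_trans sr) // (leq_trans hq).
  exists ((lead_coef h ^+ k)%:P * u), s; split=> //.
  by rewrite -us !evM evC evr rmorphXn /= mulrCA mulrA mulrAC.
have [k [d [r [e sr]]]] := pseudo_div h sq' rq0.
have evr : ev r = - ev d * ev p.
  have : ev (lead_coef q ^+ k *: h) = 0 by rewrite evZ h0 mulr0.
  by rewrite e evD evM evq addrC => /eqP; rewrite addr_eq0 mulNr => /eqP.
have [r0|r0] := eqVneq (ev r) 0; last first.
  have [||u [s [s0 us]]] := IH r => //; first exact: leq_trans sr qm.
  exists (- (u * d)), s; split=> //.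
  by rewrite -us -[- _]sub0r -[0]/(0%:P) evM evB evC rmorph0 sub0r !evM evr !mulNr mulrN mulrA.
(* If the remainder dies, then up to a nonzero scalar [h] becomes the product of [d] and [q], with
   [y] a root of [d]. As [q] is not constant, [d] has smaller degree than [h], against
   minimality. *)
have rr0 : red r = 0 by apply: min_rel_small => //; exact: ltn_trans sr qh.
have ed0 : ev d = 0.
  by apply/eqP; move/eqP: evr; rewrite r0 mulNr eq_sym oppr_eq0 mulf_eq0 (negPf pn0) orbF.
have e' : mmap j x (lead_coef q) ^+ k *: red h = red d * red q.
  have := congr1 red e; rewrite rmorphD rmorphM /= rr0 addr0 => <-.
  by rewrite map_polyZ /= rmorphXn.
have lk : mmap j x (lead_coef q) ^+ k != 0 by rewrite expf_neq0.
have rd0 : red d != 0.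
  apply: contraNneq hn => d0; move/eqP: e'; rewrite d0 mul0r scaler_eq0.
  by rewrite (negPf lk).
have := hmin d ed0 rd0; rewrite leqNgt sh -(size_scale (red h) lk) e'.
rewrite size_mul // -sq' -[in X in (_ < X)%N]subn1 -addnBA ?(ltnW sq1) //.
by rewrite -[X in (X < _)%N]addn0 ltn_add2l subn_gt0 sq1.
Qed.

End Min.
End MinimalRelation.

(** * Specializations and composita *)

Lemma mpoly0E (R : comNzRingType) (p : {mpoly R[0]}) : p = (p@_0%MM)%:MP.
Proof.
by apply/mpolyP => m; rewrite mcoeffC (_ : m = 0%MM) ?eqxx ?mulr1 //;
  apply/mnmP => -[].
Qed.

Lemma algebraic_mmap (K Om : fieldType) (l : {rmorphism K -> Om}) (n : nat)
    (z : 'I_n -> Om) (p : {mpoly K[n]}) :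
  (forall t, algebraicOver l (z t)) -> algebraicOver l (mmap l z p).
Proof.
move=> az; apply: (big_ind (algebraicOver l)); first exact: algebraic0.
  by move=> u v; exact: algebraic_add.
move=> m _; apply: algebraic_mul; first exact: algebraic_id.
apply: (big_ind (algebraicOver l)); first exact: algebraic1.
  by move=> u v; exact: algebraic_mul.
move=> t _; elim: (m t) => [|k IH]; first exact: algebraic1.
by rewrite exprS; exact: algebraic_mul.
Qed.

Lemma algebraic_poly_root (K Om : fieldType) (l : {rmorphism K -> Om})
    (p : {poly Om}) (u : Om) :
  p != 0 -> root p u -> (forall i, algebraicOver l p`_i) -> algebraicOver l u.
Proof.
move=> p0 pu pa; apply/integral_algebraic; apply: integral_root p0 pu _.
by move=> c /(nthP 0)[i _ <-]; apply/integral_algebraic.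
Qed.

(** For nonconstant p, a root of p - 1 is algebraic and p takes the value 1 there. *)
Lemma algebraic_nonroot (K : fieldType) (Om : closedFieldType)
    (l : {rmorphism K -> Om}) (p : {poly Om}) :
  p != 0 -> (forall i, algebraicOver l p`_i) ->
  exists u, algebraicOver l u /\ p.[u] != 0.
Proof.
move=> p0 pa; have [p1|p1] := leqP (size p) 1.
  exists 0; split; first exact: algebraic0.
  by have pC := size1_polyC p1; rewrite pC hornerC; rewrite pC polyC_eq0 in p0.
have sp : size (p - 1) = size p.
  by rewrite size_polyDl // size_polyN size_poly1.
have /closed_rootP[u ru] : size (p - 1) != 1%N by rewrite sp; case: (size p) p1 => [|[]].
exists u; split.
  apply: algebraic_poly_root ru _; first by rewrite -size_poly_gt0 sp (ltn_trans _ p1).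
  move=> i; rewrite coefB coef1; apply: algebraic_sub => //.
  by case: eqP => _; [exact: algebraic1|exact: algebraic0].
move: ru; rewrite rootE hornerD hornerN hornerC subr_eq0 => /eqP ->.
exact: oner_neq0.
Qed.

(** Induction on the number of coordinates: the first n are specialized while keeping one
    well-chosen polynomial nonzero, and then the last coordinate is chosen. *)
Lemma nullstellensatz (K M : fieldType) (Om : closedFieldType)
    (i : {rmorphism K -> M}) (l : {rmorphism K -> Om}) (n : nat)
    (c : 'I_n -> M) (q : {mpoly K[n]}) : mmap i c q != 0 ->
  exists z : 'I_n -> Om, [/\ forall t, algebraicOver l (z t),
    forall p, mmap i c p = 0 -> mmap l z p = 0 & mmap l z q != 0].
Proof.
elim: n c q => [|n IH] c q.
  move=> q0; have z : 'I_0 -> Om by case.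
  exists z; split=> [[//]|p|].
    have := mpoly0E p; move: (p@__) => a ->; rewrite !mmapC => /eqP.
    by rewrite fmorph_eq0 => /eqP ->; rewrite raddf0.
  have := mpoly0E q; move: (q@__) q0 => a + qa.
  by rewrite qa !mmapC !fmorph_eq0.
rewrite (extend_split c); set x := fun k => _; set y := c ord_max.
have [{}q ->] := mlast_surj q; rewrite mmap_mlast => q0.
have coefs_alg z (p : {poly {mpoly K[n]}}) : (forall t, algebraicOver l (z t)) -> forall e,
    algebraicOver l (map_poly (mmap l z) p : {poly Om})`_e.
  by move=> za e; rewrite coef_map; exact: algebraic_mmap.
have red0 z (p : {poly {mpoly K[n]}}) : (forall r, mmap i x r = 0 -> mmap l z r = 0) ->
    map_poly (mmap i x) p = 0 -> map_poly (mmap l z) p = 0.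
  move=> zr p0; apply/polyP => e; rewrite coef0 coef_map; apply: zr.
  by have := congr1 (fun f : {poly M} => f`_e) p0; rewrite coef0 coef_map.
(* If [y] is transcendental, all relations hold coefficientwise; a surviving leading coefficient of
   [q] leaves a nonzero polynomial, and any algebraic non-root of it will do. *)
have [tr|[h mh]] := min_rel_ex i x y.
  have rq0 : map_poly (mmap i x) q != 0.
    by apply: contraNneq q0 => ->; rewrite horner0.
  move: (rq0); rewrite -lead_coef_eq0 lead_coefE coef_map; set e := _.-1 => lq.
  have [z [za zr zq]] := IH x q`_e lq.
  have zq0 : map_poly (mmap l z) q != 0.
    apply: contraNneq zq => zq0.
    by have := congr1 (fun f : {poly Om} => f`_e) zq0; rewrite coef0 coef_map => ->.
  have [w [wa wq]] := algebraic_nonroot zq0 (coefs_alg z q za).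
  exists (extend z w); split.
  - by apply: ordS_ind => [k|]; rewrite ?extend_widen ?extend_max.
  - move=> p; have [{}p ->] := mlast_surj p; rewrite !mmap_mlast => /tr p0.
    by rewrite (red0 z p zr p0) horner0.
  - by rewrite mmap_mlast.
have [u [r [r0 ur]]] := min_rel_bezout mh q0.
(* If [y] is algebraic, its value will be a root of the specialized [h]. The leading coefficient
   must survive for this root to exist and for pseudo-division to transfer relations; [r] must
   survive to keep [q] nonzero, by the Bezout identity. *)
have lr0 : mmap i x (r * lead_coef h) != 0.
  by rewrite rmorphM mulf_neq0 // (min_rel_lead mh).
have [z [za zr]] := IH x _ lr0.
rewrite rmorphM mulf_eq0 negb_or => /andP[zr0 zl0].
have sh : (1 < size (map_poly (mmap l z) h))%N.
  apply: leq_trans (min_rel_size mh) _.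
  have := min_rel_size mh; case sE : (size h) => [//|m] _.
  rewrite ltnNge; apply/negP => /leq_sizeP/(_ m (leqnn m)).
  rewrite coef_map => /eqP; apply/negP.
  by move: zl0; rewrite lead_coefE sE.
have /closed_rootP[w wh] : size (map_poly (mmap l z) h) != 1%N.
  by case: (size _) sh => [|[]].
have rel p : ev i x y p = 0 -> (map_poly (mmap l z) p).[w] = 0.
  move=> /(min_rel_div mh)[k [d [s [e s0]]]].
  have := congr1 (fun f => (map_poly (mmap l z) f).[w]) e.
  rewrite map_polyZ rmorphD rmorphM /= (red0 z s zr s0) addr0 hornerZ hornerM.
  rewrite (rootP wh) mulr0 rmorphXn => /eqP.
  by rewrite mulf_eq0 expf_eq0 (negPf zl0) andbF => /eqP.
exists (extend z w); split.
- apply: ordS_ind => [k|]; rewrite ?extend_widen ?extend_max //.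
  apply: (algebraic_poly_root _ wh (coefs_alg z h za)).
  by rewrite -size_poly_gt0 (ltn_trans _ sh).
- move=> p; have [{}p ->] := mlast_surj p; rewrite !mmap_mlast; exact: rel.
- rewrite mmap_mlast; have : ev i x y (u * q - r%:P) = 0.
    by rewrite evB ur evC subrr.
  move=> /rel; rewrite rmorphB rmorphM /= map_polyC hornerD hornerN hornerM hornerC.
  move=> /subr0_eq e; apply: contraNneq zr0 => w0.
  by rewrite -e w0 mulr0.
Qed.

Section PartialPlace.
Variables (K M : fieldType) (Om : closedFieldType).
Variables (i : {rmorphism K -> M}) (l : {rmorphism K -> Om}) (c : seq M).

(** The entries of [c] are taken as coordinates of a point and specialized; an identity among
    entries is a polynomial relation between coordinates, hence preserved. *)
Lemma partial_place : exists theta : M -> Om,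
  [/\ forall x, algebraicOver l (theta x),
      forall x y, x \in c -> y \in c -> x - y \in c ->
        theta (x - y) = theta x - theta y,
      1 \in c -> theta 1 = 1,
      forall x y, x \in c -> y \in c -> x * y \in c ->
        theta (x * y) = theta x * theta y &
      forall a, i a \in c -> theta (i a) = l a].
Proof.
pose x := fun t : 'I_(size c) => c`_t.
have [|z [za zr _]] := @nullstellensatz K M Om i l (size c) x 1.
  by rewrite rmorph1 oner_neq0.
(* Off the list the value is 0; [index] gives repeated entries the same coordinate. *)
pose theta m := if insub (index m c) is Some t then z t else 0.
pose X m : {mpoly K[size c]} := if insub (index m c) is Some t then 'X_t else 0.
have XE m : m \in c -> mmap i x (X m) = m /\ mmap l z (X m) = theta m.
  rewrite -index_mem /theta /X => h; rewrite insubT /= !mmapX !mmap1U.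
  by rewrite /x /= nth_index // -index_mem.
exists theta; split.
- move=> m; rewrite /theta; case: insub => [t|]; [exact: za|exact: algebraic0].
- move=> m m' mc mc' mmc; have [[e1 e2] [e3 e4] [e5 e6]] :=
    And3 (XE m mc) (XE m' mc') (XE (m - m') mmc).
  have := zr (X (m - m') - (X m - X m')).
  rewrite !rmorphB /= e1 e2 e3 e4 e5 e6 subrr => /(_ erefl) /subr0_eq.
  by [].
- move=> c1; have [e1 e2] := XE 1 c1; have := zr (X 1 - 1).
  by rewrite !rmorphB !rmorph1 /= e1 e2 subrr => /(_ erefl) /subr0_eq.
- move=> m m' mc mc' mmc; have [[e1 e2] [e3 e4] [e5 e6]] :=
    And3 (XE m mc) (XE m' mc') (XE (m * m') mmc).
  have := zr (X (m * m') - X m * X m').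
  by rewrite !rmorphB !rmorphM /= e1 e2 e3 e4 e5 e6 subrr => /(_ erefl) /subr0_eq.
- move=> a ac; have [e1 e2] := XE _ ac; have := zr (X (i a) - a%:MP).
  by rewrite !rmorphB /= !mmapC e1 e2 subrr => /(_ erefl) /subr0_eq.
Qed.

End PartialPlace.

Definition lin_indep (K F : fieldType) (j : K -> F) (n : nat) (a : 'I_n -> F) :=
  forall c : 'I_n -> K, \sum_(l < n) j (c l) * a l = 0 -> forall l, c l = 0.

(* An ultraproduct of places of the finitely generated subrings of [M] with
   algebraic values: it embeds [M] into an ultrapower of [Om] with image
   consisting of (non-standard) algebraic elements, which are therefore
   linearly disjoint from the image of [F]. *)
Lemma free_compositum (K F M : fieldType) (j : {rmorphism K -> F})
    (i : {rmorphism K -> M}) : regular_extension j ->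
  exists (L : fieldType) (al : {rmorphism F -> L}) (be : {rmorphism M -> L}),
    (forall c, al (j c) = be (i c)) /\
    forall n (a : 'I_n -> F) (b : 'I_n -> M), lin_indep j a ->
      \sum_(l < n) be (b l) * al (a l) = 0 -> forall l, b l = 0.
Proof.
move=> [Om [e reg]].
have [U [uU Umem]] := ultra_seq M.
have FU : Filter U by apply: ultra_proper.
pose I : pointedType := HB.pack (seq M) (isPointed.Build (seq M) [::]).
have [L [p [_ pE]]] := @ultrapower_field I U uU Om.
have [theta th] := choice (partial_place i (e \o j)).
have UB x y : U [set c | theta c (x - y) = theta c x - theta c y].
  apply: filterS (filterI (Umem x) (filterI (Umem y) (Umem (x - y)))).
  by move=> c [xc [yc xyc]]; have [_ tB _ _ _] := th c; exact: tB.
have U1 : U [set c | theta c 1 = 1].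
  by apply: filterS (Umem 1) => c; have [_ _ t1 _ _] := th c.
have UM x y : U [set c | theta c (x * y) = theta c x * theta c y].
  apply: filterS (filterI (Umem x) (filterI (Umem y) (Umem (x * y)))).
  by move=> c [xc [yc xyc]]; have [_ _ _ tM _] := th c; exact: tM.
have [be beE] := @ultra_rmorph M Om I U L p theta FU pE UB U1 UM.
have [al alE] : exists al : {rmorphism F -> L}, forall a, al a = p (fun=> e a).
  apply: (@ultra_rmorph F Om I U L p (fun _ => e) FU pE) => [x y||x y].
  - by apply: filterS filterT => c _ /=; rewrite rmorphB.
  - by apply: filterS filterT => c _ /=; rewrite rmorph1.
  - by apply: filterS filterT => c _ /=; rewrite rmorphM.
exists L, al, be; split=> [c|n a b ind].
  rewrite alE beE; apply/pE; apply: filterS (Umem (i c)) => d dc /=.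
  by have [_ _ _ _ tK] := th d; rewrite tK.
rewrite (eq_bigr (fun l => p (fun c => theta c (b l) * e (a l)))); last first.
  by move=> l _; rewrite beE alE -rmorphM.
rewrite -rmorph_sum -(rmorph0 p) => /pE Us l.
apply/eqP; rewrite -(fmorph_eq0 be) beE -(rmorph0 p); apply/eqP/pE.
(* Almost every index carries the relation with coefficients algebraic over [K], and there
   regularity forces all of them to be 0. *)
apply: filterS Us => c; rewrite fct_sumE => s0.
have [ta _ _ _ _] := th c.
exact: (reg n a ind (fun l => theta c (b l))).
Qed.

(** * Finitely generated ideals *)

Definition is_ideal (R : comNzRingType) (I : set R) : Prop :=
  [/\ I 0, forall a b, I a -> I b -> I (a + b) & forall a b, I b -> I (a * b)].

Section Span.
Variables (R : comNzRingType) (c : nat) (f : 'I_c -> R).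

Definition span : set R := [set p | exists h : 'I_c -> R, p = \sum_(k < c) h k * f k].

Lemma span_ideal : is_ideal span.
Proof.
split=> /=.
- by exists (fun=> 0); rewrite big1 // => k _; rewrite mul0r.
- move=> a b [g ->] [h ->]; exists (fun k => g k + h k).
  by rewrite -big_split; apply: eq_bigr => k _; rewrite mulrDl.
- move=> a b [h ->]; exists (fun k => a * h k).
  by rewrite mulr_sumr; apply: eq_bigr => k _; rewrite mulrA.
Qed.

Lemma span_gen k : span (f k).
Proof.
exists (fun k' => (k' == k)%:R); rewrite (bigD1 k) //= eqxx mul1r.
by rewrite big1 ?addr0 // => k' /negPf ->; rewrite mul0r.
Qed.

Lemma span_sub (I : set R) : is_ideal I -> (forall k, I (f k)) -> span `<=` I.
Proof.
move=> [I0 ID IM] If _ [h ->]; apply: (big_ind I) => // k _.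
exact: IM.
Qed.

End Span.

Lemma ideal_sum (R : comNzRingType) (I : set R) (T : Type) (r : seq T)
    (P : pred T) (F : T -> R) :
  is_ideal I -> (forall t, P t -> I (F t)) -> I (\sum_(t <- r | P t) F t).
Proof. by move=> [I0 ID IM] IF; exact: (big_ind I). Qed.

(** Finite generation is expressed by minimality among ideals, which spares linear combinations
    indexed by lists. *)
Definition noetherian (R : comNzRingType) : Prop :=
  forall I : set R, is_ideal I -> exists s : seq R,
    (forall x, x \in s -> I x) /\
    forall J, is_ideal J -> (forall x, x \in s -> J x) -> I `<=` J.

Lemma noetherian_field (K : fieldType) : noetherian K.
Proof.
move=> I [I0 ID IM]; have [[a [Ia a0]]|n] := pselect (exists a, I a /\ a != 0).
  exists [:: 1]; split=> [x|J [_ _ JM] J1 x _].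
    by rewrite inE => /eqP ->; rewrite -(mulVf a0); exact: IM.
  by rewrite -[x]mulr1; apply: JM; apply: J1; rewrite inE.
exists [::]; split=> // J [J0 _ _] _ x Ix; have [->//|x0] := eqVneq x 0.
by case: n; exists x.
Qed.

Lemma noetherian_surj (R A : comNzRingType) (f : {rmorphism R -> A}) :
  (forall a, exists r, f r = a) -> noetherian R -> noetherian A.
Proof.
move=> fs nR I [I0 ID IM].
have pre J : is_ideal J -> is_ideal (f @^-1` J).
  move=> [J0 JD JM]; split=> /=; first by rewrite rmorph0.
    by move=> a b Ja Jb; rewrite rmorphD; exact: JD.
  by move=> a b Jb; rewrite rmorphM; exact: JM.
have [s [sI sJ]] := nR _ (pre _ (And3 I0 ID IM)).
exists (map f s); split=> [_ /mapP[x /sI Ix ->] //|J iJ Js a Ia].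
have [r fr] := fs a; rewrite -fr; apply: (sJ _ (pre _ iJ)) => [x xs|].
  by apply: Js; apply/mapP; exists x.
by rewrite /= fr.
Qed.

Section Hilbert.
Variable R : comNzRingType.

Definition leads (I : set {poly R}) (d : nat) : set R :=
  [set a | exists p, [/\ I p, (size p <= d.+1)%N & p`_d = a]].

Lemma leads_ideal I d : is_ideal I -> is_ideal (leads I d).
Proof.
move=> [I0 ID IM]; split.
- by exists 0; rewrite size_poly0 coef0.
- move=> a b [p [Ip sp <-]] [q [Iq sq <-]]; exists (p + q); split.
  + exact: ID.
  + by rewrite (leq_trans (size_polyD _ _)) // geq_max sp.
  + by rewrite coefD.
- move=> a b [p [Ip sp <-]]; exists (a%:P * p); split; first exact: IM.
    by rewrite mul_polyC (leq_trans (size_scale_leq _ _)).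
  by rewrite coefCM.
Qed.

Lemma leads_shift I d e : is_ideal I -> (d <= e)%N -> leads I d `<=` leads I e.
Proof.
move=> [_ _ IM] de a [p [Ip sp <-]]; exists ('X^(e - d) * p); split.
- exact: IM.
- rewrite mulrC (leq_trans (size_polyMleq _ _)) // size_polyXn addnS /=.
  by rewrite -(subnKC de) -addSn leq_add // addKn.
- by rewrite coefXnM ltnNge leq_subr subKn.
Qed.

(** An element of [I] can be lowered in degree by subtracting an element of [J] with the same
    leading coefficient. *)
Lemma ideal_leads_sub (I J : set {poly R}) :
  is_ideal I -> is_ideal J -> J `<=` I ->
  (forall d, leads I d `<=` leads J d) -> I `<=` J.
Proof.
move=> [I0 ID IM] [J0 JD JM] JI IJ p.
have [m] := ubnP (size p); elim: m => // m IH in p * => pm Ip.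
case sE : (size p) => [|d].
  by move/eqP: sE; rewrite size_poly_eq0 => /eqP ->.
have [q [Jq sq qd]] : leads J d p`_d by apply: IJ; exists p; rewrite sE.
rewrite -[p](subrK q); apply: (JD) => //; apply: IH; last first.
  apply: ID => //; rewrite -mulN1r; apply: IM; exact: JI.
rewrite (@leq_ltn_trans d) //; last by rewrite sE in pm.
apply/leq_sizeP => k; rewrite leq_eqVlt => /orP[/eqP <-|dk].
  by rewrite coefB qd subrr.
by rewrite coefB !nth_default ?subrr // ?sE // (leq_trans sq).
Qed.

(** * Hilbert's basis theorem *)

Lemma noetherian_poly : noetherian R -> noetherian {poly R}.
Proof.
move=> nR I iI.
have leadsU : is_ideal (\bigcup_d leads I d).
  split; first by exists 0%N => //; case: (leads_ideal 0 iI).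
    move=> a b [d _ da] [e _ eb]; exists (maxn d e) => //.
    have [_ LD _] := leads_ideal (maxn d e) iI; apply: LD.
      apply: (leads_shift iI _ da); exact: leq_maxl.
    apply: (leads_shift iI _ eb); exact: leq_maxr.
  move=> a b [d _ db]; exists d => //.
  by have [_ _ LM] := leads_ideal d iI; exact: LM.
have [s [sL sgen]] := nR _ leadsU.
(* The leading ideals increase with the degree, so finitely many generators of their union all occur
   in one degree [N]; only degrees up to [N] need generators of their own. *)
have [N sN] : exists N, forall x, x \in s -> leads I N x.
  elim: s sL {sgen} => [|y s IH] sL; first by exists 0%N.
  have [x xs|N NP] := IH; first by apply: sL; rewrite inE xs orbT.
  have [d _ dy] := sL y (mem_head _ _); exists (maxn d N) => x.
  rewrite inE => /orP[/eqP ->|/NP Nx].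
    by apply: (leads_shift iI _ dy); exact: leq_maxl.
  by apply: (leads_shift iI _ Nx); exact: leq_maxr.
have gens_ex d : exists t : seq R, (forall x, x \in t -> leads I d x) /\
    forall J, is_ideal J -> (forall x, x \in t -> J x) -> leads I d `<=` J.
  exact/nR/leads_ideal.
have [t tP] := choice gens_ex.
have lift_ex (da : nat * R) : exists p : {poly R}, leads I da.1 da.2 ->
    [/\ I p, (size p <= da.1.+1)%N & p`_da.1 = da.2].
  by have [[p pP]|n] := pselect (leads I da.1 da.2); [exists p|exists 0].
have [lf lfP] := choice lift_ex.
exists [seq lf (d, a) | d <- iota 0 N.+1, a <- t d]; split.
  move=> _ /allpairsPdep[d [a [_ at_ ->]]].
  by have [] := lfP (d, a) ((tP d).1 a at_).
(* The comparison of leading ideals requires a subideal of [I]. *)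
move=> J iJ Js; pose J' := I `&` J.
have iJ' : is_ideal J'.
  case: iI iJ => I0 ID IM [J0 JD JM]; split=> //.
    by move=> a b [Ia Ja] [Ib Jb]; split; [exact: ID|exact: JD].
  by move=> a b [Ib Jb]; split; [exact: IM|exact: JM].
apply: (@subset_trans _ J'); last by move=> x [].
have lowd d : (d <= N)%N -> leads I d `<=` leads J' d.
  move=> dN; apply: (tP d).2; first exact: leads_ideal.
  move=> a at_; have [Ip sp pd] := lfP (d, a) ((tP d).1 a at_).
  exists (lf (d, a)); split=> //; split=> //; apply: Js.
  by apply/allpairsPdep; exists d, a; split=> //; rewrite mem_iota.
apply: ideal_leads_sub => // [x []//|d].
have [dN|Nd] := leqP d N; first exact: lowd.
apply: (@subset_trans _ (\bigcup_d leads I d)); first by move=> a ?; exists d.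
apply: sgen; first exact: leads_ideal.
by move=> x /sN /(lowd _ (leqnn N)); apply: leads_shift => //; exact: ltnW.
Qed.

End Hilbert.

Lemma noetherian_mpoly (K : fieldType) (n : nat) : noetherian {mpoly K[n]}.
Proof.
elim: n => [|n IH].
  apply: (@noetherian_surj K _ (@mpolyC 0 K)) (@noetherian_field K) => p.
  exists (p@_0%MM); exact: (esym (mpoly0E p)).
apply: (@noetherian_surj _ _ (@mlast n K)) (noetherian_poly IH) => p.
by have [q ->] := mlast_surj p; exists q.
Qed.

Lemma kernel_fg (R A : comNzRingType) (f : {rmorphism R -> A}) :
  noetherian R -> exists (c : nat) (g : 'I_c -> R), forall p,
    f p = 0 <-> span g p.
Proof.
move=> nR; have iK : is_ideal [set p | f p = 0].
  split=> /=; first exact: rmorph0.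
    by move=> a b fa fb; rewrite rmorphD fa fb addr0.
  by move=> a b fb; rewrite rmorphM fb mulr0.
have [s [s0 sgen]] := nR _ iK.
exists (size s), (fun i => s`_i) => p; split; last first.
  by move: p; apply: span_sub => // i; apply: s0; rewrite mem_nth.
apply: sgen => [|x xs]; first exact: span_ideal.
have xi : (index x s < size s)%N by rewrite index_mem.
by have := span_gen (fun i : 'I_(size s) => s`_i) (Ordinal xi); rewrite /= nth_index.
Qed.

Lemma mmap_map_mpoly (n : nat) (R A B : comNzRingType) (i : {rmorphism R -> A})
    (b : {rmorphism A -> B}) (y : 'I_n -> B) (p : {mpoly R[n]}) :
  mmap b y (map_mpoly i p) = mmap (b \o i) y p.
Proof.
rewrite /map_mpoly.
apply: (@rmorph_mmap n R {mpoly A[n]} B (mmap b y) (@mpolyC n A \o i)) => [c|k].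
  by rewrite /= mmapC.
by rewrite /= mmapX mmap1U.
Qed.

Lemma mderiv_map_mpoly (n : nat) (R A : comNzRingType) (i : {rmorphism R -> A})
    (k : 'I_n) (p : {mpoly R[n]}) :
  mderiv k (map_mpoly i p) = map_mpoly i (mderiv k p).
Proof.
elim/mpolyind: p => [|c m p _ _ IH]; first by rewrite !(rmorph0, raddf0).
rewrite (mderivD k (c *: 'X_[m])) !rmorphD /= mderivD IH; congr (_ + _).
by rewrite map_mpolyZ map_mpolyX !mderivZ !mderivX !map_mpolyZ map_mpolyX rmorph_nat.
Qed.

Section BaseChange.
Variables (K F M L : fieldType).
Variables (j : {rmorphism K -> F}) (i : {rmorphism K -> M}).
Variables (al : {rmorphism F -> L}) (be : {rmorphism M -> L}).
Hypothesis al_be : forall c, al (j c) = be (i c).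
Hypothesis disj : forall n (a : 'I_n -> F) (b : 'I_n -> M), lin_indep j a ->
  \sum_(l < n) be (b l) * al (a l) = 0 -> forall l, b l = 0.
Variables (n : nat) (x : 'I_n -> F).

Lemma mmap_base_change (p : {mpoly K[n]}) :
  mmap be (al \o x) (map_mpoly i p) = al (mmap j x p).
Proof.
rewrite mmap_map_mpoly; symmetry; apply: rmorph_mmap => //= c.
Qed.

Variables (c : nat) (f : 'I_c -> {mpoly K[n]}).
Hypothesis ker : forall p, mmap j x p = 0 <-> span f p.

(** Induction on the length of P as an M-combination of polynomials over [K]. If their values at [x]
    are independent over [K], disjointness kills the coefficients; otherwise a dependence over [K]
    removes one term. *)
Lemma kernel_base_change (P : {mpoly M[n]}) :
  mmap be (al \o x) P = 0 <-> span (fun k => map_mpoly i (f k)) P.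
Proof.
have [I0 ID IM] := span_ideal (fun k => map_mpoly i (f k)).
split=> [P0|]; last first.
  move: P; apply: span_sub => [|k] /=.
    split=> /=; first exact: rmorph0.
      by move=> a b a0 b0; rewrite rmorphD /= a0 b0 addr0.
    by move=> a b b0; rewrite rmorphM /= b0 mulr0.
  by rewrite mmap_base_change (ker (f k)).2 ?rmorph0 //; exact: span_gen.
suff main N (m : 'I_N -> M) (U : 'I_N -> {mpoly K[n]}) :
    mmap be (al \o x) (\sum_(k < N) m k *: map_mpoly i (U k)) = 0 ->
    span (fun k => map_mpoly i (f k)) (\sum_(k < N) m k *: map_mpoly i (U k)).
  have PE : P = \sum_(k < size (msupp P))
      P@_(nth 0%MM (msupp P) k) *: map_mpoly i 'X_[nth 0%MM (msupp P) k].
    rewrite {1}[P]mpolyE (big_nth 0%MM) big_mkord; apply: eq_bigr => k _.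
    by rewrite map_mpolyX.
  by rewrite PE; apply: main; rewrite -PE.
elim: N m U => [|N IH] m U S0; first by rewrite big_ord0; exact: I0.
have [ind|] := pselect (lin_indep j (fun k => mmap j x (U k))).
  rewrite big1 => [|k _]; first exact: I0.
  rewrite (disj ind (b := m)) ?scale0r // -[RHS]S0 rmorph_sum.
  by apply: eq_bigr => l _; rewrite /= mmapZ mmap_base_change.
move=> /existsNP[d /not_implyP[d0 /existsNP[k0 /eqP dk0]]].
(* Coefficient 1 at [k0]: the term U k0 is traded for [D], a relation over [K], and the other
   terms. *)
pose D := \sum_(k < N.+1) (d k / d k0) *: U k.
have D0 : mmap j x D = 0.
  rewrite rmorph_sum -[RHS](mulr0 (j (d k0)^-1)) -[X in _ = _ * X]d0 mulr_sumr.
  apply: eq_bigr => k _; rewrite /= mmapZ rmorphM mulrA; congr (_ * _).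
  by rewrite mulrC fmorphV.
pose m' k := m (lift k0 k) - m k0 * i (d (lift k0 k) / d k0).
have SE : \sum_(k < N.+1) m k *: map_mpoly i (U k) =
    m k0 *: map_mpoly i D + \sum_(k < N) m' k *: map_mpoly i (U (lift k0 k)).
  rewrite (bigD1_ord k0) //= /D (bigD1_ord k0) //= divff // scale1r.
  rewrite rmorphD /= scalerDr -addrA; congr (_ + _).
  rewrite rmorph_sum /= scaler_sumr -big_split; apply: eq_bigr => k _ /=.
  by rewrite map_mpolyZ scalerA -scalerDl /m' addrC subrK.
have DI : span (fun k => map_mpoly i (f k)) (m k0 *: map_mpoly i D).
  rewrite -mul_mpolyC; apply: IM; have [g ->] := (ker D).1 D0.
  exists (fun k => map_mpoly i (g k)); rewrite rmorph_sum.
  by apply: eq_bigr => k _; rewrite rmorphM.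
rewrite SE; apply: ID => //; apply: IH.
move: S0; rewrite SE rmorphD /= mmapZ mmap_base_change D0 rmorph0 mulr0 add0r.
exact.
Qed.

End BaseChange.

(** * Generic smoothness *)

Lemma mderiv_var (n : nat) (R : comNzRingType) (t t' : 'I_n) :
  mderiv t ('X_t' : {mpoly R[n]}) = (t == t')%:R.
Proof.
rewrite mderivX mnm1E eq_sym; have [->|_] := eqVneq t t'; last by rewrite scale0r.
rewrite scale1r -mpolyX0; congr 'X_[_]; apply/mnmP => k.
by rewrite mnmBE subnn mnm0E.
Qed.

(** Both sides satisfy the Leibniz rule in [p] and agree on constants and variables. An arbitrary
    derivation is allowed, so that partial derivatives and the derivative of F[Y] are both
    covered. *)
Lemma chain_rule (n : nat) (R B : comNzRingType) (b : {rmorphism R -> B})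
    (u : 'I_n -> B) (D : {additive B -> B}) (p : {mpoly R[n]}) :
  (forall v w, D (v * w) = D v * w + v * D w) -> (forall c, D (b c) = 0) ->
  D (mmap b u p) = \sum_t mmap b u (mderiv t p) * D (u t).
Proof.
move=> DM DC.
pose Q p := D (mmap b u p) = \sum_t mmap b u (mderiv t p) * D (u t).
have QD p1 p2 : Q p1 -> Q p2 -> Q (p1 + p2).
  rewrite /Q => Q1 Q2; rewrite !raddfD /= Q1 Q2 -big_split.
  by apply: eq_bigr => t _; rewrite mderivD rmorphD mulrDl.
have QM p1 p2 : Q p1 -> Q p2 -> Q (p1 * p2).
  rewrite /Q => Q1 Q2; rewrite rmorphM /= DM Q1 Q2 mulr_suml mulr_sumr -big_split.
  apply: eq_bigr => t _; rewrite mderivM rmorphD !rmorphM mulrDl /=.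
  by rewrite mulrAC mulrA.
have QC c : Q c%:MP.
  rewrite /Q mmapC DC big1 // => t _; by rewrite mderivC rmorph0 mul0r.
have QX t : Q 'X_t.
  rewrite /Q mmapX mmap1U (bigD1 t) //= mderiv_var eqxx rmorph1 mul1r.
  rewrite big1 ?addr0 // => t' /negPf tt'.
  by rewrite mderiv_var tt' rmorph0 mul0r.
rewrite -/(Q p); elim/mpolyind: p => [|c m p _ _ IH].
  by rewrite -mpolyC0; exact: QC.
apply: QD => //; rewrite -mul_mpolyC; apply: (QM); first exact: QC.
rewrite mpolyXE_id; apply: (big_ind Q); [exact: (QC 1)|exact: QM|].
move=> t _; elim: (m t) => [|k IHk]; first exact: (QC 1).
by rewrite exprS; exact: QM.
Qed.

Section LastDerivative.
Variables (n : nat) (K : comNzRingType).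

Lemma mderiv_mwiden_widen (k : 'I_n) (p : {mpoly K[n]}) :
  mderiv (widen_ord (leqnSn n) k) (mwiden p) = mwiden (mderiv k p).
Proof.
have := @chain_rule n K {mpoly K[n.+1]} (@mpolyC n.+1 K)
  (fun i => 'X_(widen_ord (leqnSn n) i)) (mderiv (widen_ord (leqnSn n) k)) p
  (@mderivM _ _ _) (@mderivC _ _ _).
rewrite -/(mwiden p) => ->; rewrite (bigD1 k) //= big1 ?addr0 => [|t tk].
  by rewrite /= mderiv_var eqxx mulr1.
by rewrite /= mderiv_var -val_eqE /= val_eqE eq_sym (negPf tk) mulr0.
Qed.

Lemma mderiv_mwiden_max (p : {mpoly K[n]}) : mderiv ord_max (mwiden p) = 0.
Proof.
have := @chain_rule n K {mpoly K[n.+1]} (@mpolyC n.+1 K)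
  (fun i => 'X_(widen_ord (leqnSn n) i)) (mderiv ord_max) p
  (@mderivM _ _ _) (@mderivC _ _ _).
rewrite -/(mwiden p) => ->; rewrite big1 // => t _.
by rewrite /= mderiv_var -val_eqE /= (gtn_eqF (ltn_ord t)) mulr0.
Qed.

Lemma mlastE (p : {poly {mpoly K[n]}}) :
  mlast p = \sum_(e < size p) mwiden p`_e * 'X_ord_max ^+ e.
Proof.
rewrite /mlast (@horner_coef_wide _ (size p)) ?size_poly //.
by apply: eq_bigr => e _; rewrite coef_map.
Qed.

Lemma mderiv_mlast_max (p : {poly {mpoly K[n]}}) :
  mderiv ord_max (mlast p) = mlast p^`().
Proof.
elim/poly_ind: p => [|p c IH]; first by rewrite !raddf0.
rewrite rmorphD rmorphM /= mlastC mlastX mderivD mderivM IH mderiv_mwiden_max.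
rewrite addr0 derivD derivM derivX derivC addr0 mulr1 rmorphD rmorphM /= mlastX.
by rewrite mderiv_var eqxx mulr1.
Qed.

End LastDerivative.

Lemma lift_max n (k : 'I_n) : lift ord_max k = widen_ord (leqnSn n) k.
Proof. by apply: val_inj; rewrite /= /bump leqNgt ltn_ord. Qed.

Definition jac (K : comNzRingType) (n c : nat) (f : 'I_c -> {mpoly K[n]})
  (s : 'I_c -> 'I_n) : 'M[{mpoly K[n]}]_c := \matrix_(i, j) mderiv (s j) (f i).

Section AddEquation.
Variables (K F : fieldType) (j : {rmorphism K -> F}) (n c : nat).
Variables (x : 'I_n -> F) (y : F) (f : 'I_c -> {mpoly K[n]}) (s : 'I_c -> 'I_n).
Variable h : {poly {mpoly K[n]}}.

Definition add_eq : 'I_c.+1 -> {mpoly K[n.+1]} :=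
  extend (fun k => mwiden (f k)) (mlast h).
Definition add_var : 'I_c.+1 -> 'I_n.+1 :=
  extend (fun k => widen_ord (leqnSn n) (s k)) ord_max.

(** The old equations do not contain the new variable, so the last column vanishes except in the
    corner. *)
Lemma jac_add_eq : \det (jac add_eq add_var) =
  mwiden (\det (jac f s)) * mlast h^`().
Proof.
rewrite (expand_det_col _ ord_max) (bigD1 ord_max) //= big1 ?addr0 => [|k km].
  rewrite mxE /add_eq /add_var !extend_max mderiv_mlast_max mulrC.
  congr (_ * _); rewrite /cofactor addnn -signr_odd odd_double mul1r.
  rewrite -det_map_mx; congr (\det _); apply/matrixP => a b; rewrite !mxE.
  by rewrite !lift_max !extend_widen mderiv_mwiden_widen.
case: (unliftP ord_max k) km => [a -> _|->]; last by rewrite eqxx.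
by rewrite mxE /add_eq /add_var extend_max lift_max extend_widen
  mderiv_mwiden_max mul0r.
Qed.

Lemma mmap_jac_add_eq : mmap j (extend x y) (\det (jac add_eq add_var)) =
  mmap j x (\det (jac f s)) * ev j x y h^`().
Proof. by rewrite jac_add_eq rmorphM /= mmap_mwiden mmap_mlast. Qed.

Lemma span_add_widen p : span f p -> span add_eq (mwiden p).
Proof.
move=> [g ->]; rewrite rmorph_sum; apply: ideal_sum; first exact: span_ideal.
move=> k _; rewrite rmorphM; have [_ _ IM] := span_ideal add_eq; apply: IM.
have := span_gen add_eq (widen_ord (leqnSn c) k).
by rewrite /add_eq extend_widen.
Qed.

Lemma span_add_last q : span add_eq (q * mlast h).
Proof.
have [_ _ IM] := span_ideal add_eq; apply: IM.
by have := span_gen add_eq ord_max; rewrite {2}/add_eq extend_max.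
Qed.

Lemma span_add_coef (r : {poly {mpoly K[n]}}) g :
  (forall e, span f (g * r`_e)) -> span add_eq (mwiden g * mlast r).
Proof.
move=> gr; rewrite mlastE mulr_sumr.
apply: ideal_sum; first exact: span_ideal.
move=> e _; rewrite mulrA mulrC; have [_ _ IM] := span_ideal add_eq; apply: IM.
rewrite -mwidenM; exact: span_add_widen.
Qed.

End AddEquation.

Lemma msize_mderiv (n : nat) (R : nzRingType) (i : 'I_n) (p : {mpoly R[n]}) :
  p != 0 -> (msize (mderiv i p) < msize p)%N.
Proof.
move=> p0; have p1 : (0 < msize p)%N by rewrite lt0n msize_poly_eq0.
rewrite [msize (mderiv _ _)]msizeE big_seq.
apply: (big_ind (fun k => (k < msize p)%N)) => // [k l kp lp|m].
  by rewrite gtn_max kp.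
rewrite mcoeff_msupp mcoeff_deriv => mp.
have : (m + U_(i))%MM \in msupp p.
  by rewrite mcoeff_msupp; apply: contraNneq mp => ->; rewrite mul0rn.
by move/msize_mdeg_lt; rewrite mdegD mdeg1 addn1.
Qed.

(* If all partial derivatives vanish then [p] is a polynomial in the [X_i^l],
   [l] the characteristic; linear disjointness from the field of [l]-th roots
   of the coefficients then yields a relation of smaller degree. *)
Lemma separable_relation (K F : fieldType) (j : {rmorphism K -> F}) (n : nat)
    (x : 'I_n -> F) (p0 : {mpoly K[n]}) :
  regular_extension j -> p0 != 0 -> mmap j x p0 = 0 ->
  exists p i, mmap j x p = 0 /\ mmap j x (mderiv i p) != 0.
Proof.
move=> [Om [e reg]] p0n p0x.
pose Pn m := `[< exists p : {mpoly K[n]}, [/\ p != 0, mmap j x p = 0 & msize p = m] >].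
have exP : exists m, Pn m by exists (msize p0); apply/asboolP; exists p0.
have [d /asboolP[p [pn px sp]] dmin] := ex_minnP exP.
have small (q : {mpoly K[n]}) : (msize q < d)%N -> mmap j x q = 0 -> q = 0.
  move=> qd qx; apply: contrapT => /eqP qn.
  have := dmin (msize q); rewrite leqNgt qd => h.
  by have : false by apply: h; apply/asboolP; exists q.
(* [p] has least total degree among the nonzero relations, so a nonzero derivative, being of smaller
   degree, cannot vanish at [x]. *)
have [[i di]|nd] := pselect (exists i, mderiv i p != 0).
  exists p, i; split=> //; apply: contraNneq di => dx; apply/eqP.
  by apply: small => //; rewrite -sp; exact: msize_mderiv.
have {}nd i : mderiv i p = 0 by apply: contrapT => /eqP di; apply: nd; exists i.
have coef0 m i : m \in msupp p -> (m i)%:R = 0 :> K.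
  rewrite mcoeff_msupp => mp; have [->//|mi] := eqVneq (m i) 0%N.
  have mE : (m - U_(i) + U_(i))%MM = m.
    apply/submK/mnm_lepP => k; rewrite mnm1E; case: eqP => // <-.
    by rewrite lt0n.
  have := congr1 (mcoeff (m - U_(i))) (nd i).
  rewrite mcoeff_deriv mE mcoeff0 mnmBE mnm1E eqxx subn1 prednK ?lt0n //.
  by move=> /eqP; rewrite -(mulr_natr p@_m) mulf_eq0 (negPf mp) => /eqP.
have d1 : (1 < d)%N.
  rewrite ltnNge -sp; apply/negP => /msize1_polyC pC; move: px pn.
  by rewrite pC mmapC => /eqP; rewrite fmorph_eq0 => /eqP ->; rewrite eqxx.
have [m0 m0p /existsP[i0 m0i]] : exists2 m, m \in msupp p & [exists i, m i != 0%N].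
  apply: contrapT => nm; move: d1; rewrite -sp ltnNge msizeE.
  apply/negP/negPn; rewrite big_seq.
  apply: (big_ind (fun k => (k <= 1)%N)) => [//|k l k1 l1|m1 m1p].
    by rewrite geq_max k1.
  rewrite ltnS leqn0 mdeg_eq0; apply/eqP/mnmP => i1; rewrite mnm0E.
  apply: contrapT => /eqP mi; apply: nm; exists m1 => //; apply/existsP.
  by exists i1.
(* A positive exponent that is 0 in [K] forces positive characteristic. *)
have [l lK] : exists l, l \in [pchar K].
  by apply: (@natf0_pchar K (m0 i0)); rewrite ?lt0n ?coef0.
have l_prime := pcharf_prime lK.
have ldvd m i : m \in msupp p -> (l %| m i)%N.
  by move=> mp; rewrite (dvdn_pcharf lK) coef0.
pose r (m : 'X_{1..n}) : 'X_{1..n} := [multinom (m i %/ l)%N | i < n].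
have rK m i : m \in msupp p -> m i = (r m i * l)%N.
  by move=> mp; rewrite mnmE divnK // ldvd.
pose N := size (msupp p).
pose mk (k : 'I_N) := nth 0%MM (msupp p) k.
have mkp k : mk k \in msupp p by apply: mem_nth.
pose a (k : 'I_N) := mmap1 x (r (mk k)).
have root_ex (k : 'I_N) : exists g, g ^+ l = e (j p@_(mk k)).
  have /closed_rootP[g] : size ('X^l - (e (j p@_(mk k)))%:P) != 1%N.
    by rewrite size_XnsubC ?prime_gt0 //; case: (l) l_prime => [|[]].
  by rewrite rootE !hornerE subr_eq0 => /eqP; exists g.
have [root_ rkE] := choice root_ex.
have lOm : l \in [pchar Om] by rewrite (fmorph_pchar e) (fmorph_pchar j).
(* Its l-th power is the image of p(x), by additivity of the Frobenius map. *)
have sum0 : \sum_(k < N) root_ k * e (a k) = 0.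
  have l0 : (0 < l)%N by exact: prime_gt0.
  apply/eqP; have := expf_eq0 (\sum_(k < N) root_ k * e (a k)) l.
  rewrite l0 /= => <-; rewrite -(pFrobenius_autE lOm) rmorph_sum.
  apply/eqP; transitivity (e (mmap j x p)); last by rewrite px rmorph0.
  rewrite /mmap (big_nth 0%MM) big_mkord rmorph_sum.
  apply: eq_bigr => k _; rewrite /= pFrobenius_autE exprMn rkE rmorphM.
  congr (_ * _); rewrite -rmorphXn /a /mmap1 -prodrXl; congr (e _).
  by apply: eq_bigr => i _; rewrite -exprM -rK.
have [ind|] := pselect (lin_indep j a).
  have rt0 k : root_ k = 0.
    apply: (reg N a ind) sum0 k => k; exists ('X^l - (p@_(mk k))%:P).
      by rewrite -size_poly_eq0 size_XnsubC ?prime_gt0.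
    rewrite rmorphB /= map_polyXn map_polyC /= rootE !hornerE rkE.
    by rewrite subrr.
  have : p@_m0 = 0.
    have kN : (index m0 (msupp p) < N)%N by rewrite index_mem.
    have := rkE (Ordinal kN); rewrite rt0 expr0n eqn0Ngt prime_gt0 //= /mk /=.
    by rewrite nth_index // => /esym/eqP; rewrite !fmorph_eq0 => /eqP.
  by move: m0p; rewrite mcoeff_msupp => /eqP.
move=> /existsNP[c /not_implyP[c0 /existsNP[k0 ck0]]].
(* A dependence among the monomials with exponents divided by [l] is a relation of smaller degree.
   Its coefficients cannot merge, since dividing exponents by [l] is injective on the support. *)
pose q : {mpoly K[n]} := \sum_(k < N) c k *: 'X_[r (mk k)].
have q0 : q = 0.
  apply: small; last first.
    by rewrite rmorph_sum -[RHS]c0; apply: eq_bigr => k _; rewrite /= mmapZ mmapX.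
  rewrite /q; apply: (big_ind (fun u : {mpoly K[n]} => (msize u < d)%N)).
  - by rewrite msize0 (ltn_trans _ d1).
  - move=> u v ud vd; rewrite (leq_ltn_trans (msizeD_le _ _)) //.
    by rewrite gtn_max ud.
  - move=> k _; rewrite (leq_ltn_trans (msizeZ_le _ _)) // msizeX.
    have [->|mz] := eqVneq (mdeg (r (mk k))) 0%N; first exact: d1.
    rewrite -sp; apply: leq_trans (msize_mdeg_lt (mkp k)); rewrite ltnS.
    have -> : mdeg (mk k) = (mdeg (r (mk k)) * l)%N.
      by rewrite !mdegE big_distrl; apply: eq_bigr => i _; exact: rK.
    by rewrite -[X in (X < _)%N]muln1 ltn_pmul2l ?lt0n // prime_gt1.
case: ck0; have := congr1 (mcoeff (r (mk k0))) q0.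
rewrite raddf_sum mcoeff0 (bigD1 k0) //= mcoeffZ mcoeffX eqxx mulr1.
rewrite big1 ?addr0 // => k kk0; rewrite mcoeffZ mcoeffX.
have [rr|_] := eqVneq (r (mk k)) (r (mk k0)); last by rewrite mulr0.
move/eqP: kk0; case; apply/val_inj/eqP.
rewrite -(nth_uniq 0%MM (ltn_ord k) (ltn_ord k0) (msupp_uniq p)).
by apply/eqP/mnmP => i; rewrite -/(mk k) -/(mk k0) rK // rr -rK.
Qed.

(** Where [g] does not vanish, the equations [f] generate all relations; where the minor does not
    vanish, they are smooth. Both open sets contain the generic point [x]. *)
Definition generically_smooth (K F : fieldType) (j : {rmorphism K -> F}) (n : nat)
    (x : 'I_n -> F) : Prop :=
  exists (c : nat) (f : 'I_c -> {mpoly K[n]}) (s : 'I_c -> 'I_n) g,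
  [/\ forall k, mmap j x (f k) = 0, mmap j x (\det (jac f s)) != 0,
      mmap j x g != 0 & forall p, mmap j x p = 0 -> span f (g * p)].

Lemma seq_bound (T : eqType) (s : seq T) (P : T -> nat -> Prop) :
  (forall t k l, (k <= l)%N -> P t k -> P t l) ->
  (forall t, t \in s -> exists k, P t k) ->
  exists k, forall t, t \in s -> P t k.
Proof.
move=> mono; elim: s => [|t s IH] Ps; first by exists 0%N.
have [u us|k kP] := IH; first by apply: Ps; rewrite inE us orbT.
have [l lP] := Ps t (mem_head _ _); exists (maxn k l) => u.
rewrite inE => /orP[/eqP ->|/kP].
  by apply: mono lP; exact: leq_maxr.
by apply: mono; exact: leq_maxl.
Qed.

(** Here [y] is a simple root of [q] over K(x), so its minimal relation is separable and can be
    added as a last equation. *)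
Lemma generically_smooth_step (K F : fieldType) (j : {rmorphism K -> F}) (n : nat)
    (x : 'I_n -> F) (y : F) (q : {poly {mpoly K[n]}}) :
  generically_smooth j x -> ev j x y q = 0 ->
  (map_poly (mmap j x) q)^`().[y] != 0 ->
  generically_smooth j (extend x y).
Proof.
move=> [c [f [s [g [f0 J0 g0 gker]]]]] q0 dq.
have rq0 : map_poly (mmap j x) q != 0.
  by apply: contraNneq dq => ->; rewrite deriv0 horner0.
have [tr|[h mh]] := min_rel_ex j x y; first by rewrite tr // eqxx in rq0.
(* A multiple of [q] by a nonzero scalar is a multiple of [h] after evaluation at [x];
   differentiating at [y] shows that h'(y) divides a nonzero element. *)
have evd : ev j x y h^`() != 0.
  have [k [d [r [e r0]]]] := min_rel_div mh q0.
  have := congr1 (fun u => (map_poly (mmap j x) u)^`().[y]) e.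
  rewrite map_polyZ /= derivZ hornerZ rmorphD rmorphM /= r0 addr0 derivM.
  rewrite hornerD !hornerM; have -> : (map_poly (mmap j x) h).[y] = 0 by case: mh.
  rewrite mulr0 add0r rmorphXn => ed; rewrite /ev -deriv_map.
  have : mmap j x (lead_coef h) ^+ k * (map_poly (mmap j x) q)^`().[y] != 0.
    by rewrite mulf_neq0 // expf_neq0 // (min_rel_lead mh).
  by rewrite ed mulf_eq0 negb_or => /andP[].
pose G k := mwiden (g * lead_coef h ^+ k).
have GS k l p : (k <= l)%N -> span (add_eq f h) (G k * p) -> span (add_eq f h) (G l * p).
  move=> kl; have [_ _ IM] := span_ideal (add_eq f h).
  move=> /(IM (mwiden (lead_coef h ^+ (l - k)))); rewrite mulrA -mwidenM.
  by rewrite mulrCA -exprD subnK.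
have Gp p : mmap j (extend x y) p = 0 -> exists k, span (add_eq f h) (G k * p).
  have [{}p ->] := mlast_surj p; rewrite mmap_mlast => /(min_rel_div mh).
  move=> [k [d [r [e r0]]]]; exists k.
  rewrite /G mwidenM -mulrA -[mwiden (_ ^+ _)]mlastC -rmorphM /= mul_polyC e.
  have [_ ID IM] := span_ideal (add_eq f h).
  rewrite rmorphD mulrDr rmorphM /=; apply: ID.
    by rewrite mulrA; exact: span_add_last.
  apply: span_add_coef => e'; apply: gker.
  have := congr1 (fun u : {poly F} => u`_e') r0.
  by rewrite coef0 coef_map.
(* The power of the leading coefficient used in pseudo-division depends on the relation; finitely
   many generators of the ideal of relations give a common bound. *)
have [t [t0 tgen]] := @noetherian_mpoly K n.+1
  [set p | mmap j (extend x y) p = 0] (And3 (rmorph0 _)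
    (fun a b a0 b0 => etrans (rmorphD _ a b) (etrans (congr2 +%R a0 b0) (addr0 0)))
    (fun a b b0 => etrans (rmorphM _ a b) (etrans (congr1 (fun u => _ * u) b0) (mulr0 _)))).
have [k kP] := seq_bound (fun p k l => @GS k l p) (fun p pt => Gp p (t0 p pt)).
exists c.+1, (add_eq f h), (add_var s), (G k); split.
- apply: ordS_ind => [k'|]; rewrite /add_eq ?extend_widen ?extend_max.
    by rewrite mmap_mwiden.
  by rewrite mmap_mlast; case: mh.
- by rewrite mmap_jac_add_eq mulf_neq0.
- by rewrite mmap_mwiden rmorphM rmorphXn mulf_neq0 // expf_neq0 // (min_rel_lead mh).
- have [I0 ID IM] := span_ideal (add_eq f h).
  move=> p p0; apply: (tgen [set p | span (add_eq f h) (G k * p)]) => //.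
  split=> /=; first by rewrite mulr0.
    by move=> a b ha hb; rewrite mulrDr; exact: ID.
  by move=> a b hb; rewrite mulrCA; exact: IM.
Qed.

(* MacLane's separating transcendence basis: a separable relation makes one of
   the generators separably algebraic over the others. *)
Lemma regular_generically_smooth (K F : fieldType) (j : {rmorphism K -> F})
    (n : nat) (x : 'I_n -> F) : regular_extension j ->
  exists x' : 'I_n -> F, (forall t, exists t', x t = x' t') /\
    generically_smooth j x'.
Proof.
move=> reg; have triv m (u : 'I_m -> F) : (forall p, mmap j u p = 0 -> p = 0) ->
    generically_smooth j u.
  move=> ker0; have e0 (T : Type) : 'I_0 -> T by case.
  exists 0%N, (e0 _), (e0 _), 1.
  split; [by case|by rewrite det_mx00 rmorph1 oner_neq0|by rewrite rmorph1 oner_neq0|].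
  by move=> p /ker0 ->; rewrite mulr0; case: (span_ideal (e0 {mpoly K[m]})).
elim: n x => [|n IH] x.
  exists x; split=> [t|]; first by exists t.
  apply: triv => p; have := mpoly0E p; move: (p@__) => a ->.
  by rewrite mmapC => /eqP; rewrite fmorph_eq0 => /eqP ->.
have [ker0|/existsNP[p0 /not_implyP[p0x /eqP p0n]]] :=
  pselect (forall p, mmap j x p = 0 -> p = 0).
  by exists x; split=> [t|]; [exists t|exact: triv].
have [p [i [px dpx]]] := separable_relation reg p0n p0x.
(* The generator x i, a simple root of a relation over the others, is removed and put back last. *)
have [x' [x'r gs]] := IH (fun k => x (lift i k)).
have [tau tauE] := choice x'r.
exists (extend x' (x i)); split.
  move=> t; case: (unliftP i t) => [k ->|->].
    by exists (widen_ord (leqnSn n) (tau k)); rewrite extend_widen -tauE.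
  by exists ord_max; rewrite extend_max.
(* Rewrites [p] as a polynomial in the removed generator; [tau] tells where the other generators
   occur in [x']. *)
pose u t : {poly {mpoly K[n]}} :=
  if unlift i t is Some k then ('X_(tau k))%:P else 'X.
pose u' t : {poly F} := if unlift i t is Some k then (x (lift i k))%:P else 'X.
pose q := mmap (polyC \o @mpolyC n K) u p.
have qE : map_poly (mmap j x') q = mmap (polyC \o j) u' p.
  apply: (@rmorph_mmap n.+1 K {poly {mpoly K[n]}} {poly F} (map_poly (mmap j x'))
    (polyC \o @mpolyC n K) (polyC \o j)) => [a|t].
    by rewrite /= map_polyC /= mmapC.
  rewrite /u /u'; case: unliftP => [k _|_]; last by rewrite /= map_polyX.
  by rewrite /= map_polyC /= mmapX mmap1U -tauE.
have hor r : (mmap (polyC \o j) u' r).[x i] = mmap j x r.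
  apply: (@rmorph_mmap n.+1 K {poly F} F (horner_eval (x i)) (polyC \o j) j) => [a|t].
    by rewrite /= /horner_eval hornerC.
  by rewrite /= /horner_eval /u'; case: unliftP => [k ->|->];
    rewrite ?hornerC ?hornerX.
apply: (@generically_smooth_step _ _ _ _ _ _ q gs).
  by rewrite /ev qE hor.
rewrite qE.
have -> := @chain_rule n.+1 K {poly F} (polyC \o j) u' (@deriv F) p _ _.
- rewrite (bigD1 i) //= big1 => [|t ti]; last first.
    by rewrite /u'; case: unliftP ti => [k _ _|->]; rewrite ?eqxx // derivC mulr0.
  by rewrite addr0 hornerM hor /u' unlift_none derivX hornerC mulr1.
- by move=> v w; exact: derivM.
- by move=> a; exact: derivC.
Qed.

(* Inverting [d] turns generic smoothness into smoothness everywhere: one adds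
   the variable [Z] and the equation [d Z = 1]. *)
Lemma smooth_localization (K F : fieldType) (j : {rmorphism K -> F}) (n : nat)
    (x : 'I_n -> F) (D : {mpoly K[n]}) :
  generically_smooth j x -> mmap j x D != 0 ->
  exists (z : F) (c : nat) (f : 'I_c -> {mpoly K[n.+1]}) (s : 'I_c -> 'I_n.+1),
  [/\ forall p, mmap j (extend x z) p = 0 <-> span f p,
      gen j (extend x z) (mmap j x D)^-1,
      mmap j (extend x z) (\det (jac f s)) != 0 &
      gen j (extend x z) (mmap j (extend x z) (\det (jac f s)))^-1].
Proof.
move=> [c [f [s [g [f0 J0 g0 gker]]]]] D0.
(* One inverse for three purposes: [D] for the caller, [g] to make the equations complete, the minor
   to make them smooth. *)
have [d dE] : exists d, d = D * g * \det (jac f s).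
  by exists (D * g * \det (jac f s)).
have d0 : mmap j x d != 0 by rewrite dE !rmorphM !mulf_neq0.
pose z := (mmap j x d)^-1; pose h : {poly {mpoly K[n]}} := d%:P * 'X - 1.
pose S := gen j (extend x z).
have Sz : S z by have := gen_gen j (extend x z) ord_max; rewrite extend_max.
have Sx p : S (mmap j x p) by exists (mwiden p); rewrite mmap_mwiden.
have evh : ev j x z h = 0.
  rewrite /ev rmorphB rmorphM /= map_polyC map_polyX rmorph1 !hornerE.
  by rewrite mulfV // subrr.
have dh : h^`() = d%:P.
  by rewrite derivB derivM derivC mul0r add0r derivX mulr1 -[1]/(1%:P) derivC subr0.
have Jz : mmap j (extend x z) (\det (jac (add_eq f h) (add_var s))) =
    mmap j x (\det (jac f s) * d).
  by rewrite mmap_jac_add_eq dh evC rmorphM.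
have wd : mwiden d = mwiden (D * \det (jac f s)) * mwiden g.
  by rewrite dE -mwidenM mulrAC.
exists z, c.+1, (add_eq f h), (add_var s); split.
- move=> p; have [I0 ID IM] := span_ideal (add_eq f h); split; last first.
    move: p; apply: span_sub.
      split=> /=; first exact: rmorph0.
        by move=> a b a0 b0; rewrite rmorphD /= a0 b0 addr0.
      by move=> a b b0; rewrite rmorphM /= b0 mulr0.
    apply: ordS_ind => [k|] /=; rewrite /add_eq ?extend_widen ?extend_max.
      by rewrite mmap_mwiden.
    by rewrite mmap_mlast.
  have [{}p ->] := mlast_surj p; rewrite mmap_mlast -/(ev j x z p) => p0.
  have dn : d != 0 by apply: contraNneq d0 => ->; rewrite rmorph0.
  have sh : size h = 2%N.
    rewrite size_polyDl ?size_polyN ?size_poly1 mul_polyC size_scale // size_polyX //.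
  have lh : lead_coef h = d.
    by rewrite lead_coefE sh coefB coefCM coefX coef1 subr0 mulr1.
  have hn : h != 0 by rewrite -size_poly_eq0 sh.
  have e := Pdiv.Idomain.divp_eq p h; rewrite lh in e.
  set k := scalp p h in e; set r := p %% h in e.
  have rC : r = (r`_0)%:P.
    by apply: size1_polyC; rewrite -ltnS -sh Pdiv.Idomain.ltn_modp.
  have r0 : mmap j x r`_0 = 0.
    rewrite -(evC j x z) -rC; have : ev j x z (d ^+ k *: p) = 0 by rewrite evZ p0 mulr0.
    by rewrite e evD evM evh mulr0 add0r.
  have gr : span (add_eq f h) (mwiden g * mlast r).
    by rewrite rC mlastC -mwidenM; apply/span_add_widen/gker.
  pose T := mwiden d * 'X_ord_max : {mpoly K[n.+1]}.
  have hT : mlast h = T - 1.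
    by rewrite rmorphB rmorphM rmorph1 /= mlastC mlastX.
  have TS m : span (add_eq f h) (T ^+ m - 1).
    rewrite subrX1 -hT mulrC; exact: span_add_last.
  (* With T = dZ, which is 1 modulo [h]: [k] factors pay for the pseudo-division of [p] by [h], and
     one more supplies the factor [g] that puts the remainder into the span. *)
  have main : span (add_eq f h) (T ^+ k.+1 * mlast p).
    rewrite exprS {2}/T exprMn; set X := 'X_ord_max.
    have -> : T * (mwiden d ^+ k * X ^+ k) * mlast p =
        (X ^+ k.+1 * mwiden (D * \det (jac f s))) * (mwiden g * (mwiden d ^+ k * mlast p)).
      set W := mwiden d ^+ k; rewrite /T wd exprS -/X.
      by rewrite [LHS](AC (3*2*1) (3*5*1*(2*(4*6)))).
    apply: (IM); rewrite -(rmorphXn (@mwiden n K)) /= -[mwiden (d ^+ k)]mlastC -rmorphM /= mul_polyC e.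
    rewrite rmorphD mulrDr rmorphM /=; apply: ID => //.
    by rewrite mulrA; exact: span_add_last.
  have -> : mlast p = T ^+ k.+1 * mlast p + (- mlast p) * (T ^+ k.+1 - 1).
    by rewrite mulNr [mlast p * _]mulrC mulrBl mul1r opprB addrC subrK.
  by apply: ID => //; apply: (IM).
- have -> : (mmap j x D)^-1 = mmap j x (g * \det (jac f s)) * z.
    apply: (mulfI D0); by rewrite divff // /z mulrA -rmorphM mulrA -dE divff.
  exact: srM.
- by rewrite Jz rmorphM mulf_neq0.
- rewrite Jz rmorphM invfM; apply: srM => //.
  have -> : (mmap j x (\det (jac f s)))^-1 = mmap j x (D * g) * z.
    by apply: (mulIf J0); rewrite mulVf // /z mulrAC -rmorphM -dE divff.
  exact: srM.
Qed.

(** * First-order formulas *)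

Fixpoint exs (L : language) (n : nat) (psi : formula L) : formula L :=
  if n is m.+1 then Ex m (exs m psi) else psi.

Lemma sat_exs (L : language) (M : structure L) (n : nat) (psi : formula L)
    (v : nat -> M) : sat v (exs n psi) <->
  exists w : nat -> M, (forall k, (n <= k)%N -> w k = v k) /\ sat w psi.
Proof.
elim: n v => [|n IH] v /=.
  split=> [s|[w [wv s]]]; first by exists v.
  by rewrite (_ : v = w) //; apply/funext => k; rewrite wv.
split=> [[x /IH[w [wv s]]]|[w [wv s]]].
  exists w; split=> // k nk; rewrite wv ?(ltnW nk) // /update.
  by rewrite gtn_eqF.
exists (w n); apply/IH; exists w; split=> // k nk.
rewrite /update; case: eqP => [->//|/eqP kn].
by rewrite wv // ltn_neqAle eq_sym kn.
Qed.

Lemma existential_exs (L : language) n (psi : formula L) :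
  qfree psi -> existential (exs n psi).
Proof. by move=> q; elim: n => [|n //]; case: psi q. Qed.

Section RingTerms.
Local Notation term := (term ring_lang).

Definition binop (f : fsym ring_lang) (a b : term) : term :=
  @App ring_lang f (fun i => if (i : nat) == 0%N then a else b).
Definition Tadd := binop Radd.
Definition Tmul := binop Rmul.
Definition Tzero : term := @App ring_lang Rzero (fun=> Var _ 0).
Definition Tone : term := @App ring_lang Rone (fun=> Var _ 0).
Definition Tpow (a : term) (k : nat) : term := iter k (Tmul a) Tone.

Variables (K : fieldType) (n : nat) (cs : seq K).

Definition Tmon (m : 'X_{1..n}) : term :=
  foldr (fun i t => Tmul (Tpow (Var _ (i : 'I_n)) (m i)) t) Tone (enum 'I_n).
(** Ring terms have no names for elements of [K]: the coefficients become parameters, stored in the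
    variables after the [n] unknowns. *)
Definition Tpoly (p : {mpoly K[n]}) : term :=
  foldr (fun m t => Tadd (Tmul (Var _ (n + index p@_m cs)) (Tmon m)) t) Tzero
    (msupp p).

Variables (F : fieldType) (w : nat -> ring_structure F).
Local Notation val t := (tval w t : F).

Lemma val_pow a k : val (Tpow a k) = val a ^+ k.
Proof. by elim: k => [|k IH] //; rewrite exprS -IH. Qed.

Lemma val_mon m : val (Tmon m) = mmap1 (fun i : 'I_n => w i : F) m.
Proof.
rewrite /mmap1 -big_enum /= /Tmon.
elim: (enum 'I_n) => [|i s IH]; first by rewrite big_nil.
by rewrite big_cons -IH -(val_pow (Var ring_lang i)).
Qed.

Lemma val_poly (j : {rmorphism K -> F}) p :
  (forall m, m \in msupp p -> w (n + index p@_m cs) = j p@_m) ->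
  val (Tpoly p) = mmap j (fun i : 'I_n => w i : F) p.
Proof.
rewrite /mmap /Tpoly; elim: (msupp p) => [|m s IH] ws; first by rewrite big_nil.
rewrite big_cons -IH => [|m' ms]; last by apply: ws; rewrite inE ms orbT.
by rewrite -ws ?mem_head // -val_mon.
Qed.

End RingTerms.

Section Systems.
Variables (K : fieldType) (n : nat) (ps : seq {mpoly K[n]}) (q : {mpoly K[n]}).

Definition coefs : seq K := [seq p@_m | p : {mpoly K[n]} <- q :: ps, m <- msupp p].

Definition sys : formula ring_lang :=
  exs n (foldr (fun p phi => Conj (Equal (Tpoly coefs p) Tzero) phi)
    (Neg (Equal (Tpoly coefs q) Tzero)) ps).

Definition sys_val : nat -> ring_structure K := fun k => nth 0 coefs (k - n).

Lemma sys_existential : existential sys.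
Proof. by apply: existential_exs; elim: ps. Qed.

Lemma sat_sys (F : fieldType) (j : {rmorphism K -> F}) :
  @sat _ (ring_structure F) (j \o sys_val) sys <->
  exists x : 'I_n -> F, (forall p, p \in ps -> mmap j x p = 0) /\ mmap j x q != 0.
Proof.
have body (w : nat -> ring_structure F) :
    (forall k, (n <= k)%N -> w k = j (sys_val k)) ->
    sat w (foldr (fun p phi => Conj (Equal (Tpoly coefs p) Tzero) phi)
      (Neg (Equal (Tpoly coefs q) Tzero)) ps) <->
    (forall p, p \in ps -> mmap j (fun i : 'I_n => w i : F) p = 0) /\
    mmap j (fun i : 'I_n => w i : F) q != 0.
  move=> wj; have valE p : p \in q :: ps ->
      tval w (Tpoly coefs p) = mmap j (fun i : 'I_n => w i : F) p.
    move=> pq; apply: val_poly => m mp; rewrite wj ?leq_addr // /sys_val addKn.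
    rewrite nth_index //; apply/allpairsPdep; by exists p, m.
  move: valE; move: coefs => cs; elim: ps => [|p s IH] /= valE.
    by rewrite valE ?mem_head //; split=> [/eqP|[_ /eqP]].
  rewrite valE ?inE ?eqxx ?orbT // IH => [|r]; last first.
    by rewrite inE => rs; apply: valE; rewrite !inE orbCA rs orbT.
  split=> [[p0 [s0 q0]]|[ps0 q0]].
    by split=> // r; rewrite inE => /orP[/eqP ->|/s0].
  split; first by apply: ps0; rewrite mem_head.
  by split=> // r rs; apply: ps0; rewrite inE rs orbT.
rewrite sat_exs; split=> [[w [wv /(body w wv) s]]|[x xs]].
  by exists (fun i => w i).
exists (fun k => if insub k is Some i then x i else j (sys_val k)).
have wE k : (n <= k)%N ->
    (if insub k is Some i then x i else j (sys_val k)) = j (sys_val k).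
  by move=> nk; rewrite insubF // ltnNge nk.
split=> //; apply/body => //.
rewrite (_ : (fun i : 'I_n => _) = x) //.
by apply/funext => i; rewrite valK.
Qed.

End Systems.

Section LiftFormula.
Variable E : language.

Fixpoint lift_term (t : term ring_lang) : term (enrich E) :=
  match t with
  | Var k => Var _ k
  | App f a => @App (enrich E) (inl f) (fun i => lift_term (a i))
  end.

Fixpoint lift_formula (phi : formula ring_lang) : formula (enrich E) :=
  match phi with
  | Equal t u => Equal (lift_term t) (lift_term u)
  | Rel r _ => match (r : void) with end
  | Neg psi => Neg (lift_formula psi)
  | Conj psi chi => Conj (lift_formula psi) (lift_formula chi)
  | Ex n psi => Ex n (lift_formula psi)
  end.

Lemma tval_lift (M : Lfield E) (v : nat -> M) t :
  @tval _ (Lstruct M) v (lift_term t) = @tval _ (ring_structure M) v t.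
Proof.
elim: t => [//|f a IH] /=.
by congr ring_interp; apply/funext => i; exact: IH.
Qed.

Lemma sat_lift (M : Lfield E) (v : nat -> M) phi :
  @sat _ (Lstruct M) v (lift_formula phi) <-> @sat _ (ring_structure M) v phi.
Proof.
elim: phi v => [t u|[]|psi IH|psi IH1 chi IH2|n psi IH] v /=.
- by rewrite !tval_lift.
- by split=> h /IH.
- by rewrite IH1 IH2.
- by split=> -[x] h; exists x; apply/IH.
Qed.

Lemma embedding_rmorph (K M : Lfield E) (e : Lstruct K -> Lstruct M) :
  embedding e -> exists i : {rmorphism K -> M}, (i : K -> M) = e.
Proof.
move=> [_ ef _].
have eD (a b : K) : e (a + b) = (e a : M) + e b.
  exact: (ef (inl Radd) (fun i => if (i : nat) == 0%N then a else b)).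
have eN (a : K) : e (- a) = - (e a : M) by exact: (ef (inl Ropp) (fun=> a)).
have eM (a b : K) : e (a * b) = (e a : M) * e b.
  exact: (ef (inl Rmul) (fun i => if (i : nat) == 0%N then a else b)).
have e1 : e (1 : K) = (1 : M) by exact: (ef (inl Rone) (fun=> 0)).
have [i iE] : exists i : {rmorphism K -> M}, forall a, i a = e a.
  by apply: (@rmorph_ex K M e) => // a b; rewrite eD eN.
by exists i; apply/funext.
Qed.

Lemma elementary_system (K F : fieldType) (M N : Lfield E)
    (j : {rmorphism K -> F}) (i : {rmorphism K -> M})
    (e : Lstruct M -> Lstruct N) (g : {rmorphism F -> N})
    (n : nat) (ps : seq {mpoly K[n]}) (x : 'I_n -> F) :
  elementary e -> (forall c, g (j c) = e (i c)) ->
  (forall p, p \in ps -> mmap j x p = 0) ->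
  exists m : 'I_n -> M, forall p, p \in ps -> mmap i m p = 0.
Proof.
move=> el gj xps.
(* The inequation of the system is filled with the trivial one, that 1 is nonzero. *)
have : @sat _ (ring_structure N) ((g \o j) \o sys_val ps 1) (sys ps 1).
  apply/sat_sys; exists (g \o x); split; last by rewrite rmorph1 oner_neq0.
  move=> p /xps p0; rewrite -(@rmorph_mmap _ _ _ _ g j (g \o j) x) //.
  by rewrite p0 rmorph0.
rewrite (_ : (g \o j) \o sys_val ps 1 = e \o (i \o sys_val ps 1)); last first.
  by apply/funext => k /=; exact: gj.
by move=> /sat_lift /el /sat_lift /sat_sys[m [mp _]]; exists m.
Qed.

End LiftFormula.

Section QuantifierFree.
Variables (F : fieldType) (w : nat -> ring_structure F).

Lemma tval_subring (S : subring F) : (forall k, S (w k)) ->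
  forall t, S (tval w t).
Proof.
move=> Sw; elim=> [k|f a IH]; first exact: Sw.
case: f a IH => a IH /=.
- exact: srD.
- exact: srN.
- exact: srM.
- exact: sr0.
- exact: sr1.
Qed.

Lemma tval_hom (S : subring F) (M : fieldType) (h : {rmorphism sr_ring S -> M}) :
  (forall k, S (w k)) -> forall t,
  @tval _ (ring_structure M) (fun k => h (srmk S (w k))) t = h (srmk S (tval w t)).
Proof.
move=> Sw; elim=> [//|f a IH].
have Sa i := tval_subring Sw (a i).
case: f a IH Sa => a IH Sa /=.
- by rewrite !IH -rmorphD; congr (h _); apply: srval_inj; rewrite srvalD !srmkK //; exact: srD.
- rewrite !IH -rmorphN; congr (h _); apply: srval_inj; rewrite -sub0r srvalB.
  by rewrite !srmkK ?sub0r //; exact: srN.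
- by rewrite !IH -rmorphM; congr (h _); apply: srval_inj; rewrite srvalM !srmkK //; exact: srM.
- by rewrite -[LHS](rmorph0 h); congr (h _); apply: srval_inj; rewrite srmkK //; exact: sr0.
- by rewrite -[LHS](rmorph1 h); congr (h _); apply: srval_inj; rewrite srmkK //; exact: sr1.
Qed.

(* [d] is the product of the differences that a homomorphism must not kill in
   order to preserve the inequations of [psi]. *)
Lemma qfree_transfer (psi : formula ring_lang) : qfree psi ->
  exists d : F, [/\ d != 0, forall S : subring F, (forall k, S (w k)) -> S d &
    forall (S : subring F) (M : fieldType) (h : {rmorphism sr_ring S -> M}),
      (forall k, S (w k)) -> S d^-1 ->
      (sat w psi <-> @sat _ (ring_structure M) (fun k => h (srmk S (w k))) psi)].
Proof.
elim: psi => [t u _|[]|psi IH /IH|psi IH1 chi IH2 /= /andP[/IH1 h1 /IH2 h2]|//].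
(* A true equation survives every homomorphism; a false one stays false once its difference is made
   invertible. *)
- have [tu|tu] := pselect (tval w t = tval w u).
    exists 1; split; [exact: oner_neq0|by move=> S _; exact: sr1|].
    by move=> S M h Sw _ /=; rewrite !tval_hom // tu.
  pose d : F := tval w t - tval w u.
  have d0 : d != 0 by rewrite subr_eq0; exact/eqP.
  exists d; split=> //.
    by move=> S Sw; apply: srB; exact: tval_subring.
  move=> S M h Sw Sd /=; rewrite !tval_hom //; split=> [//|e].
  have [St Su] := (tval_subring Sw t, tval_subring Sw u).
  have Sd' : S d by exact: srB.
  have ud : srmk S d \is a GRing.unit by apply/srval_unit; rewrite srmkK.
  have : h (srmk S d) != 0 by rewrite -unitfE rmorph_unit.
  rewrite (_ : srmk S d = srmk S (tval w t) - srmk S (tval w u)); last first.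
    by apply: srval_inj; rewrite srvalB !srmkK.
  by rewrite rmorphB e subrr eqxx.
- move=> [d [d0 Sd H]]; exists d; split=> // S M h Sw Sd' /=.
  by have := H S M h Sw Sd' => -> .
- move: h1 h2 => [d [d0 Sd H1]] [d' [d'0 Sd' H2]]; exists (d * d').
  split; first exact: mulf_neq0.
    by move=> S Sw; apply: srM; [exact: Sd|exact: Sd'].
  move=> S M h Sw Sdd /=; rewrite (H1 S M h Sw); first rewrite (H2 S M h Sw) //.
    have -> : d'^-1 = d * (d * d')^-1 by rewrite invfM mulrA mulfV // mul1r.
    by apply: srM => //; exact: Sd.
  have -> : d^-1 = d' * (d * d')^-1 by rewrite mulrC invfM mulfVK.
  by apply: srM => //; exact: Sd'.
Qed.

End QuantifierFree.

Lemma existential_strip (phi : formula ring_lang) : existential phi ->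
  exists (bs : seq nat) (psi : formula ring_lang), qfree psi /\
    forall (F : fieldType) (v : nat -> ring_structure F),
      sat v phi <-> exists w : nat -> ring_structure F,
        (forall k, k \notin bs -> w k = v k) /\ sat w psi.
Proof.
have base psi : qfree psi ->
  exists (bs : seq nat) (psi0 : formula ring_lang), qfree psi0 /\
    forall (F : fieldType) (v : nat -> ring_structure F),
      sat v psi <-> exists w : nat -> ring_structure F,
        (forall k, k \notin bs -> w k = v k) /\ sat w psi0.
  move=> q; exists [::], psi; split=> // F v.
  split=> [s|[w [wv s]]]; first by exists v.
  by rewrite (_ : v = w) //; apply/funext => k; rewrite wv.
elim: phi => [t u|r a|psi _|psi _ chi _|n psi IH] ex; try exact: base.
have [bs [psi0 [q H]]] := IH ex; exists (n :: bs), psi0; split=> // F v /=.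
split=> [[x /H[w [wv s]]]|[w [wv s]]].
  exists w; split=> // k; rewrite inE negb_or => /andP[kn kbs].
  by rewrite wv // /update (negPf kn).
exists (w n); apply/H; exists w; split=> // k kbs; rewrite /update.
by case: eqP => [->//|/eqP kn]; rewrite wv // inE negb_or kn.
Qed.

(** * The equivalences *)

Section AffineToIII.
Variables (E : language) (T : set (formula (enrich E))) (K : Lfield E).
Hypothesis affine_point : forall V : variety K, affine V ->
  geometrically_integral V -> totally_variety T V -> rational_points V !=set0.

Lemma affine_points_existentially_closed (F : fieldType) (j : {rmorphism K -> F}) :
  regular_extension j -> totally_extension T j -> existentially_closed j.
Proof.
move=> reg tot phi v ex sF.
have [bs [psi [qf strip]]] := existential_strip ex.
have [w [wv sw]] := (strip F (j \o v)).1 sF.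
have [d [d0 Sd dtr]] := qfree_transfer w qf.
(* Only the bound variables can take values outside the image of [K]. *)
pose x (t : 'I_(size bs)) : F := w (nth 0%N bs t).
have [x' [x'r gs]] := regular_generically_smooth x reg.
have wgen k : gen j x' (w k).
  have [kbs|kbs] := boolP (k \in bs); last by rewrite wv //; exact: gen_base.
  have kn : (index k bs < size bs)%N by rewrite index_mem.
  have := x'r (Ordinal kn); rewrite /x /= nth_index // => -[t' ->].
  exact: gen_gen.
have [D dD] := Sd _ wgen.
have D0 : mmap j x' D != 0 by rewrite -dD.
have [z [c [f [s [ker SD J0 SJ]]]]] := smooth_localization gs D0.
pose X := extend x' z.
have wS k : gen j X (w k).
  by have [p ->] := wgen k; exists (mwiden p); rewrite mmap_mwiden.
pose V := gen_variety j X.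
(* The Jacobian minor is a unit of the coordinate ring, so it lies in no prime. *)
have smoothV (y : V) : smooth_at y.
  apply: (gen_smooth (f := f) (s := s)) => // yJ.
  have py := pt_prime (y : spec (gen j X)).
  apply: (po_1 py); rewrite -(mulVf J0); exact: (po_Ml py).
have [y [h _]] : rational_points V !=set0.
  apply: affine_point; [exact: gen_affine|exact: gen_geometrically_integral|].
  move=> M iota modM emb; have [i iE] := embedding_rmorph emb.
  have [N [e [g [el gj]]]] := tot M iota modM emb.
  rewrite -iE in gj *.
  have [|m mf] := @elementary_system E K F M N j i e g _ [seq f k | k <- enum 'I_c] X el gj.
    by move=> _ /mapP[k _ ->]; apply/ker; exact: span_gen.
  have [|h _] := @gen_point K F j _ X M i m.
    move=> p /ker[r ->]; rewrite rmorph_sum big1 // => k _.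
    rewrite rmorphM /= (mf (f k)) ?mulr0 //.
    by apply/mapP; exists k; rewrite ?mem_enum.
  by exists h; exact: smoothV.
(* The [K]-point becomes a retraction [chi] of the coordinate ring onto [K]. As [d] is invertible
   there, [chi] preserves [psi]. *)
have [m [mker _]] := point_gen (i := idfun) h.
have [|chi chiE] := @factor_rmorph _ (sr_ring (gen j X)) K
  (mmap (gen_scalar j X) (gen_var j X)) (mmap idfun m) (@gen_surj _ _ j _ X).
  by move=> p /(congr1 (@srval _ _)); rewrite srval_gen => /mker.
have chij a : chi (srmk (gen j X) (j a)) = a.
  rewrite (_ : srmk _ _ = mmap (gen_scalar j X) (gen_var j X) a%:MP).
    by rewrite chiE /= mmapC.
  by apply: srval_inj; rewrite srval_gen mmapC srmkK //; exact: gen_base.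
have Sd1 : gen j X d^-1 by rewrite dD.
have sK := (dtr (gen j X) K chi wS Sd1).1 sw.
apply/strip; exists (fun k => chi (srmk (gen j X) (w k))); split=> // k kbs.
by rewrite wv //= chij.
Qed.

End AffineToIII.

Lemma prime_containing (A : comNzRingType) (I : set A) :
  is_ideal I -> ~ I 1 -> exists P, prime_set P /\ I `<=` P.
Proof.
move=> iI I1; have I0 : I 0 by case: iI.
pose good : set (set A) :=
  [set J | J = set0 \/ [/\ is_ideal J, I `<=` J & ~ J 1]].
have [|P [Pgood Pmax]] := @Zorn_bigcup A good.
  move=> C Cgood Ctot.
  have [[J0 [CJ0 J0n]]|nC] := pselect (exists J, C J /\ J !=set0); last first.
    left; apply/seteqP; split=> // a [J CJ Ja]; apply: nC; exists J; split=> //.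
    by exists a.
  have Cideal J a : C J -> J a -> [/\ is_ideal J, I `<=` J & ~ J 1].
    by move=> CJ Ja; case: (Cgood J CJ) => // J_0; rewrite J_0 in Ja.
  have [a0 J0a] := J0n; have [iJ0 IJ0 _] := Cideal J0 a0 CJ0 J0a.
  right; split.
  - split; first by exists J0 => //; case: iJ0.
      move=> a b [J CJ Ja] [J' CJ' J'b].
      have [JJ'|J'J] := Ctot J J' CJ CJ'.
        exists J' => //; have [[_ JD _] _ _] := Cideal J' b CJ' J'b.
        by apply: JD => //; exact: JJ'.
      exists J => //; have [[_ JD _] _ _] := Cideal J a CJ Ja.
      by apply: JD => //; exact: J'J.
    move=> a b [J CJ Jb]; exists J => //.
    by have [[_ _ JM] _ _] := Cideal J b CJ Jb; exact: JM.
  - by move=> a /IJ0 Ja; exists J0.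
  - by move=> [J CJ J1]; have [_ _] := Cideal J 1 CJ J1.
have {Pgood} [P0|[iP IP P1]] := Pgood.
  exfalso; apply: (Pmax I); last by right; split.
  by rewrite P0 properEneq; split=> //; apply/eqP => e; rewrite -e in I0.
exists P; split=> //; case: (iP) => P0 PD PM; split=> //.
- by move=> a b Pa Pb; apply: PD => //; rewrite -mulN1r; exact: PM.
move=> a b Pab; have [Pa|nPa] := pselect (P a); first by left.
right; pose Q : set A := [set q | exists r p, P p /\ q = r * a + p].
have iQ : is_ideal Q.
  split; first by exists 0, 0; rewrite mul0r addr0.
    move=> _ _ [r [p [Pp ->]]] [r' [p' [Pp' ->]]]; exists (r + r'), (p + p').
    by split; [exact: PD|rewrite mulrDl addrACA].
  move=> c _ [r [p [Pp ->]]]; exists (c * r), (c * p).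
  by split; [exact: PM|rewrite mulrDr mulrA].
have PQ : P `<=` Q by move=> p Pp; exists 0, p; rewrite mul0r add0r.
have Qa : Q a by exists 1, 0; rewrite mul1r addr0.
have [[r [p [Pp e]]]|Q1] := pselect (Q 1).
  rewrite -[b]mul1r e mulrDl; apply: (PD); first by rewrite -mulrA; exact: PM.
  by rewrite mulrC; exact: PM.
exfalso; apply: (Pmax Q); last first.
  by right; split=> //; exact: subset_trans PQ.
by split=> // QP; apply: nPa; exact: QP.
Qed.

(** If the annihilator of [a] were proper, it would lie in a prime; but at the corresponding point
    [a] is killed by an element outside that prime. *)
Lemma ao_section_eq0 (X : lrSpace) (U : set X) (A : comNzRingType)
    (phi : A -> forall x : X, stalk x) a :
  affine_open U phi -> (forall x, U x -> phi a x = 0) -> a = 0.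
Proof.
move=> aU a0; pose I : set A := [set b | b * a = 0].
have iI : is_ideal I.
  split; rewrite /I /=; first by rewrite mul0r.
    by move=> b c b0 c0; rewrite mulrDl b0 c0 addr0.
  by move=> b c c0; rewrite -mulrA c0 mulr0.
have [|I1] := pselect (I 1); first by rewrite /I /= mul1r.
have [P [[P0 P1 PB PM PP] IP]] := prime_containing iI I1.
pose Pp : pred A := fun b => `[< P b >].
have [||x [[Ux xP] _]] := ao_prime aU (P := Pp).
- split; [exact/asboolP|exact/asboolP|].
  move=> b u v /asboolP Pu /asboolP Pv; apply/asboolP.
  by rewrite -[v]opprK; apply: (PB); [exact: PM|rewrite -sub0r; exact: PB].
- by move=> u v /asboolP /PP [?|?]; apply/orP; [left|right]; apply/asboolP.
have [b ub ba] := ao_ker aU Ux (a0 x Ux).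
have : b \in Pp by apply/asboolP/IP.
by rewrite xP ub.
Qed.

Section FunctionField.
Variables (K : fieldType) (V : variety K) (y : V) (F : fieldType).
Variable g : {rmorphism stalk y -> F}.
Hypotheses (gen_y : generic_point y) (bij_g : bijective g).

Lemma generic_in (U : set V) : open U -> U !=set0 -> U y.
Proof. by move=> oU U0; have [z [Uz <-]] := gen_y U0 oU. Qed.

Variables (U : set V) (A : comNzRingType) (k : {rmorphism K -> A}).
Variables (phi : A -> forall x : V, stalk x).
Hypotheses (cU : affine_chart U k phi) (U0 : U !=set0).

Let aU := cU.1.
Let Uy : U y := generic_in (ao_open aU) U0.

Lemma chart_to_field : exists r : {rmorphism A -> F},
  [/\ forall a, r a = g (phi a y), forall c, r (k c) = g (kscalar y c),
      forall a, r a = 0 -> a = 0 &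
      forall z, exists a b, r b != 0 /\ z = r a / r b].
Proof.
have [r rE] : exists r : {rmorphism A -> F}, forall a, r a = g (phi a y).
  apply: rmorph_ex => [a b||a b].
  - by rewrite (ao_B aU _ _ Uy) rmorphB.
  - by rewrite (ao_1 aU Uy) rmorph1.
  - by rewrite (ao_M aU _ _ Uy) rmorphM.
have g_eq0 s : g s = 0 -> s = 0.
  by move=> gs; apply: (bij_inj bij_g); rewrite gs rmorph0.
exists r; split=> //.
- by move=> c; rewrite rE cU.2.
- move=> a; rewrite rE => /g_eq0 a0.
  (* A product that is zero on [U], with [b] a unit at the generic point: integrality leaves only
     that [a] vanishes on [U]. *)
  have [b ub ba] := ao_ker aU Uy a0.
  have [_ [_ int] _] := varietyP V.
  have [|b0|z0] := int U (phi b) (phi a) (ao_open aU) U0 (ao_sect aU b) (ao_sect aU a).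
  + by move=> x Ux; rewrite -(ao_M aU _ _ Ux) ba (ao_0 aU Ux).
  + by move: ub; rewrite b0 // unitr0.
  exact: (ao_section_eq0 aU).
- move=> z; have [g' _ gK] := bij_g.
  have [a [b [ub sab]]] := ao_frac aU (g' z) Uy.
  exists a, b; rewrite !rE -(gK z) sab rmorphM rmorphV //; split=> //.
  by rewrite -unitfE rmorph_unit.
Qed.

End FunctionField.

Section FunctionFieldTotal.
Variables (E : language) (T : set (formula (enrich E))).
Hypothesis large_models : forall M : Lfield E, models (Lstruct M) T -> large M.
Variables (K : Lfield E) (V : variety K) (y : V) (F : fieldType).
Variable g : {rmorphism stalk y -> F}.
Hypotheses (gen_y : generic_point y) (bij_g : bijective g).
Hypothesis reg : regular_extension (g \o @kscalar K V y).
Let j : {rmorphism K -> F} := g \o kscalar y.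

Lemma dense_specialization (M : fieldType) (i : {rmorphism K -> M}) :
  large M -> smooth_points V i !=set0 ->
  exists (n : nat) (x : 'I_n -> F),
    (forall z, exists a b, mmap j x b != 0 /\ z = mmap j x a / mmap j x b) /\
    forall q, mmap j x q != 0 -> exists m : 'I_n -> M,
      (forall p, mmap j x p = 0 -> mmap i m p = 0) /\ mmap i m q != 0.
Proof.
move=> lM [h [U [A [k [phi [n [c [t [f [cU Uh surj ker [s sJ]]]]]]]]]]].
have [r [rE rk r0 rfrac]] := chart_to_field gen_y bij_g cU (ex_intro _ _ Uh).
pose x := r \o t.
have xE p : mmap j x p = r (mmap k t p).
  by symmetry; apply: rmorph_mmap.
have kerx p : mmap j x p = 0 <-> span f p.
  by rewrite xE; split=> [/r0/ker//|/ker ->]; rewrite rmorph0.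
exists n, x; split.
  move=> z; have [a [b [b0 ->]]] := rfrac z.
  have [[pa <-] [pb pbE]] := (surj a, surj b).
  by exists pa, pb; rewrite !xE pbE.
have [L [al [be [al_be disj]]]] := free_compositum i reg.
have kerL := kernel_base_change al_be disj kerx.
pose X := al \o x; pose W := gen_variety be X.
(* The given point in chart coordinates. Having no new relations, [W] contains it too, and the same
   minor is invertible there. *)
have [gA [gAE gAk]] := hom_of_point cU Uh.
pose m := gA \o t.
have mE p : mmap idfun m (map_mpoly i p) = gA (mmap k t p).
  by rewrite mmap_map_mpoly; symmetry; apply: rmorph_mmap.
have mker P : mmap be X P = 0 -> mmap idfun m P = 0.
  move=> /kerL[G ->]; rewrite rmorph_sum big1 // => l _.
  rewrite rmorphM /= mE; have -> : mmap k t (f l) = 0.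
    by apply/ker; exact: span_gen.
  by rewrite rmorph0 mulr0.
have [w wE] := gen_point (i := idfun) mker.
have dW : dense (rational_points W).
  apply: lM; exists w.
  apply: (gen_smooth (f := fun l => map_mpoly i (f l)) (s := s) kerL).
  rewrite wE => J0; move: sJ.
  have -> : (\matrix_(a, b) phi (mmap k t (mderiv (s b) (f a))) (point_center h)) =
      map_mx (fun a => phi a (point_center h))
        (map_mx (mmap k t) (\matrix_(a, b) mderiv (s b) (f a))).
    by apply/matrixP => a b; rewrite !mxE.
  have [e eE] : exists e : {rmorphism A -> stalk (point_center h)},
      forall a, e a = phi a (point_center h).
    have aU := cU.1.
    apply: rmorph_ex => [a b||a b].
    - by rewrite (ao_B aU _ _ Uh).
    - by rewrite (ao_1 aU Uh).
    - by rewrite (ao_M aU _ _ Uh).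
  rewrite -(funext eE) !det_map_mx eE -(@hstalk_unit _ _ (point_map h) tt).
  rewrite -gAE unitfE -mE; move/eqP; apply.
  rewrite -[RHS]J0 -det_map_mx; congr (mmap _ _ (\det _)).
  by apply/matrixP => a b; rewrite !mxE mderiv_map_mpoly.
move=> q q0; pose iq := map_mpoly i q.
(* The open set contains the generic point of [W], as [q] does not vanish at [x] and [al] is
   injective. *)
have [||v [nv [h' h'v]]] := dW [set v : W | ~ in_pt v (mmap be X iq)].
- exists (spec_generic (gen be X)) => /eqP.
  by rewrite (mmap_base_change al_be) fmorph_eq0 (negPf q0).
- exact: gen_basic_open.
have [m' [m'ker m'E]] := point_gen (i := idfun) h'.
have m'i p : mmap idfun m' (map_mpoly i p) = mmap i m' p.
  by rewrite mmap_map_mpoly.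
exists m'; split=> [p p0|].
  rewrite -m'i; apply: m'ker; rewrite (mmap_base_change al_be) p0; exact: rmorph0.
by rewrite -m'i; apply/eqP => /m'E; rewrite h'v.
Qed.

(** For each finite list of elements of [F] some M-point avoids the zeros of all their denominators.
    Evaluation at these points becomes a homomorphism in the ultrapower over lists. *)
Lemma function_field_totally : totally_variety T V -> totally_extension T j.
Proof.
move=> tot M iota modM emb; have [i iE] := embedding_rmorph emb.
have := tot M iota modM emb; rewrite -iE => smooth_pt.
have [n [x [xfrac spec_x]]] := dense_specialization (large_models modM) smooth_pt.
have frac_ex z : exists ab : {mpoly K[n]} * {mpoly K[n]},
    mmap j x ab.2 != 0 /\ z = mmap j x ab.1 / mmap j x ab.2.
  by have [a [b ab]] := xfrac z; exists (a, b).
have [fr frE] := choice frac_ex.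
have theta_ex (c : seq F) : exists m : 'I_n -> M,
    (forall p, mmap j x p = 0 -> mmap i m p = 0) /\
    forall z, z \in c -> mmap i m (fr z).2 != 0.
  have [|m [m0 mq]] := spec_x (\prod_(z <- c) (fr z).2).
    by rewrite rmorph_prod prodf_seq_neq0; apply/allP => z _; case: (frE z).
  exists m; split=> // z zc; move: mq; rewrite rmorph_prod prodf_seq_neq0.
  by move=> /allP; exact.
have [mm mmE] := choice theta_ex.
pose theta c z : M := mmap i (mm c) (fr z).1 / mmap i (mm c) (fr z).2.
(* The value is independent of the fraction as soon as both denominators survive. *)
have thetaE c z a b : z \in c -> mmap j x b != 0 -> mmap i (mm c) b != 0 ->
    z = mmap j x a / mmap j x b -> theta c z = mmap i (mm c) a / mmap i (mm c) b.
  move=> zc b0 mb0 zab; have [mker mden] := mmE c; have [f0 zf] := frE z.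
  apply/eqP; rewrite eqr_div ?mden // -!rmorphM -subr_eq0 -rmorphB; apply/eqP.
  apply: mker; rewrite rmorphB !rmorphM /=; apply/eqP; rewrite subr_eq0.
  by rewrite -eqr_div // -zf -zab.
have [U [uU Umem]] := ultra_seq F.
have FU : Filter U by apply: ultra_proper.
pose I : pointedType := HB.pack (seq F) (isPointed.Build (seq F) [::]).
have [N [p [pE el]]] := @ultrapower_Lfield I U uU E M.
have [||| G GE] := @ultra_rmorph F M I U N p theta FU pE.
- move=> u v; apply: filterS (filterI (Umem u) (filterI (Umem v) (Umem (u - v)))).
  move=> c [uc [vc uvc]]; have [mker mden] := mmE c.
  have [[fu0 uE] [fv0 vE]] := (frE u, frE v).
  rewrite /= (@thetaE c (u - v) ((fr u).1 * (fr v).2 - (fr v).1 * (fr u).2)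
    ((fr u).2 * (fr v).2)) //.
  + rewrite /theta -[X in _ = _ + X]mulNr addf_div ?mden //.
    by rewrite rmorphB !rmorphM mulNr.
  + by rewrite rmorphM mulf_neq0.
  + by rewrite rmorphM mulf_neq0 ?mden.
  + rewrite {1}uE {1}vE -[X in _ + X = _]mulNr addf_div //.
    by rewrite rmorphB !rmorphM mulNr.
- apply: filterS (Umem 1) => c c1 /=.
  by rewrite (@thetaE c 1 1 1) ?rmorph1 ?oner_neq0 // divr1.
- move=> u v; apply: filterS (filterI (Umem u) (filterI (Umem v) (Umem (u * v)))).
  move=> c [uc [vc uvc]]; have [mker mden] := mmE c.
  have [[fu0 uE] [fv0 vE]] := (frE u, frE v).
  rewrite /= (@thetaE c (u * v) ((fr u).1 * (fr v).1) ((fr u).2 * (fr v).2)) //.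
  + by rewrite /theta !rmorphM mulf_div.
  + by rewrite rmorphM mulf_neq0.
  + by rewrite rmorphM mulf_neq0 ?mden.
  + by rewrite {1}uE {1}vE !rmorphM mulf_div.
exists N, (fun m => p (fun=> m)), G; split=> // c.
rewrite GE; apply/pE; apply: filterS (Umem (j c)) => d dc /=.
rewrite (@thetaE d (j c) c%:MP 1) ?rmorph1 ?oner_neq0 // ?divr1 ?mmapC //.
Qed.

End FunctionFieldTotal.

Section Density.
Variables (K : fieldType) (V : variety K) (y : V) (F : fieldType).
Variable g : {rmorphism stalk y -> F}.
Hypotheses (gen_y : generic_point y) (bij_g : bijective g).
Let j : {rmorphism K -> F} := g \o kscalar y.

Lemma existentially_closed_dense : existentially_closed j ->
  dense (rational_points V).
Proof.
move=> ec O [x0 Ox0] oO.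
have [_ _ [e [Us [cov ft]]]] := varietyP V.
have [l Ux0] := cov x0; pose U := Us l; rewrite -/U in Ux0; have [A [k [phi [n [t [cU surj]]]]]] := ft l.
have aU := cU.1; have oU := ao_open aU.
have [r [rE rk r0 _]] := chart_to_field gen_y bij_g cU (ex_intro _ _ Ux0).
(* The open set is shrunk to a basic one in a chart, given by a single function [a]. *)
have [|I OI] := (ao_top aU (W := O `&` U) (@subIsetr _ _ _)).1.
  exact: openI.
have := conj Ox0 Ux0; rewrite -[_ /\ _]/((O `&` U) x0) OI => -[_ [a Ia ua]].
have oD : open (U `&` [set x | exists2 b, [set a] b & phi b x \is a GRing.unit]).
  by apply/(ao_top aU) => [z []//|]; exists [set a].
have [|Uy [_ /= -> uy]] := generic_in gen_y oD.
  by exists x0; split=> //; exists a.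
have ra : r a != 0 by rewrite rE -unitfE rmorph_unit.
have [c [f ker]] := kernel_fg (mmap k t) (@noetherian_mpoly K n).
have [q qa] := surj a.
have xE p : mmap j (r \o t) p = r (mmap k t p).
  by symmetry; apply: rmorph_mmap.
pose ps := [seq f i | i <- enum 'I_c].
(* The generic point solves the chart equations in [F] with [q], a polynomial representing [a],
   nonzero; existential closedness brings a solution down to [K]. *)
have : @sat _ (ring_structure K) (idfun \o sys_val ps q) (sys ps q).
  apply: ec; first exact: sys_existential.
  apply/sat_sys; exists (r \o t); split; last by rewrite xE qa.
  move=> _ /mapP[i _ ->]; rewrite xE; have -> : mmap k t (f i) = 0.
    by apply/ker; exact: span_gen.
  exact: rmorph0.
move=> /sat_sys[m [mps mq]].
have [|chi chiE] := @factor_rmorph _ A K (mmap k t) (mmap idfun m) surj.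
  move=> p /ker[h ->]; rewrite rmorph_sum big1 // => i _.
  rewrite rmorphM /= (mps (f i)) ?mulr0 //.
  by apply/mapP; exists i; rewrite ?mem_enum.
have chik b : chi (k b) = b by have := chiE b%:MP; rewrite /= !mmapC.
have [h [Uh hE]] := point_of_hom cU chik.
exists (point_center h); split; last by exists h.
suff : (O `&` U) (point_center h) by case.
rewrite OI; split=> //; exists a => //.
by rewrite -(@hstalk_unit _ _ (point_map h) tt) hE unitfE -qa chiE.
Qed.

End Density.

Theorem proposition3p3 (E : language) (T : set (formula (enrich E)))
    (T_sentences : T `<=` @sentence (enrich E))
    (T_large_fields : theory_of_large_fields T)
    (K : Lfield E) :
  [<->
   (* (i) *)
   forall V : variety K,
     geometrically_integral V -> totally_variety T V ->
     rational_points V !=set0;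
   (* (ii) *)
   forall V : variety K,
     geometrically_integral V -> totally_variety T V ->
     dense (rational_points V);
   (* (iii) *)
   forall (F : fieldType) (j : {rmorphism K -> F}),
     regular_extension j -> totally_extension T j -> existentially_closed j;
   (* (i) restricted to affine varieties *)
   forall V : variety K, affine V ->
     geometrically_integral V -> totally_variety T V ->
     rational_points V !=set0;
   (* (ii) restricted to affine varieties *)
   forall V : variety K, affine V ->
     geometrically_integral V -> totally_variety T V ->
     dense (rational_points V)].
Proof.
have a_iii := @affine_points_existentially_closed E T K.
have iii_ii : (forall (F : fieldType) (j : {rmorphism K -> F}),
    regular_extension j -> totally_extension T j -> existentially_closed j) ->
    forall V : variety K, geometrically_integral V -> totally_variety T V ->
    dense (rational_points V).
  move=> iii V [y [F [g [gen_y bij_g reg]]]] totV.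
  apply: (existentially_closed_dense gen_y bij_g); apply: iii => //.
  exact: (function_field_totally T_large_fields.2).
have ii_i (V : variety K) :
    dense (rational_points V) -> rational_points V !=set0.
  move=> dV; have [_ [[x _] _] _] := varietyP V.
  by have [||y [_ Vy]] := dV setT; [exists x|exact: openT|exists y].
tfae.
- move=> i; apply/iii_ii/a_iii => V _; exact: i.
- move=> ii; apply: a_iii => V _ giV totV; exact/ii_i/ii.
- move=> iii V _ giV totV; exact/ii_i/iii_ii.
- move=> i_aff V _; exact/iii_ii/a_iii.
- move=> ii_aff V giV totV; apply/ii_i; move: V giV totV; apply/iii_ii/a_iii.
  by move=> V aV giV totV; exact/ii_i/ii_aff.
Qed.
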